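(* Let $f,\widetilde f:\mathbb{R}/\mathcal{L}\mathbb{Z}\to\mathbb{R}^n$ be arc-length parametrizations of two embedded closed curves with the same total length $\mathcal{L}$, satisfying $\mathcal{E}_0(f)<\infty$ and $\mathcal{E}_0(\widetilde f)<\infty$. For $a\in\mathbb{R}/\mathcal{L}\mathbb{Z}$, set $\widetilde f_a(\cdot)=\widetilde f(\cdot+a)$ and $\widetilde X_a=\log\dfrac{|\Delta s|^2}{\|\Delta\widetilde f_a\|^2}$. Then $$\left|\mathcal{E}_1(f)-\mathcal{E}_1(\widetilde f)\right|\le\left|\mathcal{E}_0(f)-\mathcal{E}_0(\widetilde f)\right|+2\inf_{a\in\mathbb{R}/\mathcal{L}\mathbb{Z}}\left\{\|X-\widetilde X_a\|_{L^\infty}\left(\mathcal{E}_0(f)+\mathcal{E}_0(\widetilde f)+4\right)+\left|\iint_{(\mathbb{R}/\mathcal{L}\mathbb{Z})^2}\frac{X-\widetilde X_a}{|\Delta s|^2}\,ds_1ds_2\right|\right\},$$ $$\left|\mathcal{E}_2(f)-\mathcal{E}_2(\widetilde f)\right|\le 2\inf_{a\in\mathbb{R}/\mathcal{L}\mathbb{Z}}\left\{\|X-\widetilde X_a\|_{L^\infty}\left(\mathcal{E}_0(f)+\mathcal{E}_0(\widetilde f)+4\right)+\left|\iint_{(\mathbb{R}/\mathcal{L}\mathbb{Z})^2}\frac{X-\widetilde X_a}{|\Delta s|^2}\,ds_1ds_2\right|\right\}.$$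
   Context: For an arc-length parametrization $f:\mathbb{R}/\mathcal{L}\mathbb{Z}\to\mathbb{R}^n$ of an embedded closed curve of total length $\mathcal{L}$, let $\tau=f'$ be its unit tangent (defined a.e.). Write $\Delta f=f(s_1)-f(s_2)$, $\Delta\tau=\tau(s_1)-\tau(s_2)$, and let $|\Delta s|=\mathrm{dist}_{\mathbb{R}/\mathcal{L}\mathbb{Z}}(s_1,s_2)$ be the intrinsic distance (shortest distance along the curve); similarly for $\widetilde f$. Conformal angle: let $C_{12}$ be the circle tangent to the curve at $f(s_1)$ and passing through $f(s_2)$ (oriented by $\tau(s_1)$ at $f(s_1)$), and $C_{21}$ the circle tangent to the curve at $f(s_2)$ and passing through $f(s_1)$ (oriented by $\tau(s_2)$ at $f(s_2)$); $\varphi=\varphi(s_1,s_2)$ is the angle between these circles at $f(s_1)$ (equivalently at $f(s_2)$). Explicitly, with $u=\Delta f/\|\Delta f\|$, $\cos\varphi=2(\tau(s_1)\cdot u)(\tau(s_2)\cdot u)-\tau(s_1)\cdot\tau(s_2)$. Define $$\mathscr{M}_0(f)=\frac{1-\cos\varphi}{\|\Delta f\|^2},\quad \mathscr{M}_1(f)=\frac{\|\Delta\tau\|^2}{2\|\Delta f\|^2},\quad \mathscr{M}_2(f)=\frac{2}{\|\Delta f\|^2}\left\langle \tau(s_1)\wedge\frac{\Delta f}{\|\Delta f\|},\ \tau(s_2)\wedge\frac{\Delta f}{\|\Delta f\|}\right\rangle,$$ where $\langle a\wedge b,c\wedge d\rangle=(a\cdot c)(b\cdot d)-(a\cdot d)(b\cdot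 c)$, and $\mathcal{E}_i(f)=\iint_{(\mathbb{R}/\mathcal{L}\mathbb{Z})^2}\mathscr{M}_i(f)\,ds_1ds_2$ for $i=0,1,2$ (the integrals for $i=1,2$ converge absolutely when $\mathcal{E}_0(f)<\infty$). $X(s_1,s_2)=\log\dfrac{|\Delta s|^2}{\|\Delta f\|^2}$ for $s_1\neq s_2$; $\|\cdot\|_{L^\infty}$ is the $L^\infty$ norm on $(\mathbb{R}/\mathcal{L}\mathbb{Z})^2$. *)

(* Defs.v *)
From HB Require Import structures.
From mathcomp Require Import all_boot all_order all_algebra.
From mathcomp Require Import all_classical all_reals all_analysis.
Set Implicit Arguments.
Unset Strict Implicit.
Unset Printing Implicit Defensive.
Import Order.TTheory GRing.Theory Num.Theory.
Import numFieldNormedType.Exports.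
Local Open Scope classical_set_scope.
Local Open Scope ring_scope.

(* The library norm `|u| on 'rV[R]_n is the sup norm; the Euclidean structure
   of R^n is therefore introduced here. *)
Definition dotp (R : realType) (n : nat) (u v : 'rV[R]_n) : R :=
  \sum_(i < n) u 0 i * v 0 i.

Definition enorm (R : realType) (n : nat) (u : 'rV[R]_n) : R :=
  Num.sqrt (dotp u u).

(* <a /\ b, c /\ d> *)
Definition dotp_wedge (R : realType) (n : nat) (a b c d : 'rV[R]_n) : R :=
  dotp a c * dotp b d - dotp a d * dotp b c.

(* Maps on R/LZ are represented by L-periodic maps on R, and integrals over
   (R/LZ)^2 are taken over the fundamental domain [0, L[ x [0, L[. *)
Definition circle_dist (R : realType) (L s1 s2 : R) : R :=
  inf [set `|s1 - s2 + k%:~R * L| | k in [set: int]].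

Definition torus (R : realType) (L : R) : set (R * R) :=
  `[0, L[ `*` `[0, L[.

Definition lebesgue2 (R : realType) :
    {measure set (measurableTypeR R * measurableTypeR R) -> \bar R} :=
  (lebesgue_measure \x lebesgue_measure)%E.

Definition tangent (R : realType) (n : nat) (f : R -> 'rV[R]_n) :
    R -> 'rV[R]_n := derive1 f.

(* The first clause is closedness and the second embeddedness. The last two
   say that f is parametrized by arc length: f is Lipschitz (hence absolutely
   continuous, so that arcs have length the integral of |f'|) and has a unit
   derivative almost everywhere; the Lipschitz constant is then 1. *)
Definition arclength_embedded_closed_curve (R : realType) (n : nat) (L : R)
    (f : R -> 'rV[R]_n) : Prop :=
  [/\ forall s, f (s + L) = f s,
      forall s t, f s = f t -> exists k : int, s - t = k%:~R * L,
      forall s t, enorm (f s - f t) <= `|s - t| &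
      {ae lebesgue_measure, forall s : R,
          derivable f s 1 /\ enorm (tangent f s) = 1}].

Definition chord (R : realType) (n : nat) (f : R -> 'rV[R]_n) (s1 s2 : R) :
    'rV[R]_n := f s1 - f s2.

Definition chord_dir (R : realType) (n : nat) (f : R -> 'rV[R]_n)
    (s1 s2 : R) : 'rV[R]_n :=
  (enorm (chord f s1 s2))^-1 *: chord f s1 s2.

(* The circle through f s2 tangent to tau at f s1 arrives at f s2 with
   direction 2 (tau . u) u - tau, the reflection of tau in the chord direction
   u; the conformal angle is the angle between the two such circles. *)
Definition cos_conformal_angle (R : realType) (n : nat) (f : R -> 'rV[R]_n)
    (s1 s2 : R) : R :=
  2 * dotp (tangent f s1) (chord_dir f s1 s2) * dotp (tangent f s2) (chord_dir f s1 s2)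
  - dotp (tangent f s1) (tangent f s2).

Definition M0 (R : realType) (n : nat) (f : R -> 'rV[R]_n) (s1 s2 : R) : R :=
  (1 - cos_conformal_angle f s1 s2) / enorm (chord f s1 s2) ^+ 2.

Definition M1 (R : realType) (n : nat) (f : R -> 'rV[R]_n) (s1 s2 : R) : R :=
  enorm (tangent f s1 - tangent f s2) ^+ 2 / (2 * enorm (chord f s1 s2) ^+ 2).

Definition M2 (R : realType) (n : nat) (f : R -> 'rV[R]_n) (s1 s2 : R) : R :=
  2 / enorm (chord f s1 s2) ^+ 2 *
  dotp_wedge (tangent f s1) (chord_dir f s1 s2) (tangent f s2) (chord_dir f s1 s2).

Definition torus_integral (R : realType) (L : R) (h : R -> R -> R) : \bar R :=
  (\int[lebesgue2 R]_(s in torus L) (h s.1 s.2)%:E)%E.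

Definition torus_Linfty (R : realType) (L : R) (h : R -> R -> R) : \bar R :=
  Lnorm (lebesgue2 R) +oo%E ((fun s => (h s.1 s.2)%:E) \_ (torus L)).

Definition E0 (R : realType) (n : nat) (L : R) (f : R -> 'rV[R]_n) : \bar R :=
  torus_integral L (M0 f).

Definition E1 (R : realType) (n : nat) (L : R) (f : R -> 'rV[R]_n) : \bar R :=
  torus_integral L (M1 f).

Definition E2 (R : realType) (n : nat) (L : R) (f : R -> 'rV[R]_n) : \bar R :=
  torus_integral L (M2 f).

Definition log_distortion (R : realType) (n : nat) (L : R)
    (f : R -> 'rV[R]_n) (s1 s2 : R) : R :=
  ln (circle_dist L s1 s2 ^+ 2 / enorm (chord f s1 s2) ^+ 2).

(* X - X~_a, where f~_a = f~ (. + a) *)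
Definition log_distortion_diff (R : realType) (n : nat) (L : R)
    (f ft : R -> 'rV[R]_n) (a s1 s2 : R) : R :=
  log_distortion L f s1 s2 - log_distortion L (fun s => ft (s + a)) s1 s2.

(* Main.v *)
(* Let D = |f x - f t|^2, let p and q be the scalar products of the unit tangents
   at x and t with f x - f t, divided by D, and let c be the scalar product of the
   two tangents. Then M0 = 1 / D - k with k = 2 p q - c / D, M1 = (1 - c) / D, and
   M2 = M0 - M1 = 2 p q - 2 k almost everywhere, so the first estimate follows
   from the second. On the torus use the coordinates (t, h) or (x, h), x = t + h,
   0 < h <= L / 2, in which h is the intrinsic distance. The h-derivative of q at
   fixed t and that of p at fixed x are both - k. Integrating the former over
   e <= h <= L / 2, with e -> 0, gives the cosine formula: the density
   a = 1 / D - 1 / h^2 has integral E0 + 4.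
   For two curves put Y = X - X~. Its h-derivatives are - 2 (p - p~) at fixed t and
   - 2 (q - q~) at fixed x, so the h-derivatives of Y (q + q~) and Y (p + p~) add
   up to - 4 (p q - p~ q~) - 2 Y (k + k~). The boundary terms cancel at h = L / 2 by
   antipodal symmetry and vanish along a sequence h -> 0, hence 2 p q - 2 p~ q~ and
   - Y (k + k~) have the same integral. With k = a + 1 / h^2 - M0 and the cosine
   formula, E2 - E2~ is the integral of Y (M0 + M0~ - a - a~) - 2 Y / h^2, and
   M0, M0~, a, a~ >= 0 have total integral 2 (E0 + E0~ + 4). *)

(* Finite E0 gives no pointwise control near the diagonal, so each integration by parts over e <= h
   <= L / 2 leaves a boundary term at h = e, and most of the work is to show that it is harmless. In
   the cosine formula this term is 1 / e - q. For the upper bound t is fixed: q is at most 1 / |f x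
   - f t|, f has a unit derivative at almost every t, and a doubling argument then excludes any
   excess. For the lower bound, the integral over t of (1 / h - q) / h has bounded integrals over e
   <= h <= L / 2: differentiate X / h at fixed x and use 0 <= X <= h^2 a. A function whose integrals
   against dh / h are bounded above falls below any positive number arbitrarily close to h = 0. The
   same principle removes the boundary term of the two curves: |Y| times any of |p|, |q|, |p~|, |q~|
   is at most 2 h (a + a~), and a + a~ is integrable. The number 4 is a boundary value at h = L /
   2. *)
Require Import Defs.
From HB Require Import structures.
From mathcomp Require Import all_boot all_order all_algebra.
From mathcomp Require Import all_classical all_reals all_analysis.
Import Order.TTheory GRing.Theory Num.Theory.
Import numFieldNormedType.Exports.
Local Open Scope classical_set_scope.
Local Open Scope ring_scope.
From mathcomp Require Import measurable_realfun ring lra.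
Set Implicit Arguments.
Unset Strict Implicit.
Unset Printing Implicit Defensive.

(** * Integrals on the line and translations *)

Section integral_without_measurability.
Local Open Scope ereal_scope.
Context d (T : measurableType d) (R : realType).
Variable mu : {measure set T -> \bar R}.
Import HBNNSimple.

(** The integral of a nonnegative function is a supremum over the simple functions below it, whether
    or not the function is measurable. Cutting a simple function off on [N] keeps its integral and
    brings it below [g]. *)
Lemma le_integral_off_null (N : set T) (f g : T -> \bar R) :
  measurable N -> mu N = 0 -> (forall x, 0 <= f x) -> (forall x, 0 <= g x) ->
  (forall x, ~ N x -> f x = g x) ->
  \int[mu]_x f x <= \int[mu]_x g x.
Proof.
move=> mN N0 f0 g0 fg.
rewrite (ge0_integralTE mu f0) (ge0_integralTE mu g0).
apply: ge_ereal_sup => _ [h /= hf <-].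
pose h' : {nnsfun T >-> R} := mul_nnsfun h (indic_nnsfun R (measurableC mN)).
suff <- : sintegral mu h' = sintegral mu h.
  apply: ereal_sup_ubound; exists h' => //= x.
  rewrite /h' /= mindicE.
  have [Nx|Nx] := pselect (N x).
    by rewrite memNset ?mulr0//; apply.
  by rewrite mem_set// mulr1 -fg.
rewrite -!integralT_nnsfun; apply: ge0_ae_eq_integral => //.
- exact/measurable_EFinP.
- exact/measurable_EFinP.
- by move=> x _; rewrite lee_fin.
- by move=> x _; rewrite lee_fin.
exists N; split => // x /= /not_implyP[_].
apply: contra_notP => Nx; rewrite /h' /= mindicE mem_set//.
by rewrite mulr1.
Qed.

(* The standard library lemma ae_eq_integral requires both functions to be
   measurable; the tangent of a curve need not be, on the null set where the
   derivative does not exist. *)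
Lemma ae_eq_integral_any (D : set T) (f g : T -> \bar R) :
  {ae mu, forall x, D x -> f x = g x} ->
  \int[mu]_(x in D) f x = \int[mu]_(x in D) g x.
Proof.
move=> [N [mN N0 sN]].
have fgN x : ~ N x -> (f \_ D) x = (g \_ D) x.
  move=> Nx; rewrite !patchE; case: ifPn => // /set_mem Dx.
  apply: contrapT => fg; apply: Nx; apply: sN => /= H; exact/fg/H.
have eqN (u v : T -> \bar R) : (forall x, 0 <= u x) -> (forall x, 0 <= v x) ->
    (forall x, ~ N x -> u x = v x) -> \int[mu]_x u x = \int[mu]_x v x.
  move=> u0 v0 uv; apply/eqP; rewrite eq_le; apply/andP; split.
    exact: (le_integral_off_null mN).
  by apply: (le_integral_off_null mN) => // x Nx; rewrite uv.
rewrite integral_mkcond [RHS]integral_mkcond integralE [RHS]integralE.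
congr (_ - _).
- by apply: eqN => // x /fgN; rewrite /= !funeposE => ->.
- by apply: eqN => // x /fgN; rewrite /= !funenegE => ->.
Qed.

End integral_without_measurability.

Section translation.
Context {R : realType}.
Local Notation mu := (@lebesgue_measure R).
Implicit Types (a b L : R).

Lemma measurable_shift a :
  measurable_fun [set: measurableTypeR R] (fun x : measurableTypeR R => (x + a : measurableTypeR R)).
Proof. exact: measurable_funD. Qed.

Lemma measurable_reflect b :
  measurable_fun [set: measurableTypeR R] (fun x : measurableTypeR R => (b - x : measurableTypeR R)).
Proof. exact: measurable_funB. Qed.

Lemma lebesgue_measure_shift a (A : set R) : measurable A ->
  mu ((fun x => x + a) @^-1` A) = mu A.
Proof.
pose phi := (fun x : measurableTypeR R => (x + a : measurableTypeR R)).
pose mphi := isMeasurableFun.Build _ _ _ _ phi (measurable_shift a).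
pose phiM : {mfun measurableTypeR R >-> measurableTypeR R} := HB.pack phi mphi.
move=> mA; apply/esym.
apply: (@lebesgue_measure_unique _ (pushforward mu phiM)) => //= _ [[u v]] _ <-.
rewrite /pushforward.
have -> : phi @^-1` `]u, v]%classic = `]u - a, v - a]%classic.
  by apply/seteqP; split => x /=; rewrite !in_itv/= /phi ltrBlDr lerBrDr.
rewrite !lebesgue_measure_itv/= !lte_fin ltrD2r; case: ifPn => // _.
by rewrite !EFinN -!EFinB; congr EFin; ring.
Qed.

Lemma lebesgue_measure_reflect b (A : set R) : measurable A ->
  mu ((fun x => b - x) @^-1` A) = mu A.
Proof.
move=> mA; rewrite -(lebesgue_measure_shift b mA).
rewrite -(@lebesgue_measureN R ((fun x => x + b) @^-1` A)).
  congr (mu _); apply/seteqP; split => x /=; by rewrite /preimage/= addrC.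
by rewrite -[X in measurable X]setTI; exact: measurable_shift.
Qed.

End translation.

Section measure_preserving.
Context {R : realType}.
Local Notation mu := (@lebesgue_measure R).
Variable phi : measurableTypeR R -> measurableTypeR R.
Hypothesis mphi : measurable_fun [set: measurableTypeR R] phi.
Hypothesis muphi : forall A, measurable A -> mu (phi @^-1` A) = mu A.

Lemma integral_measure_preserving (D : set R) (f : R -> \bar R) :
  measurable D -> measurable_fun setT f ->
  (\int[mu]_(x in phi @^-1` D) f (phi x) = \int[mu]_(x in D) f x)%E.
Proof.
move=> mD mf.
have ge0 (g : R -> \bar R) : measurable_fun setT g -> (forall x, 0 <= g x)%E ->
    (\int[mu]_(x in phi @^-1` D) g (phi x) = \int[mu]_(x in D) g x)%E.
  move=> mg g0.
  have <- := @ge0_integral_pushforward _ _ _ _ _ _ mphi mu D g mD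
    (measurable_funTS mg) (fun y _ => g0 y).
  apply: eq_measure_integral => A mA _; exact: muphi.
rewrite integralE [RHS]integralE; congr (_ - _)%E.
- rewrite -ge0//; last exact: measurable_funepos.
  by apply: eq_integral => x _; rewrite !funeposE.
- rewrite -ge0//; last exact: measurable_funeneg.
  by apply: eq_integral => x _; rewrite !funenegE.
Qed.

Lemma ae_measure_preserving (P : R -> Prop) :
  {ae mu, forall x, P x} -> {ae mu, forall x, P (phi x)}.
Proof.
move=> [N [mN N0 sN]]; exists (phi @^-1` N); split.
- by rewrite -[X in measurable X]setTI; exact: mphi.
- by rewrite muphi.
- by move=> x /= nP; exact: sN.
Qed.

End measure_preserving.

Section periodic.
Context {R : realType}.
Local Notation mu := (@lebesgue_measure R).
Implicit Types (a b L : R).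

Lemma periodic_int T L (f : R -> T) (k : int) x : (forall x, f (x + L) = f x) ->
  f (x + k%:~R * L) = f x.
Proof.
move=> fL.
have fLn (n : nat) y : f (y + n%:R * L) = f y.
  by elim: n y => [|n IH] y; rewrite ?mul0r ?addr0// -natr1 mulrDl mul1r addrA fL.
case: k => n; first by rewrite -pmulrn fLn.
by rewrite NegzE mulrNz mulNr -pmulrn -[LHS](fLn n.+1) subrK.
Qed.

Lemma integral_shift a b c (f : R -> \bar R) : measurable_fun setT f ->
  (\int[mu]_(x in `[b, c[) f (x + a)%R = \int[mu]_(x in `[(b + a)%R, (c + a)%R[) f x)%E.
Proof.
move=> mf.
have -> : `[b, c[%classic = (fun x => x + a) @^-1` `[b + a, c + a[%classic.
  by apply/seteqP; split => x /=; rewrite !in_itv/= lerD2r ltrD2r.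
exact: (integral_measure_preserving (measurable_shift a) (lebesgue_measure_shift a)).
Qed.

(** For a shift in [0, L[ the part of the window beyond L is moved back by one period; any other
    shift is reduced to this case by periodicity. Splitting into positive and negative parts keeps
    the statement free of integrability. *)
Lemma integral_periodic_shift a L (f : R -> \bar R) : 0 < L ->
  measurable_fun setT f -> (forall x, f (x + L) = f x) ->
  (\int[mu]_(x in `[0%R, L[) f (x + a)%R = \int[mu]_(x in `[0%R, L[) f x)%E.
Proof.
move=> L0.
have small (g : R -> \bar R) b : measurable_fun setT g ->
    (forall x, g (x + L) = g x) -> (forall x, 0 <= g x)%E -> 0 <= b < L ->
    (\int[mu]_(x in `[0%R, L[) g (x + b)%R = \int[mu]_(x in `[0%R, L[) g x)%E.
  move=> mg gL g0 /andP[b0 bL].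
  rewrite integral_shift// add0r.
  have -> : `[b, L + b[%classic = `[b, L[ `|` `[L, L + b[ :> set R.
    apply/seteqP; split => x /=; rewrite !in_itv/=.
      by case: (ltP x L) => xL /andP[? ?]; [left|right]; apply/andP; split.
    by move=> [|] /andP[? ?]; apply/andP; split; lra.
  have -> : `[0, L[%classic = `[0, b[ `|` `[b, L[ :> set R.
    apply/seteqP; split => x /=; rewrite !in_itv/=.
      by case: (ltP x b) => xb /andP[? ?]; [left|right]; apply/andP; split.
    by move=> [|] /andP[? ?]; apply/andP; split; lra.
  have mS : forall D : set R, measurable_fun D g by move=> D; exact: measurable_funTS.
  rewrite !ge0_integral_setU//; try exact: mS.
  rewrite addeC; congr (_ + _)%E.
  rewrite -{1}(add0r L) (addrC L b) -integral_shift//.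
  - by apply: eq_integral => x _; rewrite gL.
  - by rewrite disj_set2E; apply/eqP; apply/seteqP; split => x //=; rewrite !in_itv/=; lra.
  - by rewrite disj_set2E; apply/eqP; apply/seteqP; split => x //=; rewrite !in_itv/=; lra.
have ge0 (g : R -> \bar R) b : measurable_fun setT g ->
    (forall x, g (x + L) = g x) -> (forall x, 0 <= g x)%E ->
    (\int[mu]_(x in `[0%R, L[) g (x + b)%R = \int[mu]_(x in `[0%R, L[) g x)%E.
  move=> mg gL g0.
  pose k := Num.floor (b / L); pose c := b - k%:~R * L.
  have -> : (\int[mu]_(x in `[0%R, L[) g (x + b)%R = \int[mu]_(x in `[0%R, L[) g (x + c)%R)%E.
    apply: eq_integral => x _; rewrite -(periodic_int k (x + c) gL).
    by congr g; rewrite /c; ring.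
  apply: small => //; rewrite /c subr_ge0 -ler_pdivlMr//.
  have := floor_itv (b / L); rewrite -/k intrD => /andP[-> /=].
  by rewrite ltr_pdivrMr// mulrDl mul1r ltrBlDl.
move=> mf fL; rewrite integralE [RHS]integralE; congr (_ - _)%E.
- rewrite -(ge0 f^\+%E a)//.
  + by apply: eq_integral => x _; rewrite !funeposE.
  + exact: measurable_funepos.
  + by move=> x; rewrite !funeposE fL.
- rewrite -(ge0 f^\-%E a)//.
  + by apply: eq_integral => x _; rewrite !funenegE.
  + exact: measurable_funeneg.
  + by move=> x; rewrite !funenegE fL.
Qed.

End periodic.

(** * Absolutely continuous functions *)

Section ae_filter.
Context d (T : measurableType d) (R : realType).
Variable mu : {measure set T -> \bar R}.
Implicit Types P Q S : T -> Prop.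

Lemma ae_imply P Q : (forall x, P x -> Q x) ->
  {ae mu, forall x, P x} -> {ae mu, forall x, Q x}.
Proof. by move=> PQ; apply: (@filterS _ _ (ae_filter_ringOfSetsType mu)). Qed.

Lemma ae_imply2 P Q S : (forall x, P x -> Q x -> S x) ->
  {ae mu, forall x, P x} -> {ae mu, forall x, Q x} -> {ae mu, forall x, S x}.
Proof. by move=> PQ; apply: (@filterS2 _ _ (ae_filter_ringOfSetsType mu)). Qed.

End ae_filter.

Section bounded_integrable.
Context d (T : measurableType d) (R : realType).
Variable mu : {measure set T -> \bar R}.

Lemma bounded_integrable (A : set T) (f : T -> R) (M : R) : measurable A ->
  (mu A < +oo)%E -> measurable_fun A f -> (forall x, A x -> `|f x| <= M) ->
  mu.-integrable A (EFin \o f).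
Proof.
move=> mA Afin mf fM; apply: measurable_bounded_integrable => //.
exists M; split; first exact: num_real.
by move=> M' MM' x Ax /=; apply: le_trans (ltW MM'); exact: fM.
Qed.

End bounded_integrable.

Section lipschitz_ftc.
Context {R : realType}.
Local Notation mu := (@lebesgue_measure R).
Implicit Types (a b c K : R) (F G psi phi : R -> R).

Lemma lipschitz_measurable F K : (forall x y, `|F x - F y| <= K * `|x - y|) ->
  measurable_fun [set: R] F.
Proof.
move=> FK; apply: continuous_measurable_fun => x.
apply/cvgrPdist_le => /= e e0.
have K0 : 0 < `|K| + 1 by rewrite ltr_wpDl.
near=> y.
apply: (le_trans (FK _ _)); apply: (@le_trans _ _ ((`|K| + 1) * `|x - y|)).
  by rewrite ler_wpM2r// (le_trans (ler_norm _))// lerDl.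
rewrite mulrC -ler_pdivlMr//.
near: y; apply: cvgr_dist_le; first exact: cvg_id.
by rewrite divr_gt0.
Unshelve. all: by end_near. Qed.

Lemma itv_bounded_integrable (i : interval R) F M : (mu [set` i] < +oo)%E ->
  measurable_fun setT F -> (forall x, x \in i -> `|F x| <= M) ->
  mu.-integrable [set` i] (EFin \o F).
Proof.
move=> ifin mF FM; apply: (@bounded_integrable _ _ _ mu _ _ M) => //.
exact: measurable_funTS.
Qed.

Lemma itv_lty a b (b0 b1 : bool) :
  (mu [set` Interval (BSide b0 a) (BSide b1 b)] < +oo)%E.
Proof. by rewrite lebesgue_measure_itv/=; case: ifPn => // _; rewrite -EFinB ltry. Qed.

Lemma itv_measure a b (b0 b1 : bool) : a <= b ->
  fine (mu [set` Interval (BSide b0 a) (BSide b1 b)]) = b - a.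
Proof.
move=> ab; rewrite lebesgue_measure_itv/= lte_fin; case: ifPn => [//|].
by rewrite -leNgt => ba; rewrite /=; lra.
Qed.

(** Lipschitz rather than absolutely continuous: kernels are differentiated only at a positive
    distance from the diagonal, where they are Lipschitz along slices, and this class is closed
    under products and, away from 0, under inverses and logarithms. *)
Definition acd a b F psi : Prop :=
  (exists K, forall x y, a <= x <= b -> a <= y <= b ->
     `|F x - F y| <= K * `|x - y|) /\
  {ae mu, forall x : R, a < x < b -> is_derive x (1 : R) F (psi x)}.

Lemma Rintegral_split a c b F : a <= c -> c <= b ->
  mu.-integrable `[a, b[ (EFin \o F) ->
  \int[mu]_(x in `[a, b[) F x =
  \int[mu]_(x in `[a, c[) F x + \int[mu]_(x in `[c, b[) F x.
Proof.
move=> ac cb iF.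
have E : `[a, b[%classic = `[a, c[ `|` `[c, b[ :> set R.
  apply/seteqP; split => x /=; rewrite !in_itv/=.
    by case: (ltP x c) => xb /andP[? ?]; [left|right]; apply/andP; split.
  by move=> [|] /andP[? ?]; apply/andP; split; lra.
rewrite E Rintegral_setU//; first by rewrite -E.
by rewrite disj_set2E; apply/eqP; apply/seteqP; split => x //=; rewrite !in_itv/=; lra.
Qed.

(** The difference quotients of an extension [G] of [F] are bounded by the Lipschitz constant and
    converge almost everywhere to [psi], so dominated convergence applies. The integral of a
    quotient is the mean of [G] over [b, b + h] minus its mean over [a, a + h]. *)
Lemma acd_ftc a b F psi : a < b -> measurable_fun setT psi -> acd a b F psi ->
  mu.-integrable `[a, b] (EFin \o psi) /\
  (\int[mu]_(x in `[a, b]) psi x)%R = F b - F a.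
Proof.
move=> ab mpsi [[K0 FK0] dF].
pose K := `|K0|.
have K_ge0 : 0 <= K by exact: normr_ge0.
have FK x y : a <= x <= b -> a <= y <= b -> `|F x - F y| <= K * `|x - y|.
  by move=> xab yab; rewrite (le_trans (FK0 _ _ xab yab))// ler_wpM2r// ler_norm.
(* Composing with this clamp extends [F] by its end values and keeps the Lipschitz constant. *)
pose cl x := Num.max a (Num.min x b).
pose G x := F (cl x).
have cl_ab x : a <= cl x <= b.
  by rewrite /cl le_max lexx/= ge_max (ltW ab)/= ge_min lexx orbT.
have cl_id x : a <= x <= b -> cl x = x.
  move=> /andP[ax xb]; rewrite /cl.
  by rewrite (min_l xb) (max_r ax).
have cl_le x y : cl x <= cl y + `|x - y|.
  have /andP[ay _] := cl_ab y.
  have xy := ler_norm (x - y); have xy0 := normr_ge0 (x - y).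
  rewrite {1}/cl ge_max; apply/andP; split; first lra.
  apply: (@le_trans _ _ (Num.min y b + `|x - y|)); last first.
    by rewrite lerD2r /cl le_max lexx orbT.
  rewrite -lerBlDr le_min; apply/andP; split.
    by have : Num.min x b <= x := ltac:(by rewrite ge_min lexx); lra.
  by have : Num.min x b <= b := ltac:(by rewrite ge_min lexx orbT); lra.
have cl_lip x y : `|cl x - cl y| <= `|x - y|.
  have := cl_le x y; have := cl_le y x; rewrite (distrC y x) => ? ?.
  by rewrite ler_norml; apply/andP; split; lra.
have GK x y : `|G x - G y| <= K * `|x - y|.
  by rewrite (le_trans (FK _ _ (cl_ab x) (cl_ab y)))// ler_wpM2l.
have mG := lipschitz_measurable GK.
have Gbd x : `|G x| <= `|F a| + K * (b - a).
  rewrite -(subrK (F a) (G x)) addrC (le_trans (ler_normD _ _))// lerD2l.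
  have aab : a <= a <= b by rewrite lexx ltW.
  rewrite (le_trans (FK _ _ (cl_ab x) aab))// ler_wpM2l//.
  by have /andP[? ?] := cl_ab x; rewrite ger0_norm; lra.
have iG (i : interval R) : (mu [set` i] < +oo)%E -> mu.-integrable [set` i] (EFin \o G).
  by move=> ifin; apply: itv_bounded_integrable => // x _; exact: Gbd.
pose h n : R := n.+1%:R^-1.
have h0 n : 0 < h n by rewrite invr_gt0.
pose psi_ n x := (h n)^-1 * (G (x + h n) - G x).
have mpsi_ n : measurable_fun setT (psi_ n).
  apply: measurable_funM => //; apply: measurable_funB => //.
  by apply: (measurableT_comp mG); exact: measurable_funD.
have psi_K n x : `|psi_ n x| <= K.
  rewrite /psi_ normrM gtr0_norm ?invr_gt0//.
  rewrite mulrC ler_pdivrMr// (le_trans (GK _ _))//.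
  by rewrite addrAC subrr add0r gtr0_norm.
have dct := @dominated_convergence _ _ _ mu `[a, b] _ (fun n => EFin \o psi_ n)
  (EFin \o psi) (cst K%:E).
have := dct _ _ _ _ _ _; case.
- exact: measurable_itv.
- by move=> n; apply/measurable_EFinP; apply: measurable_funTS; exact: mpsi_.
- by apply/measurable_EFinP; apply: measurable_funTS; exact: mpsi.
- have aeab : {ae mu, forall x : R, x != a /\ x != b}.
    exists ([set a] `|` [set b]); split.
    + by apply: measurableU; exact: measurable_set1.
    + apply: (@null_set_setU _ _ _ mu); try exact: measurable_set1.
      * exact: lebesgue_measure_set1.
      * exact: lebesgue_measure_set1.
    + move=> x /= /not_andP[|] /negP; rewrite negbK => /eqP ->; by [left|right].
  apply: ae_imply2 aeab dF => x [xa xb] dFx; rewrite /= in_itv/= => /andP[ax xb'].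
  have {dFx} dFx : is_derive x (1 : R) F (psi x).
    by apply: dFx; rewrite !lt_neqAle ax xb' xb eq_sym xa.
  have {}ax : a < x by rewrite lt_neqAle eq_sym xa.
  have {}xb : x < b by rewrite lt_neqAle xb.
  apply/fine_cvgP; split; first by apply: nearW.
  have h_cvg : h n @[n --> \oo] --> (0 : R)^'.
    move=> A A0.
    have H : \forall n \near \oo, h n != 0 -> A (h n) := (@cvg_harmonic R) _ A0.
    apply: (@filterS _ \oo _ (fun n => h n != 0 -> A (h n))) H => n; apply.
    by rewrite gt_eqF.
  have dq : (t^-1 *: ((F \o shift x) (t *: 1) - F x) @[t --> (0 : R)^'] --> psi x).
    by case: dFx => dF1 <-; exact: dF1.
  have bx : 0 < b - x by rewrite subr_gt0.
  have := cvg_comp _ _ h_cvg dq.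
  apply: cvg_trans; apply: near_eq_cvg; near=> n => /=.
  rewrite /psi_ /= /GRing.scale/= mulr1 (addrC x); congr (_ * _).
  rewrite /G !cl_id//; first by rewrite (ltW ax) (ltW xb).
  rewrite addrC; apply/andP; split; first by rewrite ler_wpDr// ltW.
  rewrite -lerBrDl; apply: ltW.
  by near: n; apply: (cvgr_lt (0 : R)) => //; exact: cvg_harmonic.
- apply: (@bounded_integrable _ _ _ mu _ (cst K) K) => //; first exact: itv_lty.
  by move=> x _; rewrite ger0_norm.
- by apply: aeW => x n _; rewrite lee_fin psi_K.
move=> ipsi _ cvgpsi; split => //.
have iGo u v : mu.-integrable `[u, v[ (EFin \o G) by apply: iG; exact: itv_lty.
have mGh (e : R) : measurable_fun setT (fun x : R => G (x + e)).
  by apply: (measurableT_comp mG); exact: measurable_funD.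
have iGs (e u v : R) : mu.-integrable `[u, v[ (EFin \o (fun x : R => G (x + e))).
  by apply: itv_bounded_integrable; [exact: itv_lty|exact: mGh|move=> x _; exact: Gbd].
have diff n : `|\int[mu]_(x in `[a, b]) psi_ n x - (F b - F a)| <= K * h n.
  have shiftG : \int[mu]_(x in `[a, b[) G (x + h n) = \int[mu]_(x in `[a + h n, b + h n[) G x.
    congr fine; apply: (integral_shift _ _ _ (f := EFin \o G)).
    exact/measurable_EFinP.
  rewrite -Rintegral_itv_bndo_bndc; last first.
    apply: itv_bounded_integrable; [exact: itv_lty|exact: mpsi_|].
    by move=> x _; exact: psi_K.
  rewrite RintegralZl//; last first.
    apply: (@itv_bounded_integrable _ _ (`|F a| + K * (b - a) + (`|F a| + K * (b - a)))).
    - exact: itv_lty.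
    - by apply: measurable_funB => //; exact: mGh.
    - by move=> x _; rewrite (le_trans (ler_normB _ _))// lerD// Gbd.
  rewrite RintegralB//; try exact: iGs; try exact: iGo; try exact: (iGs (h n)).
  rewrite shiftG.
  have hn := h0 n.
  have aah : a <= a + h n by rewrite lerDl ltW.
  have bbh : b <= b + h n by rewrite lerDl ltW.
  have ahbh : a + h n <= b + h n by rewrite lerD2r ltW.
  have s1 : \int[mu]_(x in `[a, b + h n[) G x =
      \int[mu]_(x in `[a, a + h n[) G x + \int[mu]_(x in `[a + h n, b + h n[) G x.
    by apply: Rintegral_split.
  have s2 : \int[mu]_(x in `[a, b + h n[) G x =
      \int[mu]_(x in `[a, b[) G x + \int[mu]_(x in `[b, b + h n[) G x.
    by apply: Rintegral_split => //; exact: ltW.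
  have -> : \int[mu]_(x in `[a + h n, b + h n[) G x - \int[mu]_(x in `[a, b[) G x =
     \int[mu]_(x in `[b, b + h n[) G x - \int[mu]_(x in `[a, a + h n[) G x.
    have lin (u v w z t : R) : t = u + v -> t = w + z -> v - w = z - u.
      by clear; lra.
    exact: lin s1 s2.
  (* Beyond b the extension is constant, so this mean is exact; only the mean at a costs an error,
     at most [K * h n]. *)
  have -> : \int[mu]_(x in `[b, b + h n[) G x = F b * h n.
    rewrite -[X in F b * X](_ : fine (mu `[b, b + h n[) = _); last first.
      by rewrite itv_measure ?lerDl ?(ltW hn)// addrAC subrr add0r.
    rewrite -Rintegral_cst//.
    apply: eq_Rintegral => x; rewrite inE/= in_itv/= => /andP[bx _].
    by rewrite /G /cl (min_r bx) (max_r (ltW ab)).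
  have : `|\int[mu]_(x in `[a, a + h n[) G x - F a * h n| <= K * h n ^+ 2.
    rewrite -[X in F a * X](_ : fine (mu `[a, a + h n[) = _); last first.
      by rewrite itv_measure ?lerDl ?(ltW hn)// addrAC subrr add0r.
    rewrite -Rintegral_cst// -RintegralB//; last first.
      by apply: bounded_integrable => //; exact: itv_lty.
    have iGa : mu.-integrable `[a, a + h n[ (EFin \o (fun x => G x - F a)).
      apply: (@itv_bounded_integrable _ _ (`|F a| + K * (b - a) + `|F a|)).
      - exact: itv_lty.
      - exact: measurable_funB.
      - by move=> x _; rewrite (le_trans (ler_normB _ _))// lerD2r Gbd.
    rewrite (le_trans (le_normr_Rintegral _ iGa))//.
    rewrite expr2 mulrA -[X in _ * X](_ : fine (mu `[a, a + h n[) = _); last first.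
      by rewrite itv_measure ?lerDl ?(ltW hn)// addrAC subrr add0r.
    rewrite -Rintegral_cst//; apply: le_Rintegral => //.
    - exact: integrable_norm.
    - by apply: bounded_integrable => //; exact: itv_lty.
    - move=> x /=; rewrite in_itv/= => /andP[ax xah].
      have GaE : F a = G a by rewrite /G cl_id// lexx ltW.
      by rewrite GaE (le_trans (GK _ _))// ler_wpM2l// ger0_norm ?subr_ge0// lerBlDl ltW.
  move=> H.
  rewrite -(ler_pM2l hn) -[X in X * `|_|](gtr0_norm hn) -normrM.
  rewrite mulrBr mulrA mulfV ?gt_eqF// mul1r.
  rewrite (_ : h n * (K * h n) = K * h n ^+ 2); last by rewrite expr2 mulrCA.
  apply: le_trans H; rewrite -normrN le_eqVlt; apply/orP; left; apply/eqP.
  by congr (`|_|); clear; ring.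
apply: (@cvg_unique _ _ (\int[mu]_(x in `[a, b]) psi_ n x @[n --> \oo])) => //.
  have fin : (\int[mu]_(x in `[a, b]) (EFin \o psi) x)%E \is a fin_num.
    exact: integrable_fin_num ipsi.
  by move: cvgpsi; rewrite -(fineK fin) => /fine_cvgP[_].
apply/cvgrPdist_le => /= e e0; near=> n.
rewrite distrC (le_trans (diff n))//.
rewrite (@le_trans _ _ ((K + 1) * h n))// ?ler_wpM2r ?lerDl//; first exact: ltW.
rewrite mulrC -ler_pdivlMr; last by rewrite ltr_wpDl.
apply: ltW; near: n; apply: (cvgr_lt (0 : R)); first exact: cvg_harmonic.
by rewrite divr_gt0// ltr_wpDl.
Unshelve. all: by end_near. Qed.

End lipschitz_ftc.

Lemma measurable_inv {R : realType} : measurable_fun [set: R] (@GRing.inv R).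
Proof.
have -> : [set: R] = [set x | x != 0] `|` [set 0].
  apply/seteqP; split => x //= _.
  by have [->|x0] := eqVneq x 0; [right|left].
have o : open [set x : R | x != 0].
  rewrite (_ : [set _ | _] = ~` [set 0]); first exact: closed_openC.
  by apply/seteqP; split => x /= /eqP.
apply/measurable_funU => //; first exact: open_measurable.
split; last exact: measurable_fun_set1.
apply: open_continuous_measurable_fun => // x /set_mem x0.
exact: inv_continuous.
Qed.

Lemma measurable_funV d (T : measurableType d) (R : realType) (f : T -> R) :
  measurable_fun setT f -> measurable_fun setT (fun x => (f x)^-1).
Proof. by move=> mf; apply: (measurableT_comp measurable_inv). Qed.

Section acd_closure.
Context {R : realType}.
Implicit Types (a b c K : R) (F G f g : R -> R).

Lemma acd_eq a b F G f g : acd a b F f -> (forall x, F x = G x) ->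
  (forall x, a < x < b -> f x = g x) -> acd a b G g.
Proof.
move=> [lF dF] /funext <- fg; split=> //.
by apply: ae_imply dF => x dFx xab; rewrite -fg//; exact: dFx.
Qed.

Lemma acd_bounded a b F f : acd a b F f ->
  exists M, forall x, a <= x <= b -> `|F x| <= M.
Proof.
move=> [[K FK] _]; exists (`|F a| + `|K| * (b - a)) => x /andP[ax xb].
rewrite -(subrK (F a) (F x)) addrC (le_trans (ler_normD _ _))// lerD2l.
have ab := le_trans ax xb.
rewrite (le_trans (FK _ _ _ _)) ?ax ?xb ?lexx ?ab//.
rewrite (@le_trans _ _ (`|K| * `|x - a|)) ?ler_wpM2r ?ler_norm//.
by rewrite ler_wpM2l// ger0_norm; lra.
Qed.

Lemma acd_cst a b c : acd a b (fun=> c) (fun=> 0).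
Proof.
split; first by exists 0 => x y _ _; rewrite subrr normr0 mul0r.
by apply: aeW => x _; exact: is_derive_cst.
Qed.

Lemma acd_id a b : acd a b (fun x => x) (fun=> 1).
Proof.
split; first by exists 1 => x y _ _; rewrite mul1r.
by apply: aeW => x _; exact: is_derive_id.
Qed.

Lemma acdD a b F G f g : acd a b F f -> acd a b G g ->
  acd a b (fun x => F x + G x) (fun x => f x + g x).
Proof.
move=> [[K FK] dF] [[K' GK] dG]; split.
  exists (K + K') => x y xab yab; rewrite mulrDl.
  have -> : F x + G x - (F y + G y) = (F x - F y) + (G x - G y) by ring.
  by rewrite (le_trans (ler_normD _ _))// lerD// ?FK ?GK.
apply: ae_imply2 dF dG => x dF dG xab.
exact: (is_deriveD (dF xab) (dG xab)).
Qed.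

Lemma acdM a b F G f g : acd a b F f -> acd a b G g ->
  acd a b (fun x => F x * G x) (fun x => f x * G x + F x * g x).
Proof.
move=> aF aG; have [M FM] := acd_bounded aF; have [M' GM] := acd_bounded aG.
case: aF aG => [[K FK] dF] [[K' GK] dG]; split.
  exists (M * K' + M' * K) => x y xab yab; rewrite mulrDl.
  have -> : F x * G x - F y * G y = F x * (G x - G y) + G y * (F x - F y) by ring.
  rewrite (le_trans (ler_normD _ _))// !normrM -!mulrA.
  by rewrite lerD// ler_pM// ?FK ?GK ?FM ?GM.
apply: ae_imply2 dF dG => x dF dG xab.
have := is_deriveM (dF xab) (dG xab).
by move=> /is_derive_eq; apply; rewrite /GRing.scale/=; ring.
Qed.

Lemma acdZ a b c F f : acd a b F f -> acd a b (fun x => c * F x) (fun x => c * f x).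
Proof.
move=> aF; apply: (acd_eq (acdM (acd_cst a b c) aF)) => // x _.
by rewrite mul0r add0r.
Qed.

Lemma acdN a b F f : acd a b F f -> acd a b (fun x => - F x) (fun x => - f x).
Proof.
by move=> aF; apply: (acd_eq (acdZ (-1) aF)) => x *; rewrite mulN1r.
Qed.

Lemma acdB a b F G f g : acd a b F f -> acd a b G g ->
  acd a b (fun x => F x - G x) (fun x => f x - g x).
Proof. by move=> aF /acdN; exact: acdD. Qed.

Lemma acd_sum a b n (F f : 'I_n -> R -> R) : (forall i, acd a b (F i) (f i)) ->
  acd a b (fun x => \sum_(i < n) F i x) (fun x => \sum_(i < n) f i x).
Proof.
elim: n F f => [F f _|n IH F f aF].
  by apply: (acd_eq (acd_cst a b 0)) => x *; rewrite big_ord0.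
apply: (acd_eq (acdD (IH _ _ (fun i => aF (widen_ord (leqnSn n) i))) (aF ord_max)));
  by move=> x *; rewrite big_ord_recr.
Qed.

Lemma acdV a b c F f : 0 < c -> acd a b F f -> (forall x, a <= x <= b -> c <= F x) ->
  acd a b (fun x => (F x)^-1) (fun x => - f x / F x ^+ 2).
Proof.
move=> c0 [[K FK] dF] Fc; split.
  exists (c^-1 * c^-1 * K) => x y xab yab.
  have Fx0 : 0 < F x by rewrite (lt_le_trans c0)// Fc.
  have Fy0 : 0 < F y by rewrite (lt_le_trans c0)// Fc.
  have -> : (F x)^-1 - (F y)^-1 = (F x)^-1 * (F y)^-1 * (F y - F x).
    by field; rewrite !gt_eqF.
  rewrite !normrM distrC (gtr0_norm (_ : 0 < (F x)^-1)) ?(gtr0_norm (_ : 0 < (F y)^-1)) ?invr_gt0// -(mulrA _ K).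
  apply: ler_pM; [by rewrite mulr_ge0// invr_ge0 ltW|by []| |exact: FK].
  by apply: ler_pM; rewrite ?invr_ge0 ?(ltW Fx0) ?(ltW Fy0)// lef_pV2 ?posrE// Fc.
apply: ae_imply dF => x dF xab.
have Fx0 : F x != 0.
  rewrite gt_eqF// (lt_le_trans c0)// Fc//.
  by case/andP : xab => /ltW -> /ltW ->.
have := is_deriveV Fx0 (dF xab).
by move=> /is_derive_eq; apply; rewrite /GRing.scale/= mulrC mulrN mulNr.
Qed.

Lemma ln_lipschitz c (u v : R) : 0 < c -> c <= u -> c <= v ->
  `|ln u - ln v| <= c^-1 * `|u - v|.
Proof.
move=> c0.
have one (x y : R) : c <= x -> c <= y -> ln x - ln y <= c^-1 * `|x - y|.
  move=> cx cy; have x0 := lt_le_trans c0 cx; have y0 := lt_le_trans c0 cy.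
  rewrite -ln_div ?posrE//.
  have -> : x / y = 1 + (x - y) / y by field; rewrite gt_eqF.
  have xy1 : -1 < (x - y) / y by rewrite ltr_pdivlMr// mulN1r; lra.
  apply: (le_trans (le_ln1Dx xy1)).
  rewrite mulrC; apply: (@le_trans _ _ (y^-1 * `|x - y|)).
    by rewrite ler_wpM2l ?invr_ge0 ?(ltW y0)// ler_norm.
  by rewrite ler_wpM2r// lef_pV2 ?posrE.
move=> cu cv; rewrite ler_norml; apply/andP; split; last exact: one.
by rewrite lerNl opprB distrC; exact: one.
Qed.

Lemma acd_ln a b c F f : 0 < c -> acd a b F f -> (forall x, a <= x <= b -> c <= F x) ->
  acd a b (fun x => ln (F x)) (fun x => f x / F x).
Proof.
move=> c0 [[K FK] dF] Fc; split.
  exists (c^-1 * K) => x y xab yab.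
  rewrite (le_trans (ln_lipschitz c0 _ _)) ?Fc//.
  by rewrite -mulrA ler_wpM2l ?invr_ge0 ?(ltW c0)// FK.
apply: ae_imply dF => x dF xab.
have Fx0 : 0 < F x.
  rewrite (lt_le_trans c0)// Fc//.
  by case/andP : xab => /ltW -> /ltW ->.
have := is_derive1_comp (is_derive1_ln Fx0) (dF xab).
by move=> /is_derive_eq; apply; rewrite mulrC.
Qed.

End acd_closure.

(** * Smallness near 0 from integrals against dh / h *)

Section eventually_small.
Context {R : realType}.
Local Notation mu := (@lebesgue_measure R).

(* Otherwise [k h / h] would dominate [eta / h] near 0, and the integral of
   [1 / h] over [[e, d]] is [ln (d / e)], unbounded as [e] goes to 0. *)
Lemma exists_small_of_integral_div (k : R -> R) (l C : R) : 0 < l ->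
  (forall e, 0 < e -> mu.-integrable `[e, l] (EFin \o (fun h => k h / h))) ->
  (forall e, 0 < e -> e < l -> \int[mu]_(h in `[e, l]) (k h / h) <= C) ->
  forall eta d, 0 < eta -> 0 < d -> exists2 h, 0 < h < d & k h < eta.
Proof.
move=> l0 ik kC eta d0 eta0 d00; apply: contrapT => noh.
have [d [d_gt0 dd0 dl]] : exists d, [/\ 0 < d, d < d0 & d < l].
  by exists (Num.min (d0 / 2) (l / 2)); rewrite lt_min !gt_min; split; lra.
have kge h : 0 < h -> h <= d -> eta <= k h.
  move=> h0 hd; rewrite leNgt; apply/negP => kh; apply: noh; exists h => //.
  by rewrite h0/= (le_lt_trans hd).
pose A := \int[mu]_(h in `]d, l]) (k h / h).
(* Solves eta ln (d / e) = |C| + |A| + 1, so that the part over [e, d] alone pushes the integral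
   above [C], whatever the sign of [A]. *)
pose e := d * expR (- ((`|C| + `|A| + 1) / eta)).
have e0 : 0 < e by rewrite mulr_gt0 ?expR_gt0.
have ed : e < d.
  rewrite /e -[ltRHS]mulr1 ltr_pM2l// -expR0 ltr_expR oppr_lt0.
  by rewrite divr_gt0// ltr_wpDl.
have el : e < l by lra.
have := kC e e0 el; apply/negP; rewrite -ltNge.
have iel := ik _ e0.
have -> : \int[mu]_(h in `[e, l]) (k h / h) =
    \int[mu]_(h in `[e, d]) (k h / h) + A.
  have := Rintegral_itvB (x := d) iel; rewrite !bnd_simp => /(_ (ltW ed) (ltW dl)).
  by rewrite -/A => <-; rewrite addrC subrK.
have lnint : mu.-integrable `[e, d] (EFin \o (fun x : R => eta * x^-1)) /\
    \int[mu]_(h in `[e, d]) (eta * h^-1) = eta * ln d - eta * ln e.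
  apply: (@acd_ftc _ e d (fun x => eta * ln x)) => //.
    apply: measurable_funM => //.
    exact: measurable_funV.
  apply: acdZ; apply: (acd_eq (acd_ln e0 (acd_id e d) _)) => //.
    by move=> x /andP[].
  by move=> x _; rewrite mul1r.
case: lnint => iln lnE.
have : eta * ln d - eta * ln e <= \int[mu]_(h in `[e, d]) (k h / h).
  rewrite -lnE; apply: le_Rintegral => //.
    apply: integrableS iel => //.
    by apply: subset_itvl; rewrite bnd_simp ltW.
  move=> h /=; rewrite in_itv/= => /andP[eh hd].
  have h0 := lt_le_trans e0 eh.
  by rewrite ler_wpM2r ?invr_ge0 ?(ltW h0)// kge.
rewrite /e lnM ?posrE ?expR_gt0// expRK.
have -> : eta * ln d - eta * (ln d + - ((`|C| + `|A| + 1) / eta)) = `|C| + `|A| + 1.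
  by field; rewrite gt_eqF.
have := ler_norm C; have := ler_norm (- A); rewrite normrN => ? ? ?; clear lnE; lra.
Qed.

End eventually_small.

(** * Iterated integrals and symmetric kernels on the torus *)

Section iterated_integrals_on_a_box.
Local Open Scope ereal_scope.
Context d1 d2 (T1 : measurableType d1) (T2 : measurableType d2) (R : realType).
Variables (m1 : {sigma_finite_measure set T1 -> \bar R})
          (m2 : {sigma_finite_measure set T2 -> \bar R}).
Variables (A : set T1) (B : set T2).
Hypotheses (mA : measurable A) (mB : measurable B).

Lemma patch_box (f : T1 * T2 -> \bar R) x y :
  (f \_ (A `*` B)) (x, y) = (if x \in A then (fun y => f (x, y)) \_ B else cst 0) y.
Proof.
have E : ((x, y) \in A `*` B) = (x \in A) && (y \in B).
  by apply/idP/andP => [/set_mem[/mem_set ? /mem_set ?]|[/set_mem ? /set_mem ?]];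
    [split|apply: mem_set].
rewrite !patchE E; case: (x \in A) => /=; last by [].
by rewrite patchE.
Qed.

Lemma patch_boxr (f : T1 * T2 -> \bar R) x y :
  (f \_ (A `*` B)) (x, y) = (if y \in B then (fun x => f (x, y)) \_ A else cst 0) x.
Proof.
rewrite patch_box; case: (boolP (x \in A)) => xA; case: (boolP (y \in B)) => yB //;
  by rewrite /patch ?xA ?yB ?(negbTE xA) ?(negbTE yB).
Qed.

Lemma integral_patch_boxl (f : T1 * T2 -> \bar R) x :
  \int[m2]_y (f \_ (A `*` B)) (x, y) =
  ((fun x => \int[m2]_(y in B) f (x, y)) \_ A) x.
Proof.
under eq_integral do rewrite patch_box.
rewrite patchE; case: ifPn => _; last by rewrite integral0.
by rewrite [RHS]integral_mkcond.
Qed.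

Lemma integral_patch_boxr (f : T1 * T2 -> \bar R) y :
  \int[m1]_x (f \_ (A `*` B)) (x, y) =
  ((fun y => \int[m1]_(x in A) f (x, y)) \_ B) y.
Proof.
under eq_integral do rewrite patch_boxr.
rewrite patchE; case: ifPn => _; last by rewrite integral0.
by rewrite [RHS]integral_mkcond.
Qed.

Section nonnegative.
Variable f : T1 * T2 -> \bar R.
Hypotheses (mf : measurable_fun setT f) (f0 : forall z, 0 <= f z).

Let mfAB : measurable_fun setT (f \_ (A `*` B)).
Proof.
apply/(measurable_restrictT _ _).1; first exact: measurableX.
exact: measurable_funTS.
Qed.

Let fAB0 z : 0 <= (f \_ (A `*` B)) z.
Proof. by apply: erestrict_ge0 => {}z _; exact: f0. Qed.

Lemma integral_boxl : \int[m1 \x m2]_(z in A `*` B) f z =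
  \int[m1]_(x in A) \int[m2]_(y in B) f (x, y).
Proof.
rewrite integral_mkcond (fubini_tonelli1 _ mfAB fAB0) [RHS]integral_mkcond.
by apply: eq_integral => x _; exact: integral_patch_boxl.
Qed.

Lemma integral_boxr : \int[m1 \x m2]_(z in A `*` B) f z =
  \int[m2]_(y in B) \int[m1]_(x in A) f (x, y).
Proof.
rewrite integral_mkcond (fubini_tonelli2 _ mfAB fAB0) [RHS]integral_mkcond.
by apply: eq_integral => y _; exact: integral_patch_boxr.
Qed.

End nonnegative.

End iterated_integrals_on_a_box.

Lemma measurable_integral_fst d1 d2 (T1 : measurableType d1) (T2 : measurableType d2)
  (R : realType) (m1 : {sigma_finite_measure set T1 -> \bar R}) (A : set T1)
  (f : T1 * T2 -> \bar R) : measurable A -> measurable_fun setT f ->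
  (forall z, 0 <= f z)%E -> measurable_fun setT (fun y => \int[m1]_(x in A) f (x, y))%E.
Proof.
move=> mA mf f0.
have mfA : measurable_fun setT (f \_ (A `*` [set: T2])).
  apply/(measurable_restrictT _ _).1; first exact: measurableX.
  exact: measurable_funTS.
have fA0 z : (0 <= (f \_ (A `*` [set: T2])) z)%E.
  by apply: erestrict_ge0 => {}z _; exact: f0.
have := measurable_fun_fubini_tonelli_G (m1 := m1) _ mfA fA0.
congr (measurable_fun _ _); apply/funext => y.
by rewrite /fubini_G integral_patch_boxr patch_setT.
Qed.

Section bounded_fubini.
Context d1 d2 (T1 : measurableType d1) (T2 : measurableType d2) (R : realType).
Variables (m1 : {sigma_finite_measure set T1 -> \bar R})
          (m2 : {sigma_finite_measure set T2 -> \bar R}).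
Variables (A : set T1) (B : set T2).
Hypotheses (mA : measurable A) (mB : measurable B).
Hypotheses (Afin : (m1 A < +oo)%E) (Bfin : (m2 B < +oo)%E).
Variables (F : T1 -> T2 -> R) (C : R).
Hypothesis mF : measurable_fun setT (fun z => F z.1 z.2).
Hypothesis FC : forall x y, A x -> B y -> `|F x y| <= C.

Let f (z : T1 * T2) : \bar R := (F z.1 z.2)%:E.

Let iF : (m1 \x m2)%E.-integrable setT (f \_ (A `*` B)).
Proof.
apply/(integrable_mkcond _ _).1; first exact: measurableX.
apply: (@bounded_integrable _ _ _ _ _ (fun z => F z.1 z.2) C).
- exact: measurableX.
- rewrite [X in (X < _)%E](product_measure1E m1 m2 mA mB).
  by apply: lte_mul_pinfty => //; rewrite ge0_fin_numE.
- exact: measurable_funTS.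
- by move=> [x y] [/= Ax By]; exact: FC.
Qed.

Let iA x : A x -> m2.-integrable B (EFin \o F x).
Proof.
move=> Ax; apply: (@bounded_integrable _ _ _ _ _ _ C) => //.
  apply: measurable_funTS.
  exact: (measurableT_comp mF (pair1_measurable x)).
by move=> y By; exact: FC.
Qed.

Let iB y : B y -> m1.-integrable A (EFin \o F^~ y).
Proof.
move=> By; apply: (@bounded_integrable _ _ _ _ _ _ C) => //.
  apply: measurable_funTS.
  exact: (measurableT_comp mF (pair2_measurable y)).
by move=> x Ax; exact: FC.
Qed.

Let intA x : A x -> (\int[m2]_(y in B) f (x, y))%E = (\int[m2]_(y in B) F x y)%:E.
Proof. by move=> Ax; rewrite /Rintegral fineK//; apply: integrable_fin_num => //; exact: iA. Qed.

Let intB y : B y -> (\int[m1]_(x in A) f (x, y))%E = (\int[m1]_(x in A) F x y)%:E.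
Proof. by move=> By; rewrite /Rintegral fineK//; apply: integrable_fin_num => //; exact: iB. Qed.

Lemma integrable_Rintegral_snd :
  m1.-integrable A (EFin \o (fun x => \int[m2]_(y in B) F x y)).
Proof.
have := integrable_fubini_F iF.
rewrite (_ : fubini_F _ _ = (fun x => (\int[m2]_(y in B) f (x, y))%E) \_ A); last first.
  by apply/funext => x; exact: integral_patch_boxl.
move/(integrable_mkcond _ mA).2; apply: eq_integrable => // x /set_mem Ax.
by rewrite intA.
Qed.

Lemma Rintegral_exchange :
  \int[m1]_(x in A) \int[m2]_(y in B) F x y = \int[m2]_(y in B) \int[m1]_(x in A) F x y.
Proof.
have := Fubini iF.
under eq_integral do rewrite integral_patch_boxl.
under [X in _ = X -> _]eq_integral do rewrite integral_patch_boxr.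
rewrite -!integral_mkcond => H; rewrite /Rintegral; congr fine.
rewrite (eq_integral (fun x => (\int[m2]_(y in B) f (x, y)))%E).
  by rewrite H; apply: eq_integral => y /set_mem By; rewrite intB.
by move=> x /set_mem Ax; rewrite intA.
Qed.

End bounded_fubini.

Section kernels.
Context {R : realType}.
Local Notation mu := (@lebesgue_measure R).
Variable L : R.
Hypothesis L0 : 0 < L.
Local Notation l := (L / 2).
Implicit Types (K : R -> R -> R) (e h t x : R).

(* Kernels on the torus are studied in the coordinates (t, h) with x = t + h and
   0 < h <= L / 2, in which h is the distance between x and t. *)
Definition kern K : Prop :=
  [/\ measurable_fun setT (fun z : R * R => K z.1 z.2),
      (forall x t, K (x + L) t = K x t), (forall x t, K x (t + L) = K x t) &
      forall e, 0 < e -> exists C, forall t h, e <= h <= l -> `|K (t + h) t| <= C].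

(** Not normalised: a constant c has the value c L. *)
Definition avg K h : R := \int[mu]_(t in `[0, L[) K (t + h) t.

(** For a symmetric kernel, half of the integral over the pairs at distance at least e. *)
Definition strip e K : R := \int[mu]_(h in `[e, l]) avg K h.

Lemma kern_cst c : kern (fun _ _ => c).
Proof. by split=> // e e0; exists `|c|. Qed.

Lemma kernD K1 K2 : kern K1 -> kern K2 -> kern (fun x t => K1 x t + K2 x t).
Proof.
move=> [m1 a1 b1 c1] [m2 a2 b2 c2]; split.
- exact: measurable_funD.
- by move=> x t; rewrite a1 a2.
- by move=> x t; rewrite b1 b2.
- move=> e e0; have [C1 h1] := c1 e e0; have [C2 h2] := c2 e e0.
  exists (C1 + C2) => t h eh; rewrite (le_trans (ler_normD _ _))//.
  by rewrite lerD ?h1 ?h2.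
Qed.

Lemma kernM K1 K2 : kern K1 -> kern K2 -> kern (fun x t => K1 x t * K2 x t).
Proof.
move=> [m1 a1 b1 c1] [m2 a2 b2 c2]; split.
- exact: measurable_funM.
- by move=> x t; rewrite a1 a2.
- by move=> x t; rewrite b1 b2.
- move=> e e0; have [C1 h1] := c1 e e0; have [C2 h2] := c2 e e0.
  by exists (C1 * C2) => t h eh; rewrite normrM ler_pM// ?h1 ?h2.
Qed.

Lemma kern_eq K1 K2 : (forall x t, K1 x t = K2 x t) -> kern K1 -> kern K2.
Proof. by move=> E; have -> // : K1 = K2 by apply/funext => x; apply/funext. Qed.

Lemma kernZ c K : kern K -> kern (fun x t => c * K x t).
Proof. exact: kernM (kern_cst c). Qed.

Lemma kernN K : kern K -> kern (fun x t => - K x t).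
Proof. by move=> kK; apply: kern_eq (kernZ (-1) kK) => x t; rewrite mulN1r. Qed.

Lemma kernB K1 K2 : kern K1 -> kern K2 -> kern (fun x t => K1 x t - K2 x t).
Proof. by move=> k1 /kernN; exact: kernD. Qed.

Lemma kern_norm K : kern K -> kern (fun x t => `|K x t|).
Proof.
move=> [m a b c]; split.
- exact: (measurableT_comp (@normr_measurable R setT)).
- by move=> x t; rewrite a.
- by move=> x t; rewrite b.
- by move=> e e0; have [C h1] := c e e0; exists C => t h eh; rewrite normr_id h1.
Qed.

Lemma kern_inv K : kern K ->
  (forall e, 0 < e -> exists2 c, 0 < c & forall t h, e <= h <= l -> c <= K (t + h) t) ->
  kern (fun x t => (K x t)^-1).
Proof.
move=> [m a b _] Kc; split.
- exact: measurable_funV.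
- by move=> x t; rewrite a.
- by move=> x t; rewrite b.
- move=> e e0; have [c c0 h1] := Kc e e0; exists c^-1 => t h eh.
  have K0 := lt_le_trans c0 (h1 t h eh).
  by rewrite gtr0_norm ?invr_gt0// lef_pV2 ?posrE// h1.
Qed.

Lemma kern_ln K : kern K ->
  (forall e, 0 < e -> exists2 c, 0 < c & forall t h, e <= h <= l -> c <= K (t + h) t) ->
  kern (fun x t => ln (K x t)).
Proof.
move=> [m a b d] Kc; split.
- exact: (measurableT_comp (@measurable_ln R)).
- by move=> x t; rewrite a.
- by move=> x t; rewrite b.
- move=> e e0; have [c c0 h1] := Kc e e0; have [C CK] := d e e0.
  exists (`|ln c| + c^-1 * (C + c)) => t h eh.
  rewrite -(subrK (ln c) (ln _)) addrC (le_trans (ler_normD _ _))// lerD2l.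
  rewrite (le_trans (ln_lipschitz c0 (h1 t h eh) (lexx c)))//.
  rewrite ler_wpM2l ?invr_ge0 ?(ltW c0)// (le_trans (ler_normB _ _))//.
  by rewrite lerD ?CK// gtr0_norm.
Qed.

Lemma kern_measurable_shift K : kern K ->
  measurable_fun setT (fun z : R * R => K (z.2 + z.1) z.2).
Proof.
move=> [m _ _ _].
apply: (measurableT_comp m (g := fun z : R * R => (z.2 + z.1, z.2))).
by apply: measurable_fun_pair; [apply: measurable_funD; [exact: measurable_snd|exact: measurable_fst]|exact: measurable_snd].
Qed.

Lemma kern_measurable_slice K h : kern K -> measurable_fun setT (fun t => K (t + h) t).
Proof.
move=> /kern_measurable_shift m.
exact: (measurableT_comp m (pair1_measurable h)).
Qed.

Lemma kern_integrable K h : kern K -> 0 < h -> h <= l ->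
  mu.-integrable `[0, L[ (EFin \o (fun t => K (t + h) t)).
Proof.
move=> kK h0 hl; have mK := kern_measurable_slice h kK.
have [_ _ _ /(_ h h0) [C KC]] := kK.
apply: (itv_bounded_integrable (M := C)) => //; first exact: itv_lty.
by move=> t _; apply: KC; rewrite lexx.
Qed.

Lemma avg_shift K h a : kern K -> avg K h = \int[mu]_(t in `[0, L[) K (t + a + h) (t + a).
Proof.
move=> kK; have mK := kern_measurable_slice h kK.
case: kK => _ pl pr _.
congr fine; apply/esym.
apply: (@integral_periodic_shift _ a L (fun t => (K (t + h) t)%:E)) => //.
  exact/measurable_EFinP.
by move=> x; rewrite addrAC pl pr.
Qed.

(** The substitution t = x - h allows the derivative in h to be taken at fixed x instead of fixed
    t. *)
Lemma avg_down K h : kern K -> avg K h = \int[mu]_(x in `[0, L[) K x (x - h).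
Proof.
by move=> /avg_shift => /(_ h (- h)) ->; apply: eq_Rintegral => x _; rewrite subrK.
Qed.

Lemma avgD K1 K2 h : kern K1 -> kern K2 -> 0 < h -> h <= l ->
  avg (fun x t => K1 x t + K2 x t) h = avg K1 h + avg K2 h.
Proof. by move=> k1 k2 h0 hl; rewrite /avg RintegralD//; exact: kern_integrable. Qed.

Lemma avgZ c K h : kern K -> 0 < h -> h <= l ->
  avg (fun x t => c * K x t) h = c * avg K h.
Proof. by move=> k1 h0 hl; rewrite /avg RintegralZl//; exact: kern_integrable. Qed.

Lemma avgN K h : kern K -> 0 < h -> h <= l -> avg (fun x t => - K x t) h = - avg K h.
Proof.
move=> kK h0 hl; rewrite -[RHS]mulN1r -avgZ//.
by congr avg; apply/funext => x; apply/funext => t; rewrite mulN1r.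
Qed.

Lemma avgB K1 K2 h : kern K1 -> kern K2 -> 0 < h -> h <= l ->
  avg (fun x t => K1 x t - K2 x t) h = avg K1 h - avg K2 h.
Proof. by move=> k1 k2 h0 hl; rewrite avgD ?avgN//; exact: kernN. Qed.

Lemma avg_le K1 K2 h : kern K1 -> kern K2 -> 0 < h -> h <= l ->
  (forall t, K1 (t + h) t <= K2 (t + h) t) -> avg K1 h <= avg K2 h.
Proof.
by move=> k1 k2 h0 hl K12; apply: le_Rintegral => //; exact: kern_integrable.
Qed.

Lemma avg_eq K1 K2 h : (forall t, K1 (t + h) t = K2 (t + h) t) -> avg K1 h = avg K2 h.
Proof. by move=> K12; apply: eq_Rintegral => t _. Qed.

Lemma avg_cst c h : avg (fun _ _ => c) h = c * L.
Proof. by rewrite /avg Rintegral_cst// itv_measure ?subr0// ltW. Qed.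

Lemma avg_le_norm K h : kern K -> 0 < h -> h <= l ->
  `|avg K h| <= avg (fun x t => `|K x t|) h.
Proof. by move=> kK h0 hl; apply: le_normr_Rintegral => //; exact: kern_integrable. Qed.

Lemma avg_integrable K e : kern K -> 0 < e -> mu.-integrable `[e, l] (EFin \o avg K).
Proof.
move=> kK e0; have [_ _ _ /(_ e e0)[C KC]] := kK.
apply: (@integrable_Rintegral_snd _ _ _ _ _ mu mu `[e, l] `[0, L[ _ _ _ _
  (fun h t => K (t + h) t) C) => //; try exact: itv_lty.
- exact: kern_measurable_shift.
- by move=> h t /= + _; rewrite in_itv/= => eh; exact: KC.
Qed.

(** The bound [C] permits an exchange of the integrals, after which [acd_ftc] applies in h for each
    t. *)
Lemma strip_ftc (G g : R -> R -> R) (C : R) e : 0 < e -> e < l ->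
  measurable_fun setT (fun z : R * R => g z.1 z.2) ->
  (forall h t, e <= h <= l -> `|g h t| <= C) ->
  (forall t, acd e l (G^~ t) (g^~ t)) ->
  mu.-integrable `[0, L[ (EFin \o G l) -> mu.-integrable `[0, L[ (EFin \o G e) ->
  \int[mu]_(h in `[e, l]) \int[mu]_(t in `[0, L[) g h t =
  \int[mu]_(t in `[0, L[) G l t - \int[mu]_(t in `[0, L[) G e t.
Proof.
move=> e0 el mg gC aG il ie.
rewrite (@Rintegral_exchange _ _ _ _ _ mu mu `[e, l] `[0, L[ _ _ _ _ g C) //; try exact: itv_lty.
- rewrite -RintegralB//; apply: eq_Rintegral => t _.
  apply: (proj2 (acd_ftc el _ (aG t))).
  exact: (measurableT_comp mg (pair2_measurable t)).
- by move=> h t /= + _; rewrite in_itv/= => eh; exact: gC.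
Qed.

Lemma strip_up (Phi phi : R -> R -> R) e : 0 < e -> e < l -> kern Phi -> kern phi ->
  (forall t, acd e l (fun h => Phi (t + h) t) (fun h => phi (t + h) t)) ->
  strip e phi = avg Phi l - avg Phi e.
Proof.
move=> e0 el kP kp aP; have [_ _ _ /(_ e e0)[C pC]] := kp.
apply: (@strip_ftc (fun h t => Phi (t + h) t) (fun h t => phi (t + h) t) C) => //.
- exact: kern_measurable_shift.
- by move=> h t; exact: pC.
- by apply: kern_integrable => //; rewrite divr_gt0.
- by apply: kern_integrable => //; exact: ltW.
Qed.

Lemma kern_integrable_down K h : kern K -> 0 < h -> h <= l ->
  mu.-integrable `[0, L[ (EFin \o (fun x => K x (x - h))).
Proof.
move=> kK h0 hl; have [m _ _ /(_ h h0) [C KC]] := kK.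
apply: (itv_bounded_integrable (M := C)) => //; first exact: itv_lty.
- apply: (measurableT_comp m (g := fun x => (x, x - h))).
  by apply: measurable_fun_pair => //; apply: measurable_funB => //; exact: measurable_fst.
- by move=> x _; rewrite -{1}(subrK h x); apply: KC; rewrite lexx.
Qed.

Lemma strip_down (Phi phi : R -> R -> R) e : 0 < e -> e < l -> kern Phi -> kern phi ->
  (forall x, acd e l (fun h => Phi x (x - h)) (fun h => phi x (x - h))) ->
  strip e phi = avg Phi l - avg Phi e.
Proof.
move=> e0 el kP kp aP; have [m _ _ /(_ e e0)[C pC]] := kp.
rewrite !avg_down// /strip.
under eq_Rintegral do rewrite avg_down//.
apply: (@strip_ftc (fun h x => Phi x (x - h)) (fun h x => phi x (x - h)) C) => //.
- apply: (measurableT_comp m (g := fun z : R * R => (z.2, z.2 - z.1))).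
  by apply: measurable_fun_pair => //; apply: measurable_funB => //; exact: measurable_fst.
- by move=> h x eh; rewrite -{1}(subrK h x); exact: pC.
- by apply: kern_integrable_down => //; rewrite divr_gt0.
- by apply: kern_integrable_down => //; exact: ltW.
Qed.

Lemma stripD K1 K2 e : kern K1 -> kern K2 -> 0 < e ->
  strip e (fun x t => K1 x t + K2 x t) = strip e K1 + strip e K2.
Proof.
move=> k1 k2 e0; rewrite /strip -RintegralD//; try exact: avg_integrable.
apply: eq_Rintegral => h; rewrite inE/= in_itv/= => /andP[eh hl].
by rewrite avgD// (lt_le_trans e0).
Qed.

Lemma stripZ c K e : kern K -> 0 < e ->
  strip e (fun x t => c * K x t) = c * strip e K.
Proof.
move=> kK e0; rewrite /strip -RintegralZl//; try exact: avg_integrable.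
apply: eq_Rintegral => h; rewrite inE/= in_itv/= => /andP[eh hl].
by rewrite avgZ// (lt_le_trans e0).
Qed.

Lemma stripN K e : kern K -> 0 < e -> strip e (fun x t => - K x t) = - strip e K.
Proof.
move=> kK e0; transitivity (strip e (fun x t => -1 * K x t)); last by rewrite stripZ// mulN1r.
by congr strip; apply/funext => x; apply/funext => t; rewrite mulN1r.
Qed.

Lemma stripB K1 K2 e : kern K1 -> kern K2 -> 0 < e ->
  strip e (fun x t => K1 x t - K2 x t) = strip e K1 - strip e K2.
Proof. by move=> k1 k2 e0; rewrite stripD ?stripN//; exact: kernN. Qed.

Lemma strip_le K1 K2 e : kern K1 -> kern K2 -> 0 < e ->
  (forall t h, e <= h <= l -> K1 (t + h) t <= K2 (t + h) t) -> strip e K1 <= strip e K2.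
Proof.
move=> k1 k2 e0 K12; apply: le_Rintegral => //; try exact: avg_integrable.
move=> h /=; rewrite in_itv/= => /andP[eh hl].
by apply: avg_le => // [|t]; [exact: lt_le_trans eh|apply: K12; rewrite eh].
Qed.

Lemma strip_eq K1 K2 e : (forall t h, e <= h <= l -> K1 (t + h) t = K2 (t + h) t) ->
  strip e K1 = strip e K2.
Proof.
move=> K12; apply: eq_Rintegral => h; rewrite inE/= in_itv/= => eh.
by apply: avg_eq => t; exact: K12.
Qed.

Lemma strip_le_norm K e : kern K -> 0 < e ->
  `|strip e K| <= strip e (fun x t => `|K x t|).
Proof.
move=> kK e0; have kn := kern_norm kK.
rewrite ler_norml -stripN//; apply/andP; split; apply: strip_le => //.
- exact: kernN.
- by move=> t h _; rewrite lerNl -normrN ler_norm.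
- by move=> t h _; rewrite ler_norm.
Qed.

Lemma avg_ge0 K h : (forall t, 0 <= K (t + h) t) -> 0 <= avg K h.
Proof. by move=> K0; apply: Rintegral_ge0 => t _. Qed.

Lemma strip_anti K e e' : kern K -> (forall t h, 0 < h <= l -> 0 <= K (t + h) t) ->
  0 < e -> e <= e' -> strip e' K <= strip e K.
Proof.
move=> kK K0 e0 ee'; rewrite /strip /Rintegral.
have int := integrable_fin_num _ (avg_integrable kK _).
apply: fine_le => //; try exact: int; try by apply: int => //; exact: lt_le_trans ee'.
apply: ge0_subset_integral => //.
- by have /integrableP[] := avg_integrable kK e0.
- move=> h /=; rewrite in_itv/= => /andP[eh hl]; rewrite lee_fin; apply: avg_ge0 => t.
  by apply: K0; rewrite hl (lt_le_trans e0).
- by apply: subset_itvr; rewrite bnd_simp.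
Qed.

End kernels.

(** * Torus integrals of symmetric kernels as limits of strips *)

Section torus_fold.
Context {R : realType}.
Local Notation mu := (@lebesgue_measure R).
Variable L : R.
Hypothesis L0 : 0 < L.
Local Notation l := (L / 2).
Variable K : R -> R -> R.
Hypotheses (kK : kern L K) (K0 : forall x t, 0 <= K x t) (Ksym : forall x t, K x t = K t x).

Let m (h : R) : \bar R := (\int[mu]_(t in `[0%R, L[) (K (t + h) t)%:E)%E.

Let mK : measurable_fun setT (fun z : R * R => K z.1 z.2).
Proof. by case: kK. Qed.

Let mm : measurable_fun setT m.
Proof.
apply: (@measurable_integral_fst _ _ _ _ _ mu `[0, L[ (fun z : R * R => (K (z.1 + z.2) z.1)%:E)) => //.
  apply/measurable_EFinP.
  apply: (measurableT_comp mK (g := fun z : R * R => (z.1 + z.2, z.1))).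
  apply: measurable_fun_pair; last exact: measurable_fst.
  by apply: measurable_funD; [exact: measurable_fst|exact: measurable_snd].
by move=> z; rewrite lee_fin.
Qed.

Let m0 h : (0 <= m h)%E.
Proof. by apply: integral_ge0 => t _; rewrite lee_fin. Qed.

(** Shifting t by h turns the pair (t + L - h, t) into (t + L, t + h), which periodicity and
    symmetry identify with (t + h, t). *)
Let m_reflect h : m (L - h) = m h.
Proof.
case: kK => _ pl pr _.
rewrite /m.
transitivity (\int[mu]_(t in `[0%R, L[) (K (t + h + (L - h)) (t + h))%:E)%E.
  apply/esym/(@integral_periodic_shift _ h L (fun t => (K (t + (L - h)) t)%:E)) => //.
    by apply/measurable_EFinP; exact: (kern_measurable_slice _ kK).
  by move=> t; rewrite addrAC pl pr.
apply: eq_integral => t _.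
have -> : t + h + (L - h) = t + L by ring.
by rewrite pl Ksym.
Qed.

Let torus_m : torus_integral L K = (\int[mu]_(h in `[0%R, L[) m h)%E.
Proof.
have mKE : measurable_fun setT (fun z : R * R => (K z.1 z.2)%:E).
  exact/measurable_EFinP.
have KE0 (z : R * R) : (0 <= (K z.1 z.2)%:E)%E by rewrite lee_fin.
apply: etrans (integral_boxr mu mu (measurable_itv _) (measurable_itv _) mKE KE0) _.
transitivity (\int[mu]_(t in `[0%R, L[) \int[mu]_(h in `[0%R, L[) (K (t + h) t)%:E)%E.
  apply: eq_integral => t _ /=.
  rewrite -(@integral_periodic_shift _ t L (fun x => (K x t)%:E))//.
  - by apply: eq_integral => h _; rewrite addrC.
  - apply/measurable_EFinP.
    exact: (measurableT_comp mK (pair2_measurable t)).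
  - by move=> x; case: kK => _ -> _ _.
have mF : measurable_fun setT (fun z : R * R => (K (z.1 + z.2) z.1)%:E).
  apply/measurable_EFinP.
  apply: (measurableT_comp mK (g := fun z : R * R => (z.1 + z.2, z.1))).
  apply: measurable_fun_pair; last exact: measurable_fst.
  by apply: measurable_funD; [exact: measurable_fst|exact: measurable_snd].
have F0 : forall z : R * R, (0 <= (K (z.1 + z.2) z.1)%:E)%E.
  by move=> z; rewrite lee_fin.
rewrite -(integral_boxl mu mu _ _ mF F0)//.
by rewrite (integral_boxr mu mu _ _ mF F0).
Qed.

Lemma torus_fold : torus_integral L K =
  (2%:E * \int[mu]_(h in `]0%R, l]) \int[mu]_(t in `[0%R, L[) (K (t + h) t)%:E)%E.
Proof.
rewrite torus_m -/m.
have l0 : 0 < l by rewrite divr_gt0.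
have mS (D : set R) : measurable_fun D m by exact: measurable_funTS.
have -> : `[0, L[%classic = `[0, l[ `|` `[l, L[ :> set R.
  apply/seteqP; split => x /=; rewrite !in_itv/=.
    by case: (ltP x l) => xl /andP[? ?]; [left|right]; apply/andP; split.
  by move=> [|] /andP[? ?]; apply/andP; split; lra.
rewrite ge0_integral_setU//; try exact: mS; try (by move=> ? _; exact: m0); last first.
  by rewrite disj_set2E; apply/eqP; apply/seteqP; split => x //=; rewrite !in_itv/=; lra.
have refl : `[l, L[%classic = (fun x => L - x) @^-1` `]0, l]%classic.
  by apply/seteqP; split => x /=; rewrite !in_itv/= => /andP[? ?]; apply/andP; split; lra.
transitivity (\int[mu]_(x in `]0%R, l]) m x + \int[mu]_(x in `]0%R, l]) m x)%E.
  congr (_ + _)%E.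
    rewrite integral_itv_bndo_bndc; last exact: mS.
    by rewrite integral_itv_obnd_cbnd//; exact: mS.
  rewrite refl.
  transitivity (\int[mu]_(x in (fun x : R => (L - x)%R) @^-1` `]0%R, l]) m (L - x)%R)%E.
    by apply: eq_integral => x _; rewrite m_reflect.
  apply: (integral_measure_preserving (measurable_reflect L) (lebesgue_measure_reflect L)).
    exact: measurable_itv.
  exact: mm.
by rewrite mule_natl mule2n.
Qed.

Lemma strip_integral e : 0 < e ->
  (strip L e K)%:E = (\int[mu]_(h in `[e, l]) m h)%E.
Proof.
move=> e0; rewrite /strip /Rintegral fineK; last first.
  by apply: integrable_fin_num => //; exact: avg_integrable.
apply: eq_integral => h; rewrite inE/= in_itv/= => /andP[eh hl].
rewrite /avg /Rintegral fineK//; apply: integrable_fin_num => //.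
by apply: kern_integrable => //; exact: lt_le_trans eh.
Qed.

Lemma strip_le_torus e : 0 < e -> ((2 * strip L e K)%:E <= torus_integral L K)%E.
Proof.
move=> e0; rewrite torus_fold EFinM strip_integral// lee_pmul2l//.
apply: ge0_subset_integral => //; first exact: measurable_funTS.
by move=> x /=; rewrite !in_itv/= => /andP[ex ->]; rewrite (lt_le_trans e0).
Qed.

Lemma torus_le C : (forall e, 0 < e -> e < l -> strip L e K <= C) ->
  (torus_integral L K <= (2 * C)%:E)%E.
Proof.
move=> stripC; have l0 : 0 < l by rewrite divr_gt0.
rewrite torus_fold EFinM lee_pmul2l//.
(* With n + 2 in the denominator, [e n < l] holds from n = 0 on, as [stripC] requires. *)
pose e n : R := l / n.+2%:R.
have e0 n : 0 < e n by rewrite divr_gt0.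
have el n : e n < l by rewrite ltr_pdivrMr// ltr_pMr// ltr1n.
have -> : `]0, l]%classic = \bigcup_n `[e n, l]%classic :> set R.
  apply/seteqP; split => x /=.
    rewrite in_itv/= => /andP[x0 xl]; exists (Num.truncn (x^-1 * l)) => //=.
    rewrite in_itv/= xl andbT /e ler_pdivrMr// -ler_pdivrMl//.
    by apply: (le_trans (ltW (truncnS_gt _))); rewrite ler_nat.
  by move=> [n _] /=; rewrite !in_itv/= => /andP[ex ->]; rewrite (lt_le_trans (e0 n)).
have cv : (\int[mu]_(x in `[e n, l]%classic) m x @[n --> \oo] -->
   \int[mu]_(x in \bigcup_n `[e n, l]%classic) m x)%E.
  apply: ge0_nondecreasing_set_cvg_integral => //.
  - move=> n k nk; rewrite subsetEset; apply: subset_itvr; rewrite bnd_simp.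
    by rewrite /e ler_pM2l// lef_pV2 ?posrE// ler_nat.
  - by move=> n; exact: measurable_funTS.
rewrite -(cvg_lim _ cv)//; apply: lime_le; [exact: cvgP cv|apply: nearW => n].
by rewrite -strip_integral// lee_fin stripC.
Qed.

(** Strips grow as e decreases. Hence, if no [d] worked, all of them would be at most E / 2 - eta,
    and [torus_le] would contradict the value of the torus integral. *)
Lemma torus_approx (E eta : R) : torus_integral L K = E%:E -> 0 < eta ->
  exists2 d, 0 < d & forall e, 0 < e -> e < d -> E / 2 - eta < strip L e K.
Proof.
move=> KE eta0; apply: contrapT => nod.
have : (torus_integral L K <= (2 * (E / 2 - eta))%:E)%E.
  apply: torus_le => e e0 el; rewrite leNgt; apply/negP => se; apply: nod.
  exists e => // e' e'0 /ltW ee'; apply: (lt_le_trans se).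
  by apply: strip_anti.
by rewrite KE lee_fin; apply/negP; rewrite -ltNge; lra.
Qed.

Lemma strip_le_half (E e : R) : torus_integral L K = E%:E -> 0 < e -> strip L e K <= E / 2.
Proof. by move=> KE e0; have := strip_le_torus e0; rewrite KE lee_fin; lra. Qed.

End torus_fold.

(** * Closed curves *)

Lemma norm_le_of_sqr {R : realType} (x y : R) : 0 <= y -> x ^+ 2 <= y ^+ 2 -> `|x| <= y.
Proof. by move=> y0 xy; rewrite -(@ler_pXn2r _ 2)// ?nnegrE// real_normK ?num_real. Qed.

Section dot_product.
Context {R : realType} {n : nat}.
Implicit Types (u v w : 'rV[R]_n) (k : R).

Lemma dotpC u v : dotp u v = dotp v u.
Proof. by apply: eq_bigr => i _; rewrite mulrC. Qed.

Lemma dotpDl u v w : dotp (u + v) w = dotp u w + dotp v w.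
Proof. by rewrite -big_split/=; apply: eq_bigr => i _; rewrite mxE mulrDl. Qed.

Lemma dotpZl k u v : dotp (k *: u) v = k * dotp u v.
Proof. by rewrite mulr_sumr; apply: eq_bigr => i _; rewrite mxE mulrA. Qed.

Lemma dotpNl u v : dotp (- u) v = - dotp u v.
Proof. by rewrite -scaleN1r dotpZl mulN1r. Qed.

Lemma dotpBl u v w : dotp (u - v) w = dotp u w - dotp v w.
Proof. by rewrite dotpDl dotpNl. Qed.

Lemma dotpDr u v w : dotp u (v + w) = dotp u v + dotp u w.
Proof. by rewrite dotpC dotpDl !(dotpC u). Qed.

Lemma dotpZr k u v : dotp u (k *: v) = k * dotp u v.
Proof. by rewrite dotpC dotpZl dotpC. Qed.

Lemma dotpNr u v : dotp u (- v) = - dotp u v.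
Proof. by rewrite dotpC dotpNl dotpC. Qed.

Lemma dotpBr u v w : dotp u (v - w) = dotp u v - dotp u w.
Proof. by rewrite dotpDr dotpNr. Qed.

Definition dotp_expand := (dotpBl, dotpBr, dotpDl, dotpDr, dotpNl, dotpNr, dotpZl, dotpZr).

Lemma dotp_ge0 u : 0 <= dotp u u.
Proof. by apply: sumr_ge0 => i _; rewrite -expr2 sqr_ge0. Qed.

Lemma dotp_eq0 u : dotp u u = 0 -> u = 0.
Proof.
move=> u0; apply/rowP => i; rewrite mxE.
have /psumr_eq0P/(_ u0)/(_ i isT)/eqP : forall i : 'I_n, true -> 0 <= u 0 i * u 0 i.
  by move=> j _; rewrite -expr2 sqr_ge0.
by rewrite -expr2 sqrf_eq0 => /eqP.
Qed.

Lemma cauchy_schwarz u v : dotp u v ^+ 2 <= dotp u u * dotp v v.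
Proof.
have [v0|v0] := eqVneq (dotp v v) 0.
  by rewrite (dotp_eq0 v0) -(scale0r 0) !dotpZr !mul0r expr0n mulr0.
have vv : 0 < dotp v v by rewrite lt_neqAle eq_sym v0 dotp_ge0.
have := dotp_ge0 (dotp v v *: u - dotp u v *: v).
rewrite !dotp_expand (dotpC v u).
rewrite (_ : _ - _ = dotp v v * (dotp u u * dotp v v - dotp u v ^+ 2)); last by ring.
by rewrite pmulr_rge0 // subr_ge0.
Qed.

Lemma enorm_sqr u : enorm u ^+ 2 = dotp u u.
Proof. by rewrite /enorm sqr_sqrtr// dotp_ge0. Qed.

Lemma coord_le_dotp u i : u 0 i ^+ 2 <= dotp u u.
Proof.
rewrite /dotp (bigD1 i)//= expr2 lerDl.
by apply: sumr_ge0 => j _; rewrite -expr2 sqr_ge0.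
Qed.

(* The reflection 2 (w.g) g - (g.g) w of w in the direction g has norm g.g if w
   is a unit vector; the left-hand side is its product with v. *)
Lemma reflection_dotp_le v w g : dotp v v = 1 -> dotp w w = 1 ->
  2 * (dotp v g * dotp w g) - dotp v w * dotp g g <= dotp g g.
Proof.
move=> v1 w1; set z := (2 * dotp w g) *: g - dotp g g *: w.
have -> : 2 * (dotp v g * dotp w g) - dotp v w * dotp g g = dotp v z.
  by rewrite /z !dotp_expand; ring.
have zz : dotp z z = dotp g g ^+ 2.
  by rewrite /z !dotp_expand w1 (dotpC g w); ring.
have := cauchy_schwarz v z; rewrite v1 mul1r zz => /(norm_le_of_sqr (dotp_ge0 g)).
by apply: le_trans; exact: ler_norm.
Qed.

End dot_product.

Section circle_distance.
Context {R : realType}.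
Variable L : R.
Hypothesis L0 : 0 < L.
Local Notation d := (circle_dist L).
Implicit Types s t h x : R.

Let D s t := [set `|s - t + k%:~R * L| | k in [set: int]].

Let D0 s t : D s t !=set0.
Proof. by exists `|s - t + 0%:~R * L|; exists 0. Qed.

Let lbD s t : lbound (D s t) 0.
Proof. by move=> _ [k _ <-]. Qed.

Lemma circle_dist_le s t (k : int) : d s t <= `|s - t + k%:~R * L|.
Proof. by apply: ge_inf; [exists 0; exact: lbD|exists k]. Qed.

Lemma le_circle_dist s t x : (forall k : int, x <= `|s - t + k%:~R * L|) -> x <= d s t.
Proof. by move=> H; apply: (lb_le_inf (D0 s t)) => _ [k _ <-]. Qed.

Lemma circle_dist_ge0 s t : 0 <= d s t.
Proof. exact: le_circle_dist. Qed.

Lemma circle_distC s t : d s t = d t s.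
Proof.
have H x y : d x y <= d y x.
  apply: le_circle_dist => k; rewrite -normrN.
  have -> : - (y - x + k%:~R * L) = x - y + (- k)%:~R * L by rewrite rmorphN/=; ring.
  exact: circle_dist_le.
by apply/eqP; rewrite eq_le !H.
Qed.

Lemma circle_dist_perl s t : d (s + L) t = d s t.
Proof.
apply/eqP; rewrite eq_le; apply/andP; split; apply: le_circle_dist => k.
  have -> : s - t + k%:~R * L = s + L - t + (k - 1)%:~R * L by rewrite rmorphB/=; ring.
  exact: circle_dist_le.
have -> : s + L - t + k%:~R * L = s - t + (k + 1)%:~R * L by rewrite rmorphD/=; ring.
exact: circle_dist_le.
Qed.

Lemma circle_dist_val t h : 0 <= h <= L / 2 -> d (t + h) t = h.
Proof.
move=> /andP[h0 hl]; apply/eqP; rewrite eq_le; apply/andP; split.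
  have := circle_dist_le (t + h) t 0.
  rewrite (_ : t + h - t + 0%:~R * L = h); last by rewrite mulr0z; ring.
  by rewrite ger0_norm.
apply: le_circle_dist => k; rewrite (_ : t + h - t = h); last by ring.
case: k => m.
  have m0 : 0 <= (m%:R : R) * L by rewrite mulr_ge0// ltW.
  by rewrite -pmulrn ger0_norm ?lerDl// addr_ge0.
have m1 : L <= m.+1%:R * L by apply: ler_peMl; [exact: ltW|rewrite ler1n].
rewrite NegzE mulrNz mulNr -pmulrn; move: m1; set y := (m.+1%:R * L) => m1; clearbody y.
have m2 : h < y by move: (L0) (hl) (m1); lra.
rewrite ltr0_norm ?subr_lt0// opprB lerBrDr; lra.
Qed.

Lemma measurable_circle_dist : measurable_fun setT (fun z : R * R => d z.1 z.2).
Proof.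
pose g (u : R) := inf [set `|u + k%:~R * L| | k in [set: int]].
have g_lb (u : R) (k : int) : g u <= `|u + k%:~R * L|.
  by apply: ge_inf; [exists 0 => _ [j _ <-]|exists k].
have gle u v : g u <= g v + `|u - v|.
  rewrite -lerBlDr; apply: lb_le_inf; first by exists `|v + 0%:~R * L|; exists 0.
  move=> _ [k _ <-]; rewrite lerBlDr (le_trans (g_lb u k))//.
  have -> : u + k%:~R * L = (v + k%:~R * L) + (u - v) by ring.
  exact: ler_normD.
have mg : measurable_fun setT g.
  apply: (@lipschitz_measurable _ _ 1) => u v; rewrite mul1r ler_norml.
  by have := gle u v; have := gle v u; rewrite (distrC v u) => ? ?; apply/andP; split; lra.
apply: (measurableT_comp mg (g := fun z : R * R => z.1 - z.2)).
by apply: measurable_funB; [exact: measurable_fst|exact: measurable_snd].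
Qed.

Lemma circle_dist_perr s t : d s (t + L) = d s t.
Proof. by rewrite circle_distC circle_dist_perl circle_distC. Qed.

Lemma kern_circle_dist : kern L d.
Proof.
split; [exact: measurable_circle_dist|exact: circle_dist_perl|exact: circle_dist_perr|].
move=> e e0; exists (L / 2) => t h /andP[eh hl].
by rewrite circle_dist_val ?hl ?andbT; [rewrite ger0_norm// (le_trans _ eh)// ltW|
  rewrite (le_trans _ eh)// ltW].
Qed.

Lemma kern_inv_dist : kern L (fun x t => (d x t)^-1).
Proof.
apply: kern_inv; first exact: kern_circle_dist.
move=> e e0; exists e => // t h /andP[eh hl]; rewrite circle_dist_val// hl andbT.
by rewrite (le_trans _ eh)// ltW.
Qed.

End circle_distance.

(** * The kernels attached to a curve *)

Section curve_kernels.
Context {R : realType} {n : nat}.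
Implicit Types (f T : R -> 'rV[R]_n) (L x t : R).

(** [T] is a Borel representative of the derivative: periodic and of unit norm at every point, but a
    derivative only almost everywhere. Bounds and symmetries of the kernels then hold without an
    exceptional set. *)
Definition tangent_curve L f T : Prop :=
  [/\ [/\ forall s, f (s + L) = f s,
          forall s t, f s = f t -> exists k : int, s - t = k%:~R * L &
          forall s t, enorm (f s - f t) <= `|s - t|],
      forall s, T (s + L) = T s,
      forall s, dotp (T s) (T s) = 1,
      forall i, measurable_fun setT (fun s => T s 0 i) &
      {ae lebesgue_measure, forall s : R, forall i,
          is_derive s (1 : R) (fun s => f s 0 i) (T s 0 i)}].

Definition sqchord f x t : R := dotp (f x - f t) (f x - f t).

Definition tcos T x t : R := dotp (T x) (T t).

(* Half the partial derivatives of log (sqchord f x t) in x and, up to sign, in t *)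
Definition dlog1 f T x t : R := dotp (T x) (f x - f t) / sqchord f x t.
Definition dlog2 f T x t : R := dotp (T t) (f x - f t) / sqchord f x t.

(* cos (conformal angle) / |f x - f t|^2 *)
Definition ccos f T x t : R :=
  2 * (dlog1 f T x t * dlog2 f T x t) - tcos T x t / sqchord f x t.

Definition m0 f T x t : R := (sqchord f x t)^-1 - ccos f T x t.
Definition m1 f T x t : R := (1 - tcos T x t) / sqchord f x t.

(* The density of the Moebius energy of O'Hara *)
Definition ohara L f x t : R := (sqchord f x t)^-1 - (circle_dist L x t ^+ 2)^-1.

Definition logdist L f x t : R := 2 * ln (circle_dist L x t) - ln (sqchord f x t).

End curve_kernels.

Section curve.
Context {R : realType} {n : nat}.
Variables (L : R) (f T : R -> 'rV[R]_n).
Hypotheses (L0 : 0 < L) (fT : tangent_curve L f T).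
Local Notation l := (L / 2).
Local Notation d := (circle_dist L).
Implicit Types (x t h e : R).
Local Notation D := (sqchord f).

Let fL s : f (s + L) = f s. Proof. by case: fT => -[]. Qed.
Let T1 s : dotp (T s) (T s) = 1. Proof. by case: fT. Qed.

Lemma sqchordC x t : D x t = D t x.
Proof. by rewrite /sqchord !dotp_expand (dotpC (f x) (f t)); ring. Qed.

Lemma dlog1C x t : dlog1 f T x t = - dlog2 f T t x.
Proof. by rewrite /dlog1 /dlog2 sqchordC -mulNr -dotpNr opprB. Qed.

Lemma dlog2C x t : dlog2 f T x t = - dlog1 f T t x.
Proof. by rewrite dlog1C opprK. Qed.

Lemma ccosC x t : ccos f T x t = ccos f T t x.
Proof.
rewrite /ccos (dlog2C x t) (dlog1C x t) (sqchordC x t) /tcos (dotpC (T x)).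
by congr (_ - _); ring.
Qed.

Lemma m0C x t : m0 f T x t = m0 f T t x.
Proof. by rewrite /m0 ccosC sqchordC. Qed.

Lemma m1C x t : m1 f T x t = m1 f T t x.
Proof. by rewrite /m1 /tcos dotpC sqchordC. Qed.

Lemma oharaC x t : ohara L f x t = ohara L f t x.
Proof. by rewrite /ohara sqchordC circle_distC. Qed.

Lemma logdistC x t : logdist L f x t = logdist L f t x.
Proof. by rewrite /logdist sqchordC circle_distC. Qed.

Lemma sqchord_ge0 x t : 0 <= D x t.
Proof. exact: dotp_ge0. Qed.

Lemma sqchord_le x t : D x t <= (x - t) ^+ 2.
Proof.
case: fT => -[_ _ flip] _ _ _ _.
rewrite /sqchord -enorm_sqr -[leRHS]real_normK ?num_real//.
by rewrite ler_pXn2r// ?nnegrE// sqrtr_ge0.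
Qed.

Lemma coord_lipschitz i s t : `|f s 0 i - f t 0 i| <= `|s - t|.
Proof.
apply: norm_le_of_sqr => //; rewrite real_normK ?num_real//.
apply: le_trans (sqchord_le s t).
by have := coord_le_dotp (f s - f t) i; rewrite !mxE.
Qed.

Lemma measurable_coord i : measurable_fun setT (fun s => f s 0 i).
Proof.
by apply: (@lipschitz_measurable _ _ 1) => s t; rewrite mul1r coord_lipschitz.
Qed.

Lemma continuous_coord i : continuous (fun s => f s 0 i).
Proof.
move=> s; apply/cvgrPdist_le => /= e e0; near=> t.
rewrite (le_trans (coord_lipschitz _ _ _))//.
Unshelve. all: by end_near. Qed.

Lemma sqchord_gt0 t h : 0 < h -> h <= l -> 0 < D (t + h) t.
Proof.
move=> h0 hl; rewrite lt_neqAle sqchord_ge0 andbT eq_sym; apply/eqP.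
move=> /dotp_eq0/eqP; rewrite subr_eq0 => /eqP fE.
case: fT => -[_ /(_ _ _ fE)[k +] _] _ _ _ _.
rewrite (_ : t + h - t = h); last by ring.
case: k => m hE.
  case: m hE => [|m]; first by rewrite mul0r => hE; move: h0; rewrite hE ltxx.
  rewrite -pmulrn => hE.
  have : L <= m.+1%:R * L by apply: ler_peMl; [exact: ltW|rewrite ler1n].
  by rewrite -hE; move: (L0) (h0) (hl); lra.
move: hE; rewrite NegzE mulrNz mulNr -pmulrn => hE.
have : 0 < m.+1%:R * L by rewrite mulr_gt0.
by rewrite -[X in 0 < X]opprK -hE; move: (h0); lra.
Qed.

(** Compactness: [D (t + h) t] is continuous and positive on [0, L] x [e, L / 2], and periodicity
    brings every t into [0, L]. This is where embeddedness becomes quantitative; it controls 1 / D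
    and ln D off the diagonal. *)
Lemma sqchord_lb e : 0 < e ->
  exists2 c, 0 < c & forall t h, e <= h <= l -> c <= D (t + h) t.
Proof.
move=> e0; have [el|le] := leP e l; last first.
  by exists 1 => // t h /andP[eh hl]; move: (lt_le_trans le eh); rewrite ltNge hl.
pose F (z : R * R) := D (z.1 + z.2) z.1.
have cF : continuous F.
  rewrite (_ : F = \sum_(i < n) (fun z : R * R => (f (z.1 + z.2) 0 i - f z.1 0 i) *
      (f (z.1 + z.2) 0 i - f z.1 0 i))); last first.
    apply/funext => z; rewrite fct_sumE /F /sqchord /dotp.
    by apply: eq_bigr => i _; rewrite !mxE.
  elim/big_ind: _ => [|F1 F2 c1 c2|i _]; first exact: cst_continuous.
    by move=> z; exact: (cvgD (c1 z) (c2 z)).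
  have cg : continuous (fun z : R * R => f (z.1 + z.2) 0 i - f z.1 0 i).
    move=> z.
    have c1 : f (y.1 + y.2) 0 i @[y --> z] --> f (z.1 + z.2) 0 i.
      apply: (continuous_comp (f := fun y : R * R => y.1 + y.2)
        (g := fun s => f s 0 i) (x := z)); last exact: continuous_coord.
      by apply: cvgD; [exact: cvg_fst|exact: cvg_snd].
    have c2 : f y.1 0 i @[y --> z] --> f z.1 0 i.
      apply: (continuous_comp (f := fun y : R * R => y.1)
        (g := fun s => f s 0 i) (x := z)); last exact: continuous_coord.
      exact: cvg_fst.
    exact: (cvgB c1 c2).
  by move=> z; exact: (cvgM (cg z) (cg z)).
have cA : compact (`[0, L] `*` `[e, l] : set (R * R)).
  by apply: compact_setX; exact: segment_compact.
have A0 : (`[0, L] `*` `[e, l] : set (R * R)) !=set0.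
  by exists (0, e); split; rewrite /= in_itv/= lexx ?el ?(ltW L0).
have [[t0 h0] /set_mem[/= _ +] Fmin] := compact_EVT_min A0 cA (continuous_subspaceT cF).
rewrite in_itv/= => /andP[eh0 h0l].
exists (F (t0, h0)); first by apply: sqchord_gt0 => //; exact: lt_le_trans eh0.
move=> t h /andP[eh hl].
pose k := Num.floor (t / L); pose t1 := t - k%:~R * L.
have -> : D (t + h) t = D (t1 + h) t1.
  have per := @periodic_int R _ L f (- k) _ fL.
  rewrite /D /t1 -mulNr -rmorphN/=.
  rewrite -[in RHS](addrC h) addrA !per//.
  by rewrite addrC.
have := Fmin (t1, h); apply; apply/mem_set; split; rewrite /= in_itv/= ?eh ?hl//.
have := floor_itv (t / L); rewrite -/k intrD => /andP[k1 k2].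
rewrite /t1 subr_ge0 -ler_pdivlMr// k1/= lerBlDr.
by move: k2; rewrite ltr_pdivrMr// mulrDl mul1r addrC => /ltW.
Qed.

Lemma tcos_norm x t : `|tcos T x t| <= 1.
Proof.
by apply: norm_le_of_sqr => //; rewrite expr1n; have := cauchy_schwarz (T x) (T t); rewrite !T1 mulr1.
Qed.

Lemma tproj_sqr_le (v w : 'rV[R]_n) : dotp v v = 1 -> dotp v w ^+ 2 <= dotp w w.
Proof. by move=> v1; have := cauchy_schwarz v w; rewrite v1 mul1r. Qed.

Lemma m0_ge0 x t : 0 <= m0 f T x t.
Proof.
(* At coinciding points each quotient is a division by 0, hence 0. *)
have [D0|D0] := eqVneq (D x t) 0.
  by rewrite /m0 /ccos /dlog1 /dlog2 D0 invr0 !mulr0 subrr.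
have Dp : 0 < D x t by rewrite lt_neqAle eq_sym D0 sqchord_ge0.
have := reflection_dotp_le (f x - f t) (T1 x) (T1 t).
rewrite -/(D x t) => H.
rewrite (_ : m0 f T x t = (D x t - (2 * (dotp (T x) (f x - f t) * dotp (T t) (f x - f t)) -
   dotp (T x) (T t) * D x t)) / D x t ^+ 2); last first.
  by rewrite /m0 /ccos /dlog1 /dlog2 /tcos; field.
by rewrite divr_ge0 ?subr_ge0// sqr_ge0.
Qed.

Lemma m1_ge0 x t : 0 <= m1 f T x t.
Proof.
rewrite divr_ge0 ?sqchord_ge0// subr_ge0.
by rewrite (le_trans (ler_norm _))// tcos_norm.
Qed.

Lemma sqchord_le_circle_dist x t : D x t <= d x t ^+ 2.
Proof.
have r_le : enorm (f x - f t) <= d x t.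
  apply: le_circle_dist => k.
  case: fT => -[_ _ flip] _ _ _ _.
  rewrite -(periodic_int k x fL) (le_trans (flip _ _))//.
  by rewrite (_ : x + k%:~R * L - t = x - t + k%:~R * L)//; ring.
by rewrite /sqchord -enorm_sqr ler_pXn2r ?nnegrE ?circle_dist_ge0// sqrtr_ge0.
Qed.

Lemma circle_dist_eq0 x t : D x t = 0 -> d x t = 0.
Proof.
move=> /dotp_eq0/eqP; rewrite subr_eq0 => /eqP fE.
case: fT => -[_ /(_ _ _ fE)[k xt] _] _ _ _ _.
apply/eqP; rewrite eq_le circle_dist_ge0// andbT.
rewrite (le_trans (circle_dist_le L x t (- k)))//.
by rewrite xt rmorphN/= mulNr subrr normr0.
Qed.

(* On the diagonal both terms vanish because 1 / 0 = 0. *)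
Lemma ohara_ge0 x t : 0 <= ohara L f x t.
Proof.
have [D0|D0] := eqVneq (D x t) 0.
  by rewrite /ohara D0 circle_dist_eq0// expr0n subrr.
have Dp : 0 < D x t by rewrite lt_neqAle eq_sym D0 sqchord_ge0.
have Dd := sqchord_le_circle_dist x t.
by rewrite subr_ge0 lef_pV2 ?posrE// (lt_le_trans Dp).
Qed.

(* Likewise ln 0 = 0. *)
Lemma logdist_ge0 x t : 0 <= logdist L f x t.
Proof.
have [D0|D0] := eqVneq (D x t) 0.
  by rewrite /logdist D0 circle_dist_eq0// !ln0// mulr0 subrr.
have Dp : 0 < D x t by rewrite lt_neqAle eq_sym D0 sqchord_ge0.
have Dd := sqchord_le_circle_dist x t.
have dp : 0 < d x t.
  rewrite lt_neqAle circle_dist_ge0 andbT eq_sym; apply/eqP => d0.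
  by move: Dd; rewrite d0 expr0n leNgt Dp.
by rewrite /logdist mulr_natl -lnXn// subr_ge0 ler_ln ?posrE ?exprn_gt0.
Qed.

End curve.

Section acd_dot_product.
Context {R : realType} {n : nat}.
Implicit Types (a b : R) (phi V : R -> 'rV[R]_n) (w y : 'rV[R]_n).

(** Agreement on [a, b] suffices because derivatives are required at interior points only. It serves
    for [circle_dist], which is equal to h only for h in [0, L / 2]. *)
Lemma acd_eq_in a b (F G f g : R -> R) : acd a b F f ->
  (forall x, a <= x <= b -> F x = G x) ->
  (forall x, a < x < b -> f x = g x) -> acd a b G g.
Proof.
move=> [[K FK] dF] FG fg; split.
  by exists K => x y xab yab; rewrite -!FG//; exact: FK.
apply: ae_imply dF => x dFx xab; rewrite -fg//.
apply: near_eq_is_derive (dFx xab).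
have xi : x \in `]a, b[ by rewrite in_itv/=.
have := near_in_itvoo xi; apply: filterS => z.
by rewrite in_itv/= => /andP[/ltW az /ltW zb]; apply: FG; rewrite az.
Qed.

Lemma acd_dotp a b phi V w y :
  (forall i, acd a b (fun h => phi h 0 i) (fun h => V h 0 i)) ->
  acd a b (fun h => dotp w (phi h - y)) (fun h => dotp w (V h)).
Proof.
move=> H.
apply: (acd_eq (acd_sum (fun i => acdZ (w 0 i) (acdB (H i) (acd_cst a b (y 0 i)))))).
- by move=> h; rewrite /dotp; apply: eq_bigr => i _; rewrite !mxE.
- by move=> h _; rewrite /dotp; apply: eq_bigr => i _; rewrite subr0.
Qed.

Lemma acd_sqnorm a b phi V y :
  (forall i, acd a b (fun h => phi h 0 i) (fun h => V h 0 i)) ->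
  acd a b (fun h => dotp (phi h - y) (phi h - y)) (fun h => 2 * dotp (V h) (phi h - y)).
Proof.
move=> H; pose H' i := acdB (H i) (acd_cst a b (y 0 i)).
apply: (acd_eq (acd_sum (fun i => acdM (H' i) (H' i)))).
- by move=> h; rewrite /dotp; apply: eq_bigr => i _; rewrite !mxE.
- by move=> h _; rewrite /dotp mulr_sumr; apply: eq_bigr => i _; rewrite !mxE; ring.
Qed.

End acd_dot_product.

(** * Derivatives of the kernels in h, at fixed t and at fixed x *)

Section curve_calculus.
Context {R : realType} {n : nat}.
Variables (L : R) (f T : R -> 'rV[R]_n).
Hypotheses (L0 : 0 < L) (fT : tangent_curve L f T).
Local Notation l := (L / 2).
Local Notation d := (circle_dist L).
Implicit Types (x t h e : R).
Local Notation D := (sqchord f).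
Local Notation p := (dlog1 f T).
Local Notation q := (dlog2 f T).
Local Notation kap := (ccos f T).

Let fL s : f (s + L) = f s. Proof. by case: fT => -[]. Qed.
Let TL s : T (s + L) = T s. Proof. by case: fT. Qed.
Let T1 s : dotp (T s) (T s) = 1. Proof. by case: fT. Qed.
Let mT i : measurable_fun setT (fun s => T s 0 i). Proof. by case: fT. Qed.
Let mf i : measurable_fun setT (fun s => f s 0 i). Proof. exact: (measurable_coord fT). Qed.

Let m_fst (g : R -> R) : measurable_fun setT g -> measurable_fun setT (fun z : R * R => g z.1).
Proof. by move=> mg; exact: (measurableT_comp mg measurable_fst). Qed.

Let m_snd (g : R -> R) : measurable_fun setT g -> measurable_fun setT (fun z : R * R => g z.2).
Proof. by move=> mg; exact: (measurableT_comp mg measurable_snd). Qed.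

Lemma kern_sqchord : kern L D.
Proof.
split.
- apply: measurable_sum => i.
  rewrite (_ : (fun _ => _) = (fun z : R * R => (f z.1 0 i - f z.2 0 i) * (f z.1 0 i - f z.2 0 i))).
    by apply: measurable_funM; apply: measurable_funB;
      try exact: (m_fst (mf i)); exact: (m_snd (mf i)).
  by apply/funext => z; rewrite !mxE.
- by move=> x t; rewrite /sqchord fL.
- by move=> x t; rewrite /sqchord fL.
- move=> e e0; exists (l ^+ 2) => t h /andP[eh hl].
  have h0 : 0 < h := lt_le_trans e0 eh.
  rewrite ger0_norm ?sqchord_ge0// (le_trans (sqchord_le fT _ _))//.
  rewrite (_ : t + h - t = h); last by ring.
  by rewrite ler_sqr ?nnegrE ?(ltW h0)// (le_trans (ltW h0)).
Qed.

Lemma kern_inv_sqchord : kern L (fun x t => (D x t)^-1).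
Proof. by apply: kern_inv; [exact: kern_sqchord|exact: (sqchord_lb L0 fT)]. Qed.

Lemma kern_ln_sqchord : kern L (fun x t => ln (D x t)).
Proof. by apply: kern_ln; [exact: kern_sqchord|exact: (sqchord_lb L0 fT)]. Qed.

Let kern_proj (G : R * R -> 'rV[R]_n) : (forall i, measurable_fun setT (fun z => G z 0 i)) ->
  measurable_fun setT (fun z : R * R => dotp (G z) (f z.1 - f z.2)).
Proof.
move=> mG; apply: measurable_sum => i.
rewrite (_ : (fun _ => _) = (fun z : R * R => G z 0 i * (f z.1 0 i - f z.2 0 i))).
  apply: measurable_funM; first exact: mG.
  by apply: measurable_funB; [exact: (m_fst (mf i))|exact: (m_snd (mf i))].
by apply/funext => z; rewrite !mxE.
Qed.

Lemma tproj_norm_le (v : 'rV[R]_n) t h : dotp v v = 1 -> 0 <= h ->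
  `|dotp v (f (t + h) - f t)| <= h.
Proof.
move=> v1 h0; apply: norm_le_of_sqr => //.
apply: (le_trans (tproj_sqr_le _ v1)); apply: (le_trans (sqchord_le fT _ _)).
by rewrite (_ : t + h - t = h)//; ring.
Qed.

Lemma kern_tproj1 : kern L (fun x t => dotp (T x) (f x - f t)).
Proof.
split.
- by apply: (kern_proj (G := fun z => T z.1)) => i; exact: (m_fst (mT i)).
- by move=> x t; rewrite fL TL.
- by move=> x t; rewrite fL.
- move=> e e0; exists l => t h /andP[eh hl].
  by rewrite (le_trans (tproj_norm_le _ _ _))// (le_trans (ltW e0)).
Qed.

Lemma kern_tproj2 : kern L (fun x t => dotp (T t) (f x - f t)).
Proof.
split.
- by apply: (kern_proj (G := fun z => T z.2)) => i; exact: (m_snd (mT i)).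
- by move=> x t; rewrite fL.
- by move=> x t; rewrite fL TL.
- move=> e e0; exists l => t h /andP[eh hl].
  by rewrite (le_trans (tproj_norm_le _ _ _))// (le_trans (ltW e0)).
Qed.

Lemma kern_tcos : kern L (tcos T).
Proof.
split.
- apply: measurable_sum => i.
  by apply: measurable_funM; [exact: (m_fst (mT i))|exact: (m_snd (mT i))].
- by move=> x t; rewrite /tcos TL.
- by move=> x t; rewrite /tcos TL.
- by move=> e e0; exists 1 => t h _; exact: (tcos_norm fT).
Qed.

Lemma kern_dlog1 : kern L p.
Proof. exact: kernM kern_tproj1 kern_inv_sqchord. Qed.

Lemma kern_dlog2 : kern L q.
Proof. exact: kernM kern_tproj2 kern_inv_sqchord. Qed.

Lemma kern_ccos : kern L kap.
Proof.
apply: kernB; last exact: kernM kern_tcos kern_inv_sqchord.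
by apply: kernZ; exact: kernM kern_dlog1 kern_dlog2.
Qed.

Lemma kern_m0 : kern L (m0 f T).
Proof. exact: kernB kern_inv_sqchord kern_ccos. Qed.

Lemma kern_m1 : kern L (m1 f T).
Proof. exact: kernM (kernB (kern_cst L 1) kern_tcos) kern_inv_sqchord. Qed.

Lemma kern_inv_dist2 : kern L (fun x t => (d x t ^+ 2)^-1).
Proof.
apply: kern_eq (kernM (kern_inv_dist L0) (kern_inv_dist L0)) => x t.
by rewrite -invfM expr2.
Qed.

Lemma kern_ohara : kern L (ohara L f).
Proof. exact: kernB kern_inv_sqchord kern_inv_dist2. Qed.

Lemma kern_logdist : kern L (logdist L f).
Proof.
apply: kernB kern_ln_sqchord; apply: kernZ; apply: kern_ln (kern_circle_dist L0) _.
move=> e e0; exists e => // t h /andP[eh hl].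
by rewrite circle_dist_val ?eh// hl (le_trans (ltW e0)).
Qed.

Section strip.
Variables (e : R).
Hypotheses (e0 : 0 < e).

Let acd_coord_up t i : acd e l (fun h => f (t + h) 0 i) (fun h => T (t + h) 0 i).
Proof.
split.
  exists 1 => x y _ _; rewrite mul1r (le_trans (coord_lipschitz fT _ _ _))//.
  by rewrite (_ : t + x - (t + y) = x - y)//; ring.
case: fT => _ _ _ _ dfT.
have := ae_measure_preserving (measurable_shift t) (lebesgue_measure_shift t) dfT.
apply: ae_imply => h /(_ i); rewrite (addrC h t) => H _.
have dt : is_derive h (1 : R) (fun h => t + h) 1.
  by have := is_deriveD (is_derive_cst t h (1 : R)) (is_derive_id h (1 : R)); rewrite add0r.
by have := is_derive1_comp H dt; rewrite mulr1.
Qed.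

Let acd_coord_down x i : acd e l (fun h => f (x - h) 0 i) (fun h => (- T (x - h)) 0 i).
Proof.
split.
  exists 1 => u v _ _; rewrite mul1r (le_trans (coord_lipschitz fT _ _ _))//.
  by rewrite (_ : x - u - (x - v) = - (u - v)) ?normrN//; ring.
case: fT => _ _ _ _ dfT.
have := ae_measure_preserving (measurable_reflect x) (lebesgue_measure_reflect x) dfT.
apply: ae_imply => h /(_ i) H _.
have dt : is_derive h (1 : R) (fun h => x - h) (-1).
  by have := is_deriveB (is_derive_cst x h (1 : R)) (is_derive_id h (1 : R)); rewrite sub0r.
by have := @is_derive1_comp R (fun s => f s 0 i) (fun h => x - h) h _ _ H dt; rewrite mulrN1 mxE.
Qed.

Let lb_up t : exists2 c, 0 < c & forall h, e <= h <= l -> c <= D (t + h) t.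
Proof. by have [c c0 cD] := sqchord_lb L0 fT e0; exists c => // h; exact: cD. Qed.

Let lb_down x : exists2 c, 0 < c & forall h, e <= h <= l -> c <= D x (x - h).
Proof.
have [c c0 cD] := sqchord_lb L0 fT e0; exists c => // h eh.
by rewrite -{1}(subrK h x); exact: cD.
Qed.

Lemma acd_up_sqchord t :
  acd e l (fun h => D (t + h) t) (fun h => 2 * dotp (T (t + h)) (f (t + h) - f t)).
Proof. by apply: acd_sqnorm => i; exact: acd_coord_up. Qed.

Lemma acd_up_tproj2 t :
  acd e l (fun h => dotp (T t) (f (t + h) - f t)) (fun h => tcos T (t + h) t).
Proof.
apply: (acd_eq (acd_dotp _ _ (acd_coord_up t))) => // h _.
by rewrite /tcos dotpC.
Qed.

Lemma acd_down_sqchord x :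
  acd e l (fun h => D x (x - h)) (fun h => 2 * dotp (T (x - h)) (f x - f (x - h))).
Proof.
apply: (acd_eq (acd_sqnorm (f x) (acd_coord_down x))) => h.
  by rewrite -[LHS]/(D (x - h) x) sqchordC.
by move=> _; rewrite dotpNl -dotpNr opprB.
Qed.

Lemma acd_down_tproj1 x :
  acd e l (fun h => dotp (T x) (f x - f (x - h))) (fun h => tcos T x (x - h)).
Proof.
apply: (acd_eq (acdN (acd_dotp (T x) (f x) (acd_coord_down x)))) => h.
  by rewrite -dotpNr opprB.
by move=> _; rewrite dotpNr opprK.
Qed.

Lemma acd_up_ln t : acd e l (fun h => ln (D (t + h) t)) (fun h => 2 * p (t + h) t).
Proof.
have [c c0 cD] := lb_up t.
apply: (acd_eq (acd_ln c0 (acd_up_sqchord t) cD)) => // h _.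
by rewrite /dlog1 mulrA.
Qed.

Lemma acd_down_ln x : acd e l (fun h => ln (D x (x - h))) (fun h => 2 * q x (x - h)).
Proof.
have [c c0 cD] := lb_down x.
apply: (acd_eq (acd_ln c0 (acd_down_sqchord x) cD)) => // h _.
by rewrite /dlog2 mulrA.
Qed.

(** At fixed t the projection of the chord on T t has derivative [tcos], and [D] has as derivative
    twice the projection on T x; the quotient rule gives tcos / D - 2 p q. *)
Lemma acd_up_dlog2 t : acd e l (fun h => q (t + h) t) (fun h => - kap (t + h) t).
Proof.
have [c c0 cD] := lb_up t.
apply: (acd_eq (acdM (acd_up_tproj2 t) (acdV c0 (acd_up_sqchord t) cD))) => // h.
move=> /andP[eh hl]; rewrite /ccos /dlog1 /dlog2.
have : D (t + h) t != 0.
  by rewrite gt_eqF// (lt_le_trans c0)// cD// (ltW eh) (ltW hl).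
by move=> D0; field.
Qed.

Lemma acd_down_dlog1 x : acd e l (fun h => p x (x - h)) (fun h => - kap x (x - h)).
Proof.
have [c c0 cD] := lb_down x.
apply: (acd_eq (acdM (acd_down_tproj1 x) (acdV c0 (acd_down_sqchord x) cD))) => // h.
move=> /andP[eh hl]; rewrite /ccos /dlog1 /dlog2.
have : D x (x - h) != 0.
  by rewrite gt_eqF// (lt_le_trans c0)// cD// (ltW eh) (ltW hl).
by move=> D0; field.
Qed.

Lemma acd_up_dist t : acd e l (fun h => d (t + h) t) (fun=> 1).
Proof.
apply: (acd_eq_in (acd_id e l)) => // h /andP[eh hl].
by rewrite circle_dist_val// hl (le_trans (ltW e0)).
Qed.

Lemma acd_down_dist x : acd e l (fun h => d x (x - h)) (fun=> 1).
Proof.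
apply: (acd_eq_in (acd_id e l)) => // h /andP[eh hl].
by rewrite -{1}(subrK h x) circle_dist_val// hl (le_trans (ltW e0)).
Qed.

End strip.

(** Shifting t by l sends (t + l, t) to (t + L, t + l): up to a period, the two points are
    exchanged. *)
Lemma avg_antipode K : kern L K -> avg L K l = avg L (fun x t => K t x) l.
Proof.
move=> kK; rewrite (avg_shift L0 l l kK); apply: eq_Rintegral => t _ /=.
case: kK => _ pl _ _.
by rewrite (_ : t + l + l = t + L) ?pl//; field.
Qed.

(* Differentiate [ln |f (t + l) - f t|^2] in t and integrate over a period;
   antipodally, shifting t by l exchanges p and - q. *)
Lemma avg_dlog2_antipode : avg L q l = 0.
Proof.
have l0 : 0 < l by rewrite divr_gt0.
have kp := kern_dlog1; have kq := kern_dlog2.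
have qp : avg L q l = - avg L p l.
  rewrite (avg_antipode kq) -(avgN kp)//.
  by apply: avg_eq => t; exact: dlog2C.
suff : avg L (fun x t => p x t - q x t) l = 0.
  by rewrite (avgB kp kq)// qp opprK => /eqP; rewrite -mulr2n mulrn_eq0/= => /eqP ->; rewrite oppr0.
have [c c0 cD] := sqchord_lb L0 fT l0.
have aco i : acd 0 L (fun t => (f (t + l) - f t) 0 i) (fun t => (T (t + l) - T t) 0 i).
  have ac u : acd 0 L (fun t => f (t + u) 0 i) (fun t => T (t + u) 0 i).
    split.
      exists 1 => x y _ _; rewrite mul1r (le_trans (coord_lipschitz fT _ _ _))//.
      by rewrite (_ : x + u - (y + u) = x - y)//; ring.
    case: fT => _ _ _ _ dfT.
    have := ae_measure_preserving (measurable_shift u) (lebesgue_measure_shift u) dfT.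
    apply: ae_imply => h /(_ i) H _.
    have dt : is_derive h (1 : R) (fun h => h + u) 1.
      by have := is_deriveD (is_derive_id h (1 : R)) (is_derive_cst u h (1 : R)); rewrite addr0.
    by have := @is_derive1_comp R (fun s => f s 0 i) (fun h => h + u) h _ _ H dt; rewrite mulr1.
  apply: (acd_eq (acdB (ac l) (ac 0))) => t; last by move=> _; rewrite !mxE addr0.
  by rewrite !mxE addr0.
have aD : acd 0 L (fun t => ln (D (t + l) t))
    (fun t => 2 * (p (t + l) t - q (t + l) t)).
  have cD' t : 0 <= t <= L -> c <= dotp (f (t + l) - f t - 0) (f (t + l) - f t - 0).
    by move=> _; rewrite subr0; apply: cD; rewrite !lexx.
  apply: (acd_eq (acd_ln c0 (acd_sqnorm 0 aco) cD')) => t.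
    by rewrite subr0.
  by move=> _; rewrite /dlog1 /dlog2 subr0 dotpBl; rewrite -/(D (t + l) t); ring.
have kpq := kernB kp kq.
have k2 := kernZ 2 kpq.
have [_ E] := acd_ftc L0 (kern_measurable_slice l k2) aD.
have := @avgZ R L 2 _ l kpq l0 (lexx l).
rewrite /avg Rintegral_itv_bndo_bndc; last exact: (kern_integrable k2).
rewrite E.
have -> : ln (D (L + l) L) - ln (D (0 + l) 0) = 0.
  have fL0 : f L = f 0 by rewrite -[in LHS](add0r L) fL.
  have fLl : f (L + l) = f (0 + l) by rewrite addrC fL add0r.
  by rewrite /sqchord fL0 fLl subrr.
by move=> /esym/eqP; rewrite mulf_eq0 pnatr_eq0/= => /eqP.
Qed.

End curve_calculus.

(** * The cosine formula *)

Section doubling.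
Context {R : realType}.
Local Notation mu := (@lebesgue_measure R).
Variables (a w : R -> R) (l C : R).
Local Notation u e := (\int[mu]_(h in `[e, l]) a h).
Hypotheses (ia : forall e, 0 < e -> mu.-integrable `[e, l] (EFin \o a)).
Hypotheses (a0 : forall h, 0 < h -> h <= l -> 0 <= a h).
Hypotheses (aw : forall h, 0 < h -> h <= l -> 2 * w h / h <= a h).
Hypotheses (uw : forall e, 0 < e -> e < l -> u e <= C + w e).
Hypotheses (hw : forall eta, 0 < eta -> exists2 d, 0 < d & forall h, 0 < h < d -> h * w h < eta).

Let u_split e e' : 0 < e -> e <= e' -> e' <= l -> u e = \int[mu]_(h in `[e, e']) a h + u e'.
Proof.
move=> e0 ee' e'l; have iel := ia e0.
have := Rintegral_itvB (x := e') iel; rewrite !bnd_simp => /(_ ee' e'l) H.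
rewrite -[u e'](Rintegral_itv_obnd_cbnd (r := e') (b := BRight l)).
  by rewrite -H addrC subrK.
apply: integrableS iel => //; apply: subset_itvr.
by rewrite bnd_simp.
Qed.

Let u_anti e e' : 0 < e -> e <= e' -> e' <= l -> u e' <= u e.
Proof.
move=> e0 ee' e'l; rewrite (u_split e0 ee' e'l) lerDr.
apply: Rintegral_ge0 => h /=; rewrite in_itv/= => /andP[eh he'].
by apply: a0; [exact: lt_le_trans eh|exact: le_trans he' e'l].
Qed.

(** For h in [e / 2, e] one has w h >= u h - C >= u e - C, hence a h >= 2 (u e - C) / e on an
    interval of length e / 2. *)
Let step e : 0 < e -> e < l -> C < u e -> 2 * (u e - C) <= u (e / 2) - C.
Proof.
move=> e0 el Cu; have e20 : 0 < e / 2 by rewrite divr_gt0.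
have e2e : e / 2 <= e by lra.
rewrite (u_split e20 e2e (ltW el)).
suff : u e - C <= \int[mu]_(h in `[(e / 2), e]) a h by lra.
have cE : \int[mu]_(h in `[(e / 2), e]) (2 * (u e - C) / e) = u e - C.
  by rewrite Rintegral_cst// itv_measure//; field; rewrite gt_eqF.
rewrite -[leLHS]cE; apply: le_Rintegral => //.
- by apply: bounded_integrable => //; exact: itv_lty.
- apply: integrableS (ia e20) => //; apply: subset_itvl.
  by rewrite bnd_simp ltW.
move=> h /=; rewrite in_itv/= => /andP[eh he].
have h0 : 0 < h := lt_le_trans e20 eh.
have hl : h < l := le_lt_trans he el.
apply: le_trans (aw h0 (ltW hl)).
have wh : u e - C <= w h.
  by have := uw h0 hl; have := u_anti h0 he (ltW el); lra.
rewrite -!mulrA ler_pM2l//; apply: ler_pM => //.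
- by rewrite subr_ge0 ltW.
- by rewrite invr_ge0 ltW.
- by rewrite lef_pV2.
Qed.

(* If u e > C then u - C at least doubles each time e is halved, so e * (u e - C),
   hence e * w e, would stay bounded away from 0. *)
Lemma integral_le_of_doubling e : 0 < e -> e < l -> u e <= C.
Proof.
move=> e0 el; rewrite leNgt; apply/negP => Cu.
pose eps k := e / 2 ^+ k.
have eps0 k : 0 < eps k by rewrite divr_gt0// exprn_gt0.
have epsl k : eps k < l.
  by rewrite (le_lt_trans _ el)// ler_pdivrMr ?exprn_gt0// ler_peMr ?(ltW e0)// exprn_ege1// ler1n.
have grow k : 2 ^+ k * (u e - C) <= u (eps k) - C.
  elim: k => [|k IH]; first by rewrite /eps !expr0 mul1r divr1.
  have Ck : C < u (eps k).
    rewrite -subr_gt0; apply: lt_le_trans IH.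
    by rewrite mulr_gt0 ?exprn_gt0// subr_gt0.
  have := step (eps0 k) (epsl k) Ck.
  rewrite (_ : eps k / 2 = eps k.+1); last by rewrite /eps exprS invfM; ring.
  by apply: le_trans; rewrite exprS -mulrA ler_pM2l.
have eta0 : 0 < e * (u e - C) by rewrite mulr_gt0// subr_gt0.
have [d d0 Hd] := hw eta0.
(* Then e / d < k < 2^k, so [eps k < d]. *)
pose k := (Num.truncn (e / d)).+1.
have kd : eps k < d.
  rewrite /eps ltr_pdivrMr ?exprn_gt0// mulrC -ltr_pdivrMr//.
  rewrite (lt_le_trans (truncnS_gt _))// -natrX ler_nat.
  by rewrite ltnW// ltn_expl.
have := Hd (eps k); rewrite eps0 kd => /(_ isT); apply/negP; rewrite -leNgt.
apply: (@le_trans _ _ (eps k * (u (eps k) - C))).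
  apply: le_trans (_ : eps k * (2 ^+ k * (u e - C)) <= _); last by rewrite ler_pM2l.
  by rewrite mulrA /eps divfK// expf_neq0.
by rewrite ler_pM2l//; have := uw (eps0 k) (epsl k); lra.
Qed.

End doubling.

Section ohara_slice.
Context {R : realType} {n : nat}.
Local Notation mu := (@lebesgue_measure R).
Variables (L : R) (f T : R -> 'rV[R]_n).
Hypotheses (L0 : 0 < L) (fT : tangent_curve L f T).
Local Notation l := (L / 2).
Local Notation D := (sqchord f).
Implicit Types (x t h e : R).

Let T1 s : dotp (T s) (T s) = 1. Proof. by case: fT. Qed.

Lemma slice_integrable K t e : kern L K -> 0 < e ->
  mu.-integrable `[e, l] (EFin \o (fun h => K (t + h) t)).
Proof.
move=> kK e0; have [_ _ _ /(_ e e0)[C KC]] := kK.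
apply: (itv_bounded_integrable (M := C)); first exact: itv_lty.
  exact: (measurableT_comp (kern_measurable_shift kK) (pair2_measurable t)).
by move=> h; rewrite in_itv/= => eh; exact: KC.
Qed.

Lemma integral_inv_sqr e : 0 < e -> e < l ->
  \int[mu]_(h in `[e, l]) (h ^+ 2)^-1 = e^-1 - l^-1.
Proof.
move=> e0 el; have aV : acd e l (fun h => - h^-1) (fun h => (h ^+ 2)^-1).
  apply: (acd_eq (acdN (acdV e0 (acd_id e l) _))) => // [x /andP[]//|x _].
  by rewrite mulNr opprK mul1r.
have [|_ ->] := acd_ftc el _ aV; last by rewrite opprK addrC.
by apply: measurable_funV; exact: measurable_funX.
Qed.

(** D (t + h) t / h^2 tends to the squared norm of T t, which is 1. *)
Lemma sqchord_derivable_lb t : (forall i, is_derive t (1 : R) (fun s => f s 0 i) (T t 0 i)) ->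
  forall k, k < 1 -> exists2 d, 0 < d & forall h, 0 < h < d -> k * h ^+ 2 < D (t + h) t.
Proof.
move=> dft k k1.
have cvgD : D (t + h) t / h ^+ 2 @[h --> (0 : R)^'] --> (1 : R).
  rewrite -(T1 t) (_ : (fun _ => _) = \sum_(i < n) (fun h : R =>
    (h^-1 * (f (t + h) 0 i - f t 0 i)) * (h^-1 * (f (t + h) 0 i - f t 0 i)))); last first.
    apply/funext => h; rewrite fct_sumE /sqchord /dotp mulr_suml.
    by apply: eq_bigr => i _; rewrite !mxE expr2 invfM; ring.
  rewrite /dotp; elim/big_ind2: _ => [|F1 a1 F2 a2 c1 c2|i _]; first exact: cvg_cst.
    exact: (cvgD c1 c2).
  have c : h^-1 * (f (t + h) 0 i - f t 0 i) @[h --> (0 : R)^'] --> T t 0 i.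
    have [dfi <-] := dft i.
    rewrite (_ : (fun _ => _) = (fun h : R =>
      h^-1 *: (((fun s => f s 0 i) \o shift t) (h *: (1 : R)) - f t 0 i))); first exact: dfi.
    by apply/funext => h /=; rewrite /GRing.scale/= mulr1 (addrC t).
  exact: (cvgM c c).
have [d /= d0 Hd] := cvgr_gt _ cvgD _ k1.
exists d => // h /andP[h0 hd].
have := Hd h; rewrite /ball/= sub0r normrN gtr0_norm// => /(_ hd) H.
by rewrite -ltr_pdivlMr ?exprn_gt0//; apply: H; rewrite gt_eqF.
Qed.

(** Let r be the chord length and w h = 1 / r - 1 / h. The hypotheses of [integral_le_of_doubling]
    hold because 1 / r^2 - 1 / h^2 - 2 w / h is the square of w, because the boundary term q - 1 / e
    is at most w e by Cauchy-Schwarz, and because h w h = h / r - 1 tends to 0 where f has a unit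
    derivative. *)
Lemma ohara_slice t C : (forall i, is_derive t (1 : R) (fun s => f s 0 i) (T t 0 i)) ->
  (forall e, 0 < e -> e < l -> \int[mu]_(h in `[e, l]) m0 f T (t + h) t <= C) ->
  forall e, 0 < e -> e < l ->
    \int[mu]_(h in `[e, l]) ohara L f (t + h) t <= C + l^-1 - dlog2 f T (t + l) t.
Proof.
move=> dft mC.
pose w h := (Num.sqrt (D (t + h) t))^-1 - h^-1.
have koh := kern_ohara L0 fT; have kka := kern_ccos L0 fT; have km := kern_m0 L0 fT.
have oharaE h : 0 < h -> h <= l -> ohara L f (t + h) t = (D (t + h) t)^-1 - (h ^+ 2)^-1.
  by move=> h0 hl; rewrite /ohara circle_dist_val// (ltW h0).
have sq h : 0 < h -> h <= l -> 0 < Num.sqrt (D (t + h) t) /\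
    D (t + h) t = Num.sqrt (D (t + h) t) ^+ 2.
  by move=> h0 hl; rewrite sqrtr_gt0 sqr_sqrtr ?(sqchord_gt0 L0 fT)// ltW ?(sqchord_gt0 L0 fT).
have sqh h : 0 < h -> h <= l -> Num.sqrt (D (t + h) t) <= h.
  move=> h0 hl; rewrite -(ler_pXn2r (n := 2))// ?nnegrE ?sqrtr_ge0 ?(ltW h0)//.
  rewrite -(sq h h0 hl).2 (le_trans (sqchord_le fT _ _))//.
  by rewrite (_ : t + h - t = h)//; ring.
apply: (@integral_le_of_doubling _ _ w).
- by move=> e e0; exact: slice_integrable.
- by move=> h _ _; exact: (ohara_ge0 fT).
- move=> h h0 hl; rewrite oharaE//; have [r0 rE] := sq h h0 hl; have rh := sqh h h0 hl.
  rewrite {1}rE /w; set r := Num.sqrt _ in r0 rE rh *.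
  have rV : h^-1 <= r^-1 by rewrite lef_pV2.
  rewrite -subr_ge0 (_ : _ - _ = (r^-1 - h^-1) ^+ 2) ?sqr_ge0//.
  by field; rewrite !gt_eqF.
- move=> e e0 el.
  have [_ kE] := acd_ftc el (measurableT_comp (kern_measurable_shift (kernN kka)) (pair2_measurable t))
    (acd_up_dlog2 L0 fT e0 t).
  have iE : \int[mu]_(h in `[e, l]) ohara L f (t + h) t =
      \int[mu]_(h in `[e, l]) m0 f T (t + h) t
      - \int[mu]_(h in `[e, l]) (- ccos f T (t + h) t) - (e^-1 - l^-1).
    have i2 : mu.-integrable `[e, l] (EFin \o (fun h => (h ^+ 2)^-1)).
      apply: (@itv_bounded_integrable _ _ _ (e ^- 2)); first exact: itv_lty.
        by apply: measurable_funV; exact: measurable_funX.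
      move=> h; rewrite in_itv/= => /andP[eh hl].
      have h0 := lt_le_trans e0 eh.
      rewrite ger0_norm ?invr_ge0 ?sqr_ge0// lef_pV2 ?posrE ?exprn_gt0//.
      by rewrite ler_pXn2r ?nnegrE //; exact: ltW.
    have im := slice_integrable t km e0.
    have ik := slice_integrable t (kernN kka) e0.
    have imk := slice_integrable t (kernB km (kernN kka)) e0.
    rewrite -integral_inv_sqr// -(RintegralB _ im ik)// -(RintegralB _ imk i2)//.
    apply: eq_Rintegral => h; rewrite inE/= in_itv/= => /andP[eh hl].
    by rewrite oharaE ?(lt_le_trans e0)// /m0; ring.
  rewrite iE kE.
  have qe : dlog2 f T (t + e) t <= (Num.sqrt (D (t + e) t))^-1.
    have [r0 rE] := sq e e0 (ltW el).
    rewrite /dlog2 {1}rE ler_pdivrMr ?exprn_gt0// expr2 mulrA mulVf ?gt_eqF// mul1r.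
    rewrite (le_trans (ler_norm _))//; apply: norm_le_of_sqr; first exact: ltW.
    by rewrite -rE; exact: tproj_sqr_le.
  by move: (mC e e0 el) qe; rewrite /w; clear; lra.
- move=> eta eta0.
  (* With this factor, (h / (1 + eta))^2 < r^2 becomes h / r - 1 < eta. *)
  have k1 : ((1 + eta) ^+ 2)^-1 < 1.
    by rewrite invf_lt1 ?exprn_gt0 ?exprn_egt1//; lra.
  have [d d0 Hd] := sqchord_derivable_lb dft k1.
  exists (Num.min d l); first by rewrite lt_min d0 divr_gt0.
  move=> h /andP[h0]; rewrite lt_min => /andP[hd hl].
  have [r0 rE] := sq h h0 (ltW hl).
  have := Hd h; rewrite h0 hd rE => /(_ isT).
  rewrite /w; set r := Num.sqrt _ in r0 rE *.
  rewrite mulrC -exprVn -exprMn ltr_pXn2r ?nnegrE ?mulr_ge0 ?invr_ge0 ?(ltW r0) ?(ltW h0)//; last lra.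
  rewrite ltr_pdivrMr; last lra.
  move=> H; rewrite mulrBr mulfV ?gt_eqF// ltrBlDr ltr_pdivrMr//.
  by rewrite mulrC (addrC eta).
Qed.

End ohara_slice.

Section cosine_formula.
Context {R : realType} {n : nat}.
Local Notation mu := (@lebesgue_measure R).
Variables (L : R) (f T : R -> 'rV[R]_n) (E : R).
Hypotheses (L0 : 0 < L) (fT : tangent_curve L f T).
Hypothesis (fE : torus_integral L (m0 f T) = E%:E).
Local Notation l := (L / 2).
Local Notation D := (sqchord f).
Local Notation d := (circle_dist L).
Implicit Types (x t h e : R).

Let l0 : 0 < l. Proof. by rewrite divr_gt0. Qed.
Let koh := kern_ohara L0 fT.
Let km := kern_m0 L0 fT.
Let kq := kern_dlog2 L0 fT.
Let kk := kern_ccos L0 fT.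
Let kX := kern_logdist L0 fT.
Let ki := kern_inv_dist L0.
Let ki2 := kern_inv_dist2 L0.
Let kc := kern_tcos fT.

Let dE t h : 0 < h -> h <= l -> d (t + h) t = h.
Proof. by move=> h0 hl; rewrite circle_dist_val// hl ltW. Qed.

Lemma strip_exchange K e : kern L K -> 0 < e ->
  strip L e K = \int[mu]_(t in `[0, L[) \int[mu]_(h in `[e, l]) K (t + h) t.
Proof.
move=> kK e0; have [_ _ _ /(_ e e0)[C KC]] := kK.
apply: (@Rintegral_exchange _ _ _ _ _ mu mu `[e, l] `[0, L[ _ _ _ _ (fun h t => K (t + h) t) C) => //;
  try exact: itv_lty.
- exact: (kern_measurable_shift kK).
- by move=> h t /= + _; rewrite in_itv/= => eh; exact: KC.
Qed.

Lemma slice_integral_integrable K e : kern L K -> 0 < e ->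
  mu.-integrable `[0, L[ (EFin \o (fun t => \int[mu]_(h in `[e, l]) K (t + h) t)).
Proof.
move=> kK e0; have [m _ _ /(_ e e0)[C KC]] := kK.
apply: (@integrable_Rintegral_snd _ _ _ _ _ mu mu `[0, L[ `[e, l] _ _ _ _
  (fun t h => K (t + h) t) C) => //; try exact: itv_lty.
- apply: (measurableT_comp m (g := fun z : R * R => (z.1 + z.2, z.1))).
  apply: measurable_fun_pair; last exact: measurable_fst.
  by apply: measurable_funD; [exact: measurable_fst|exact: measurable_snd].
- by move=> t h _ /=; rewrite in_itv/= => eh; exact: KC.
Qed.

(** Kept in the extended reals, since a single slice may have an infinite integral, though only for
    t in a null set. *)
Let g t : \bar R := (\int[mu]_(h in `]0%R, l]) (m0 f T (t + h) t)%:E)%E.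

Let mg_aux : measurable_fun setT (fun z : R * R => (m0 f T (z.2 + z.1) z.2)%:E).
Proof. by apply/measurable_EFinP; exact: kern_measurable_shift km. Qed.

Let g_aux0 (z : R * R) : (0 <= (m0 f T (z.2 + z.1) z.2)%:E)%E.
Proof. by rewrite lee_fin (m0_ge0 fT). Qed.

Let mg : measurable_fun setT g.
Proof. by apply: (@measurable_integral_fst _ _ _ _ _ mu `]0, l] _ _ mg_aux g_aux0). Qed.

Let g0 t : (0 <= g t)%E.
Proof. by apply: integral_ge0 => h _; rewrite lee_fin (m0_ge0 fT). Qed.

Let int_g : (\int[mu]_(t in `[0%R, L[) g t)%E = (E / 2)%:E.
Proof.
have tE : torus_integral L (m0 f T) = (2%:E * \int[mu]_(t in `[0%R, L[) g t)%E.
  rewrite (torus_fold L0 km (m0_ge0 fT) (m0C f T)).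
  apply: (congr1 (fun z => 2%:E * z)%E).
  rewrite -[LHS](integral_boxl mu mu (measurable_itv _) (measurable_itv _) mg_aux g_aux0).
  exact: (integral_boxr mu mu (measurable_itv _) (measurable_itv _) mg_aux g_aux0).
move: tE; rewrite fE; case: (\int[mu]_(t in _) g t)%E => [r||].
- by rewrite -EFinM => -[->]; congr _%:E; field.
- by rewrite gt0_muley ?lte_fin.
- by rewrite gt0_muleNy ?lte_fin.
Qed.

(** This is [ohara_slice] integrated over t: the constant 1 / l contributes 2, and [dlog2] at
    distance l contributes 0 by [avg_dlog2_antipode]. *)
Lemma strip_ohara_le e : 0 < e -> e < l -> strip L e (ohara L f) <= E / 2 + 2.
Proof.
move=> e0 el; rewrite strip_exchange//.
(* Adding this bound [B] to both sides makes the integrands nonnegative, so that they can be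
   compared in the extended reals even where [g] is infinite. *)
have [_ _ _ /(_ l l0)[B qB]] := kq.
have qBl t : `|dlog2 f T (t + l) t| <= B by apply: qB; rewrite lexx.
have B0 : 0 <= B := le_trans (normr_ge0 _) (qBl 0).
pose A t := \int[mu]_(h in `[e, l]) ohara L f (t + h) t.
have iA : mu.-integrable `[0, L[ (EFin \o A) by exact: slice_integral_integrable.
have A0 t : 0 <= A t.
  by apply: Rintegral_ge0 => h _; exact: (ohara_ge0 fT).
have iq : mu.-integrable `[0, L[ (EFin \o (fun t => dlog2 f T (t + l) t + B)).
  exact: kern_integrable (kernD kq (kern_cst L B)) l0 (lexx l).
have qB0 t : 0 <= dlog2 f T (t + l) t + B.
  by have := qBl t; rewrite ler_norml => /andP[? _]; lra.
have c0 : 0 <= l^-1 + B by rewrite addr_ge0// invr_ge0 ltW.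
have : (\int[mu]_(t in `[0%R, L[) ((A t)%:E + (dlog2 f T (t + l) t + B)%:E) <=
        \int[mu]_(t in `[0%R, L[) (g t + (l^-1 + B)%:E))%E.
  apply: ae_ge0_le_integral => //.
  - by move=> t _; rewrite -EFinD lee_fin addr_ge0.
  - have /integrableP[mA _] := iA; have /integrableP[mq _] := iq.
    exact: emeasurable_funD.
  - by move=> t _; rewrite adde_ge0.
  - by apply: measurable_funTS; apply: emeasurable_funD.
  case: fT => _ _ _ _; apply: ae_imply => t dft _.
  case gE : (g t) => [C||]; last 2 first.
  - by rewrite addye// leey.
  - by have := g0 t; rewrite gE.
  have mC e' : 0 < e' -> e' < l -> \int[mu]_(h in `[e', l]) m0 f T (t + h) t <= C.
    move=> e'0 e'l; rewrite -lee_fin -gE /Rintegral fineK; last first.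
      by apply: integrable_fin_num => //; exact: slice_integrable.
    apply: ge0_subset_integral => //.
    - apply/measurable_EFinP; apply: measurable_funTS.
      exact: (measurableT_comp (kern_measurable_shift km) (pair2_measurable t)).
    - by move=> h _; rewrite lee_fin (m0_ge0 fT).
    - by move=> h /=; rewrite !in_itv/= => /andP[eh ->]; rewrite (lt_le_trans e'0).
  have := ohara_slice L0 fT dft mC e0 el.
  by rewrite -!EFinD lee_fin -/(A t); lra.
rewrite ge0_integralD//; try (by have /integrableP[] := iA);
  try (by have /integrableP[] := iq); try (by move=> *; rewrite lee_fin).
rewrite ge0_integralD//; try (by apply: measurable_funTS; exact: mg); try exact: measurable_cst;
  try (by move=> *; rewrite lee_fin).
rewrite int_g integral_cst//= lebesgue_measure_itv/= lte_fin L0 -EFinB subr0.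
move=> H.
have qE : \int[mu]_(t in `[0, L[) (dlog2 f T (t + l) t + B) = B * L.
  rewrite -[LHS]/(avg L (fun x t => dlog2 f T x t + B) l).
  rewrite (avgD kq (kern_cst L B) l0 (lexx l)) (avg_dlog2_antipode L0 fT) add0r.
  exact: avg_cst.
move: H; rewrite -(fineK (integrable_fin_num _ iA))// -(fineK (integrable_fin_num _ iq))//.
rewrite -!EFinM -!EFinD lee_fin.
have -> : fine (\int[mu]_(t in `[0%R, L[) (EFin \o (fun t => dlog2 f T (t + l) t + B)%R) t)%E = B * L.
  exact: qE.
have -> : (l^-1 + B) * L = 2 + B * L by field; rewrite gt_eqF.
rewrite -[X in X + _ <= _]/(\int[mu]_(t in `[0, L[) A t).
by rewrite addrA lerD2r.
Qed.

(** The upper bound is ln y <= y - 1 for y = h^2 / D. *)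
Lemma logdist_bounds t h : 0 < h -> h <= l ->
  0 <= logdist L f (t + h) t <= h ^+ 2 * ohara L f (t + h) t.
Proof.
move=> h0 hl; rewrite /logdist /ohara dE//.
have Dp := sqchord_gt0 L0 fT t h0 hl.
have Dh : D (t + h) t <= h ^+ 2.
  by rewrite (le_trans (sqchord_le fT _ _))// (_ : t + h - t = h)//; ring.
have h2 : 0 < h ^+ 2 by rewrite exprn_gt0.
have -> : 2 * ln h = ln (h ^+ 2) by rewrite lnXn// mulr_natl.
apply/andP; split; first by rewrite subr_ge0 ler_ln ?posrE.
rewrite -ln_div ?posrE// mulrBr mulfV ?gt_eqF//.
have := @le_ln1Dx R (h ^+ 2 / D (t + h) t - 1).
rewrite addrCA subrr addr0; apply.
by rewrite ltrBrDl subrr divr_gt0.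
Qed.

Lemma strip_logdist_le e : 0 < e -> e < l ->
  strip L e (fun x t => logdist L f x t / d x t ^+ 2) <= E / 2 + 2.
Proof.
move=> e0 el; have kXd : kern L (fun x t => logdist L f x t / d x t ^+ 2) := kernM kX ki2.
apply: le_trans (strip_ohara_le e0 el); apply: strip_le => // t h /andP[eh hl].
have h0 := lt_le_trans e0 eh.
rewrite dE// ler_pdivrMr ?exprn_gt0// mulrC.
by have /andP[] := logdist_bounds t h0 hl.
Qed.

(** An identity at each e, unlike the slice inequality; the price is a boundary term at e of unknown
    sign. *)
Lemma strip_ohara_E e : 0 < e -> e < l -> strip L e (ohara L f) =
  strip L e (m0 f T) + 2 - avg L (fun x t => (d x t)^-1 - dlog2 f T x t) e.
Proof.
move=> e0 el.
have -> : strip L e (ohara L f) =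
    strip L e (fun x t => m0 f T x t - - ccos f T x t - (d x t ^+ 2)^-1).
  by apply: strip_eq => t h _; rewrite /ohara /m0; ring.
rewrite (stripB (kernB km (kernN kk)) ki2)// (stripB km (kernN kk))//.
rewrite (strip_up L0 e0 el kq (kernN kk) (acd_up_dlog2 L0 fT e0)) (avg_dlog2_antipode L0 fT).
have i2E : strip L e (fun x t => - (d x t ^+ 2)^-1) =
    avg L (fun x t => (d x t)^-1) l - avg L (fun x t => (d x t)^-1) e.
  apply: strip_up => //; first exact: kernN.
  move=> t; have de h : e <= h <= l -> e <= d (t + h) t.
    by move=> /andP[eh hl]; rewrite dE// (lt_le_trans e0).
  apply: (acd_eq (acdV e0 (acd_up_dist L0 e0 t) de)) => // h _.
  by rewrite mulN1r.
move: i2E; rewrite stripN// => i2E.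
have -> : strip L e (fun x t => (d x t ^+ 2)^-1) = - (avg L (fun x t => (d x t)^-1) l - avg L (fun x t => (d x t)^-1) e).
  by rewrite -i2E opprK.
rewrite (avgB ki kq e0 (ltW el)).
(* The value is L times 2 / L. Doubled on the torus, it is the 4 of the theorem. *)
have -> : avg L (fun x t => (d x t)^-1) l = 2.
  rewrite (@avg_eq R L _ (fun _ _ => l^-1)); last by move=> t; rewrite dE.
  by rewrite avg_cst//; field; rewrite gt_eqF.
ring.
Qed.

(** The boundary integrand of [strip_ohara_E] divided by d, so that its strips are integrals against
    dh / h. *)
Let defect x t := ((d x t)^-1 - dlog2 f T x t) / d x t.
Let kdef : kern L defect. Proof. exact: kernM (kernB ki kq) ki. Qed.

(** At fixed x the derivative of X / d is 2 [defect] - X / d^2. The boundary term at e has the right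
    sign because X >= 0, and [strip_logdist_le] bounds the integral of X / d^2. *)
Lemma strip_defect_bounded : exists C, forall e, 0 < e -> e < l -> strip L e defect <= C.
Proof.
have arith (s x bl be b : R) : 2 * s - x = bl - be -> 0 <= be -> x <= b -> s <= (bl + b) / 2.
  by lra.
pose Phi x t := logdist L f x t / d x t.
have kPhi : kern L Phi := kernM kX ki.
exists ((avg L Phi l + (E / 2 + 2)) / 2) => e e0 el.
pose phi x t := 2 * defect x t - logdist L f x t / d x t ^+ 2.
have kXd : kern L (fun x t => logdist L f x t / d x t ^+ 2) := kernM kX ki2.
have kphi : kern L phi := kernB (kernZ 2 kdef) kXd.
have aPhi x : acd e l (fun h => Phi x (x - h)) (fun h => phi x (x - h)).
  have de h : e <= h <= l -> e <= d x (x - h).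
    move=> /andP[eh hl]; rewrite -{1}(subrK h x) dE//.
    exact: lt_le_trans eh.
  have ad := acd_down_dist L0 e0 x.
  apply: (acd_eq (acdM (acdB (acdZ 2 (acd_ln e0 ad de)) (acd_down_ln L0 fT e0 x)) (acdV e0 ad de))) => //.
  move=> h /andP[eh hl]; rewrite /phi /defect /logdist.
  have : d x (x - h) != 0 by rewrite gt_eqF// (lt_le_trans e0)// de// !ltW.
  by move=> d0; field.
have sPhi := strip_down L0 e0 el kPhi kphi aPhi.
rewrite (stripB (kernZ 2 kdef) kXd e0) (stripZ 2 kdef e0) in sPhi.
have Phi0 : 0 <= avg L Phi e.
  apply: avg_ge0 => t; rewrite divr_ge0 ?circle_dist_ge0//.
  by have /andP[] := logdist_bounds t e0 (ltW el).
exact: arith sPhi Phi0 (strip_logdist_le e0 el).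
Qed.

(* The boundary term of [strip_ohara_E] tends to 0 along a sequence, since its
   integral against [dh / h] is bounded, and [strip] is monotone in [e]. *)
Lemma strip_ohara_lim eta : 0 < eta ->
  exists2 r, 0 < r & forall e, 0 < e -> e < r -> E / 2 + 2 - eta < strip L e (ohara L f).
Proof.
move=> eta0; have eta2 : 0 < eta / 2 by rewrite divr_gt0.
have [r1 r10 Hr1] := torus_approx L0 km (m0_ge0 fT) (m0C f T) fE eta2.
have [C defC] := strip_defect_bounded.
pose k h := avg L (fun x t => (d x t)^-1 - dlog2 f T x t) h.
have kE h : 0 < h -> h <= l -> k h / h = avg L defect h.
  move=> h0 hl; rewrite mulrC /k -(avgZ h^-1 (kernB ki kq))//.
  by apply: avg_eq => t; rewrite /defect dE// mulrC.
have ikh e : 0 < e -> mu.-integrable `[e, l] (EFin \o (fun h => k h / h)).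
  move=> e0; have := avg_integrable kdef e0; apply: eq_integrable => // h.
  rewrite inE/= in_itv/= => /andP[eh hl]; rewrite /= kE//; exact: lt_le_trans eh.
have kC e : 0 < e -> e < l -> \int[mu]_(h in `[e, l]) (k h / h) <= C.
  move=> e0 el; apply: le_trans (defC e e0 el); rewrite le_eqVlt; apply/orP; left; apply/eqP.
  apply: eq_Rintegral => h; rewrite inE/= in_itv/= => /andP[eh hl].
  by rewrite kE// (lt_le_trans e0).
have rl : 0 < Num.min r1 l by rewrite lt_min r10.
have [h /andP[h0]] := exists_small_of_integral_div l0 ikh kC eta2 rl.
rewrite lt_min => /andP[hr1 hl] kh.
exists h => // e e0 eh.
apply: lt_le_trans (strip_anti koh _ e0 (ltW eh)); last by move=> *; exact: (ohara_ge0 fT).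
rewrite strip_ohara_E//; have := Hr1 h h0 hr1; move: kh; rewrite /k; lra.
Qed.

(** This makes E1 finite. Let Q be the projection of the chord on T t. At fixed t the derivative of
    1 / d - Q / d^2 is c2 - 2 v, and Q <= d gives v <= [defect] + a, so [strip_defect_bounded]
    controls c2. Passing from 1 / d^2 to 1 / D = a + 1 / d^2 costs at most 2 a, as 1 - tcos <= 2. *)
Lemma strip_m1_bounded : exists C, forall e, 0 < e -> e < l -> strip L e (m1 f T) <= C.
Proof.
have arith (s1 s2 s3 bl be c b : R) : s1 - 2 * s2 = bl - be -> 0 <= be ->
    s2 <= c + b -> s3 <= s1 + 2 * b -> s3 <= bl + 2 * c + 4 * b.
  by lra.
have one_sub_le2 (c : R) : -1 <= c -> 1 - c <= 2 by lra.
have [C defC] := strip_defect_bounded.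
pose Phi x t := (d x t)^-1 - dotp (T t) (f x - f t) / d x t ^+ 2.
have kQ := kern_tproj2 fT.
have kPhi : kern L Phi := kernB ki (kernM kQ ki2).
exists (avg L Phi l + 2 * C + 4 * (E / 2 + 2)) => e e0 el.
pose c2 x t := (1 - tcos T x t) / d x t ^+ 2.
pose v x t := (d x t - dotp (T t) (f x - f t)) / d x t ^+ 3.
have k1c := kernB (kern_cst L 1) kc.
have kc2 : kern L c2 := kernM k1c ki2.
have kv : kern L v.
  apply: kern_eq (kernM (kernB (kern_circle_dist L0) kQ) (kernM ki ki2)) => x t.
  by rewrite -invfM -exprS.
have kphi : kern L (fun x t => c2 x t - 2 * v x t) := kernB kc2 (kernZ 2 kv).
have Ph : strip L e (fun x t => c2 x t - 2 * v x t) = avg L Phi l - avg L Phi e.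
  apply: strip_up => // t.
  have de h : e <= h <= l -> e <= d (t + h) t.
    by move=> /andP[eh hl]; rewrite dE// (lt_le_trans e0).
  have ad := acd_up_dist L0 e0 t; have aV := acdV e0 ad de.
  apply: (acd_eq (acdB aV (acdM (acd_up_tproj2 fT e t) (acdM aV aV)))) => h.
    by rewrite /Phi -invfM expr2.
  move=> /andP[eh hl]; rewrite /c2 /v.
  have : d (t + h) t != 0 by rewrite gt_eqF// (lt_le_trans e0)// de// !ltW.
  by move=> d0; field.
have Ql t h : 0 < h -> dotp (T t) (f (t + h) - f t) <= h.
  move=> h0; apply: le_trans (ler_norm _) _; apply: (tproj_norm_le fT); last exact: ltW.
  by case: fT.
have Phi0 : 0 <= avg L Phi e.
  apply: avg_ge0 => t; rewrite /Phi dE ?(ltW el)// subr_ge0.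
  by rewrite ler_pdivrMr ?exprn_gt0// expr2 mulrA mulVf ?gt_eqF// mul1r Ql.
have vle : strip L e v <= C + (E / 2 + 2).
  apply: le_trans (_ : strip L e (fun x t => defect x t + ohara L f x t) <= _).
    apply: strip_le => //; first exact: kernD.
    move=> t h /andP[eh hl]; have h0 := lt_le_trans e0 eh.
    rewrite /v /defect dE//.
    set Q := dotp (T t) _; have := ohara_ge0 fT (t + h) t; set a := ohara L f (t + h) t => a0.
    have DE : (D (t + h) t)^-1 = a + (h ^+ 2)^-1 by rewrite /a /ohara dE//; ring.
    have -> : dlog2 f T (t + h) t = Q * (a + (h ^+ 2)^-1) by rewrite /dlog2 DE.
    rewrite -subr_ge0 (_ : _ - _ = (1 - Q / h) * a); last by field; rewrite gt_eqF.
    by rewrite mulr_ge0// subr_ge0 ler_pdivrMr// mul1r Ql.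
  by rewrite (stripD kdef koh e0) lerD//; [exact: defC|exact: strip_ohara_le].
have m1le : strip L e (m1 f T) <= strip L e c2 + 2 * (E / 2 + 2).
  apply: le_trans (_ : strip L e (fun x t => c2 x t + 2 * ohara L f x t) <= _).
    apply: strip_le => //; first exact: kern_m1.
      exact: kernD kc2 (kernZ 2 koh).
    move=> t h /andP[eh hl]; have h0 := lt_le_trans e0 eh.
    have := ohara_ge0 fT (t + h) t; set a := ohara L f (t + h) t => a0.
    have DE : (D (t + h) t)^-1 = a + (h ^+ 2)^-1 by rewrite /a /ohara dE//; ring.
    rewrite /m1 DE /c2 dE// mulrDr addrC lerD2l ler_wpM2r//.
    by apply: one_sub_le2; have := tcos_norm fT (t + h) t; rewrite ler_norml => /andP[].
  rewrite (stripD kc2 (kernZ 2 koh))// (stripZ 2 koh)// lerD2l ler_pM2l//.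
  exact: strip_ohara_le.
rewrite (stripB kc2 (kernZ 2 kv) e0) (stripZ 2 kv e0) in Ph.
exact: arith Ph Phi0 vle m1le.
Qed.

End cosine_formula.

(** * Comparison of two curves *)

Lemma norm_sub_le_add (R : realType) (x y : R) : 0 <= x -> 0 <= y -> `|x - y| <= x + y.
Proof. by move=> x0 y0; rewrite ler_norml; apply/andP; split; lra. Qed.

(** Primes mark the second curve. Each strip is within eta of its limit, and [A - M] and [A' - M']
    cancel in the limit because both tend to 2. The 90 is a generous count of the errors; it has to
    stay below the 100 by which eta is defined in [energy_gap_le]. *)
Lemma gap_arithmetic (R : realType) (E E' F F' J J' M M' B B' v v' A A' k s b eta : R) :
  E / 2 - eta < M -> M <= E / 2 -> E' / 2 - eta < M' -> M' <= E' / 2 ->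
  F / 2 - eta < B -> B <= F / 2 -> F' / 2 - eta < B' -> B' <= F' / 2 ->
  J / 2 - eta < v -> v <= J / 2 -> J' / 2 - eta < v' -> v' <= J' / 2 ->
  E / 2 + 2 - eta < A -> A <= E / 2 + 2 -> E' / 2 + 2 - eta < A' -> A' <= E' / 2 + 2 ->
  M - B - (M' - B') = -2 * ((A - M) - (A' - M')) + 2^-1 * b + s - 2 * (v - v') ->
  `|s| <= k -> `|b| < 8 * eta ->
  `|E - F - (E' - F')| <= 2 * k + `|2 * (J - J')| + 90 * eta.
Proof.
move=> F1 G1 F2 G2 F3 G3 F4 G4 F5 G5 F6 G6 F7 G7 F8 G8 S.
rewrite ler_norml ltr_norml => /andP[SY1 SY2] /andP[bk1 bk2].
have J1 := ler_norm (2 * (J - J')); have J2 := ler_norm (- (2 * (J - J'))).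
rewrite normrN in J2.
by rewrite ler_norml; apply/andP; split; lra.
Qed.

(** Linearity of [strip] for arbitrary kernels; it reduces [strip_identity] to a pointwise
    identity. *)
Lemma strip_combination (R : realType) (L e : R) (M B M' B' A A' P Q S v v' : R -> R -> R) :
  kern L M -> kern L B -> kern L M' -> kern L B' -> kern L A -> kern L A' ->
  kern L P -> kern L Q -> kern L S -> kern L v -> kern L v' -> 0 < e ->
  (forall x t, M x t - B x t - (M' x t - B' x t) =
    -2 * ((A x t - M x t) - (A' x t - M' x t)) + - 2^-1 * (P x t + Q x t) + S x t
    - 2 * (v x t - v' x t)) ->
  strip L e M - strip L e B - (strip L e M' - strip L e B') =
    -2 * ((strip L e A - strip L e M) - (strip L e A' - strip L e M'))
    + - 2^-1 * (strip L e P + strip L e Q) + strip L e S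
    - 2 * (strip L e v - strip L e v').
Proof.
move=> kM kB kM' kB' kA kA' kP kQ kS kv kv' e0 H.
have k1 := kernB kM kB; have k1' := kernB kM' kB'.
have k2 := kernB kA kM; have k2' := kernB kA' kM'.
have k3 := kernB k2 k2'; have k4 := kernD kP kQ; have k5 := kernB kv kv'.
have k6 := kernD (kernZ (-2) k3) (kernZ (- 2^-1) k4).
have k7 := kernD k6 kS.
have lhs := stripB k1 k1' e0.
rewrite (stripB kM kB e0) (stripB kM' kB' e0) in lhs.
have rhs := stripB k7 (kernZ 2 k5) e0.
rewrite (stripD k6 kS e0) (stripD (kernZ (-2) k3) (kernZ (- 2^-1) k4) e0) in rhs.
rewrite (stripZ (-2) k3 e0) (stripZ (- 2^-1) k4 e0) (stripZ 2 k5 e0) in rhs.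
rewrite (stripB k2 k2' e0) (stripB kA kM e0) (stripB kA' kM' e0) in rhs.
rewrite (stripD kP kQ e0) (stripB kv kv' e0) in rhs.
apply: etrans (esym lhs) (etrans _ rhs).
by apply: strip_eq => t h _; exact: H.
Qed.

Section two_curves.
Context {R : realType} {n : nat}.
Local Notation mu := (@lebesgue_measure R).
Variables (L : R) (f T g U : R -> 'rV[R]_n) (E E' F F' K J J' : R).
Hypotheses (L0 : 0 < L) (fT : tangent_curve L f T) (gU : tangent_curve L g U).
Hypotheses (fE : torus_integral L (m0 f T) = E%:E) (gE : torus_integral L (m0 g U) = E'%:E).
Hypotheses (fF : torus_integral L (m1 f T) = F%:E) (gF : torus_integral L (m1 g U) = F'%:E).
Local Notation l := (L / 2).
Local Notation d := (circle_dist L).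
Local Notation p := (dlog1 f T).
Local Notation q := (dlog2 f T).
Local Notation p' := (dlog1 g U).
Local Notation q' := (dlog2 g U).
Local Notation a := (ohara L f).
Local Notation a' := (ohara L g).
Local Notation Y := (fun x t => logdist L f x t - logdist L g x t).
Local Notation V := (fun x t => logdist L f x t / d x t ^+ 2).
Local Notation V' := (fun x t => logdist L g x t / d x t ^+ 2).
Local Notation G := (fun x t => m0 f T x t + m0 g U x t + (a x t + a' x t)).
Hypotheses (fJ : torus_integral L V = J%:E) (gJ : torus_integral L V' = J'%:E).
Hypotheses (K0 : 0 <= K)
  (YK : {ae lebesgue2 R, forall z, torus L z -> `|Y z.1 z.2| <= K}).
Implicit Types (x t h e : R).

Let l0 : 0 < l. Proof. by rewrite divr_gt0. Qed.
Let km := kern_m0 L0 fT.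
Let km' := kern_m0 L0 gU.
Let km1 := kern_m1 L0 fT.
Let km1' := kern_m1 L0 gU.
Let ka := kern_ohara L0 fT.
Let ka' := kern_ohara L0 gU.
Let kk := kern_ccos L0 fT.
Let kk' := kern_ccos L0 gU.
Let kp := kern_dlog1 L0 fT.
Let kp' := kern_dlog1 L0 gU.
Let kq := kern_dlog2 L0 fT.
Let kq' := kern_dlog2 L0 gU.
Let kY : kern L Y := kernB (kern_logdist L0 fT) (kern_logdist L0 gU).
Let kV : kern L V := kernM (kern_logdist L0 fT) (kern_inv_dist2 L0).
Let kV' : kern L V' := kernM (kern_logdist L0 gU) (kern_inv_dist2 L0).
Let kG : kern L G := kernD (kernD km km') (kernD ka ka').

Let dE t h : 0 < h -> h <= l -> d (t + h) t = h.
Proof. by move=> h0 hl; rewrite circle_dist_val// hl ltW. Qed.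

Let G0 x t : 0 <= G x t.
Proof.
apply: addr_ge0; apply: addr_ge0;
  [exact: (m0_ge0 fT)|exact: (m0_ge0 gU)|exact: (ohara_ge0 fT)|exact: (ohara_ge0 gU)].
Qed.

Let GC x t : G x t = G t x.
Proof. by rewrite /= (m0C f T) (m0C g U) (oharaC L f) (oharaC L g). Qed.

Let strip_G e : 0 < e -> e < l -> strip L e G <= E + E' + 4.
Proof.
move=> e0 el; rewrite (stripD (kernD km km') (kernD ka ka'))// (stripD km km')// (stripD ka ka')//.
rewrite (_ : E + E' + 4 = E / 2 + E' / 2 + (E / 2 + 2 + (E' / 2 + 2))); last by field.
apply: lerD; apply: lerD.
- exact: (strip_le_half L0 km (m0_ge0 fT) (m0C f T) fE e0).
- exact: (strip_le_half L0 km' (m0_ge0 gU) (m0C g U) gE e0).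
- exact: (strip_ohara_le L0 fT fE e0 el).
- exact: (strip_ohara_le L0 gU gE e0 el).
Qed.

(** [YK] holds almost everywhere on the torus and says nothing about a single slice, so the bound
    goes through the whole torus integral, where [|Y|] can be replaced by [K]. *)
Let strip_YG e : 0 < e -> e < l -> strip L e (fun x t => `|Y x t| * G x t) <= K * (E + E' + 4).
Proof.
move=> e0 el.
have kYG := kernM (kern_norm kY) kG.
have kKG := kernZ K kG.
have mfun k : kern L k -> measurable_fun (torus L) (fun z : R * R => (k z.1 z.2)%:E).
  by move=> [m _ _ _]; apply/measurable_EFinP; exact: measurable_funTS.
have le1 : (torus_integral L (fun x t => `|Y x t| * G x t)%R <= torus_integral L (fun x t => K * G x t)%R)%E.
  apply: ae_ge0_le_integral.
  - by apply: measurableX; exact: measurable_itv.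
  - by move=> z _; rewrite lee_fin mulr_ge0.
  - exact: (mfun _ kYG).
  - by move=> z _; rewrite lee_fin mulr_ge0.
  - exact: (mfun _ kKG).
  - by apply: ae_imply YK => z Yz Tz; rewrite lee_fin ler_wpM2r// Yz.
have le2 : (torus_integral L (fun x t => K * G x t)%R <= (2 * (K * (E + E' + 4)))%:E)%E.
  apply: torus_le => //.
  - by move=> x t; rewrite mulr_ge0.
  - by move=> x t; rewrite GC.
  - by move=> e' e'0 e'l; rewrite (stripZ K kG)// ler_wpM2l// strip_G.
have YC x t : `|Y x t| * G x t = `|Y t x| * G t x.
  by rewrite GC /= (logdistC L f) (logdistC L g).
have le0 := strip_le_torus L0 kYG (fun x t => mulr_ge0 (normr_ge0 _) (G0 x t)) YC e0.
have := le_trans le0 (le_trans le1 le2).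
by rewrite lee_fin ler_pM2l.
Qed.

(** The sums q + q' and p + p' are chosen so that mixed products cancel: (p - p') (q + q') + (q -
    q') (p + p') = 2 (p q - p' q'). *)
Let Phi1 x t := Y x t * (q x t + q' x t).
Let Phi2 x t := Y x t * (p x t + p' x t).
Let phi1 x t := -2 * (p x t - p' x t) * (q x t + q' x t) - Y x t * (ccos f T x t + ccos g U x t).
Let phi2 x t := -2 * (q x t - q' x t) * (p x t + p' x t) - Y x t * (ccos f T x t + ccos g U x t).
Let kPhi1 : kern L Phi1 := kernM kY (kernD kq kq').
Let kPhi2 : kern L Phi2 := kernM kY (kernD kp kp').
Let kYk := kernM kY (kernD kk kk').
Let kphi1 : kern L phi1 := kernB (kernM (kernZ (-2) (kernB kp kp')) (kernD kq kq')) kYk.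
Let kphi2 : kern L phi2 := kernB (kernM (kernZ (-2) (kernB kq kq')) (kernD kp kp')) kYk.

Let strip_phi1 e : 0 < e -> e < l -> strip L e phi1 = avg L Phi1 l - avg L Phi1 e.
Proof.
move=> e0 el; apply: strip_up => // t.
apply: (acd_eq (acdM (acdB (acd_up_ln L0 gU e0 t) (acd_up_ln L0 fT e0 t))
  (acdD (acd_up_dlog2 L0 fT e0 t) (acd_up_dlog2 L0 gU e0 t)))) => h.
  by rewrite /Phi1 /logdist; ring.
by move=> _; rewrite /phi1 /logdist; ring.
Qed.

Let strip_phi2 e : 0 < e -> e < l -> strip L e phi2 = avg L Phi2 l - avg L Phi2 e.
Proof.
move=> e0 el; apply: strip_down => // x.
apply: (acd_eq (acdM (acdB (acd_down_ln L0 gU e0 x) (acd_down_ln L0 fT e0 x))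
  (acdD (acd_down_dlog1 L0 fT e0 x) (acd_down_dlog1 L0 gU e0 x)))) => h.
  by rewrite /Phi2 /logdist; ring.
by move=> _; rewrite /phi2 /logdist; ring.
Qed.

(** Y is symmetric and p (x, t) = - q (t, x), so [Phi2] is minus [Phi1] with the points exchanged;
    at distance l this exchange does not change averages. *)
Let antipode : avg L Phi1 l + avg L Phi2 l = 0.
Proof.
rewrite (avg_antipode L0 kPhi1) -(@avgD R L (fun x t => Phi1 t x)) //.
- rewrite (@avg_eq R L _ (fun _ _ => 0)) ?avg_cst ?mul0r// => t.
  rewrite /Phi1 /Phi2 (logdistC L f) (logdistC L g) (dlog1C f T) (dlog1C g U).
  by ring.
- apply: kern_eq (kernN kPhi2) => x t.
  by rewrite /Phi1 /Phi2 (logdistC L f) (logdistC L g) (dlog1C f T) (dlog1C g U); ring.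
Qed.

(* 2 ln rho * rho <= 2 (rho^2 - 1) for rho >= 1, applied to the larger of the two
   ratios rho = h / |f (t + h) - f t|, whose logarithms bound |Y|. *)
Let boundary_pointwise (r r' h u : R) : 0 < r -> 0 < r' -> r <= h -> r' <= h -> 0 < h ->
  `|u| <= r^-1 \/ `|u| <= r'^-1 ->
  `|(2 * ln h - ln (r ^+ 2)) - (2 * ln h - ln (r' ^+ 2))| * `|u| <=
  2 * h * ((r ^- 2 - h ^- 2) + (r' ^- 2 - h ^- 2)).
Proof.
move=> r0 r'0 rh r'h h0 ur.
have lnE (s : R) : 0 < s -> 2 * ln h - ln (s ^+ 2) = 2 * ln (h / s).
  by move=> s0; rewrite lnXn// ln_div ?posrE// -[ln s *+ 2]mulr_natl; ring.
rewrite !lnE//.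
wlog rr' : r r' r0 r'0 rh r'h ur / r <= r'.
  move=> W; have [|/ltW] := leP r r'; first exact: W.
  move=> r'r; rewrite distrC [X in _ <= _ * X]addrC; apply: W => //.
  by case: ur; [right|left].
have s0 : 0 < h / r by rewrite divr_gt0.
have s1 : 1 <= h / r by rewrite ler_pdivlMr// mul1r.
have s1' : 1 <= h / r' by rewrite ler_pdivlMr// mul1r.
have ss : h / r' <= h / r by rewrite ler_pM2l// lef_pV2.
have {}ur : `|u| <= r^-1.
  by case: ur => // /le_trans; apply; rewrite lef_pV2.
have ln0 : 0 <= ln (h / r') by rewrite ln_ge0.
have lnle : ln (h / r') <= ln (h / r) by rewrite ler_ln ?posrE// divr_gt0.
have lns : ln (h / r) <= h / r - 1.
  have := @le_ln1Dx R (h / r - 1); rewrite addrCA subrr addr0; apply.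
  by rewrite ltrBrDl subrr.
apply: (@le_trans _ _ (2 * (h / r - 1) * r^-1)).
  apply: ler_pM => //; rewrite ler_norml; apply/andP; split; lra.
have -> : 2 * h * (r ^- 2 - h ^- 2 + (r' ^- 2 - h ^- 2)) =
    2 / h * ((h / r) ^+ 2 - 1) + 2 / h * ((h / r') ^+ 2 - 1).
  by field; rewrite !gt_eqF.
have -> : 2 * (h / r - 1) * r^-1 = 2 / h * ((h / r - 1) * (h / r)).
  by field; rewrite !gt_eqF.
rewrite -mulrDr; apply: ler_wpM2l; first by rewrite divr_ge0 ?ltW.
have : 0 <= (h / r') ^+ 2 - 1 by rewrite subr_ge0 exprn_ege1.
nra.
Qed.

(** [Phi1 + Phi2] consists of four products of Y with p, q, p' or q', each at most 2 e (a + a') in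
    absolute value. The factor e in front of an average with bounded integrals is what
    [exists_small_of_integral_div] exploits. *)
Let boundary e : 0 < e -> e < l ->
  `|avg L Phi1 e + avg L Phi2 e| <= 8 * (e * avg L (fun x t => a x t + a' x t) e).
Proof.
move=> e0 el; have el' := ltW el.
rewrite -(avgD kPhi1 kPhi2)//.
apply: (le_trans (avg_le_norm (kernD kPhi1 kPhi2) e0 el')).
rewrite mulrA -(avgZ (8 * e) (kernD ka ka'))//; apply: avg_le => //.
- exact: kern_norm (kernD kPhi1 kPhi2).
- exact: kernZ (kernD ka ka').
move=> t; set x := t + e.
have proj (h : R -> 'rV[R]_n) (W : R -> 'rV[R]_n) : tangent_curve L h W ->
  exists r : R, [/\ 0 < r, r <= e, sqchord h x t = r ^+ 2, `|dlog1 h W x t| <= r^-1 & `|dlog2 h W x t| <= r^-1].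
  move=> hW; have D0 := sqchord_gt0 L0 hW t e0 el'.
  have W1 s : dotp (W s) (W s) = 1 by case: hW.
  exists (Num.sqrt (sqchord h x t)).
  have r0 : 0 < Num.sqrt (sqchord h x t) by rewrite sqrtr_gt0.
  have rE : sqchord h x t = Num.sqrt (sqchord h x t) ^+ 2 by rewrite sqr_sqrtr// ltW.
  have tp v : dotp v v = 1 -> `|dotp v (h x - h t) / sqchord h x t| <= (Num.sqrt (sqchord h x t))^-1.
    move=> v1; rewrite normrM (gtr0_norm (_ : 0 < (sqchord h x t)^-1)) ?invr_gt0//.
    rewrite ler_pdivrMr// {2}rE expr2 mulrA mulVf ?gt_eqF// mul1r.
    by apply: norm_le_of_sqr; [exact: ltW|rewrite -rE; exact: tproj_sqr_le].
  split => //; last 2 first.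
  - exact: tp.
  - exact: tp.
  rewrite -(ler_pXn2r (n := 2))// ?nnegrE ?(ltW r0) ?(ltW e0)// -rE.
  rewrite (le_trans (sqchord_le hW _ _))// /x (_ : t + e - t = e)//; ring.
have [r [r0 re rE pr qr]] := proj f T fT.
have [r' [r'0 r'e r'E pr' qr']] := proj g U gU.
have H (u : R) : `|u| <= r^-1 \/ `|u| <= r'^-1 -> `|Y x t| * `|u| <= 2 * e * (a x t + a' x t).
  move=> ur; have := boundary_pointwise r0 r'0 re r'e e0 ur.
  by rewrite /logdist /ohara /x !dE// -/x rE r'E.
rewrite (_ : Phi1 x t + Phi2 x t = Y x t * q x t + Y x t * q' x t + (Y x t * p x t + Y x t * p' x t)); last first.
  by rewrite /Phi1 /Phi2; ring.
rewrite (_ : 8 * e * (a x t + a' x t) = 2 * e * (a x t + a' x t) + 2 * e * (a x t + a' x t) +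
  (2 * e * (a x t + a' x t) + 2 * e * (a x t + a' x t))); last by ring.
apply: (le_trans (ler_normD _ _)); apply: lerD; apply: (le_trans (ler_normD _ _));
  apply: lerD; rewrite normrM; apply: H.
- by left.
- by right.
- by left.
- by right.
Qed.

(** Every [ccos] is written as a - m0 + 1 / d^2. In the difference of the two curves the divergent 1
    / d^2 cancels, and the strips of a - m0 have the same limit for both; in Y (k + k') it remains
    and yields the term with V - V'. *)
Let strip_identity e : 0 < e -> e < l ->
  strip L e (m0 f T) - strip L e (m1 f T) - (strip L e (m0 g U) - strip L e (m1 g U)) =
  -2 * ((strip L e a - strip L e (m0 f T)) - (strip L e a' - strip L e (m0 g U)))
  + 2^-1 * (avg L Phi1 e + avg L Phi2 e)
  + strip L e (fun x t => Y x t * (m0 f T x t + m0 g U x t - (a x t + a' x t)))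
  - 2 * (strip L e V - strip L e V').
Proof.
move=> e0 el.
have -> : 2^-1 * (avg L Phi1 e + avg L Phi2 e) = - 2^-1 * (strip L e phi1 + strip L e phi2).
  by rewrite strip_phi1// strip_phi2// addrACA antipode add0r -opprD mulrNN.
have kS := kernM kY (kernB (kernD km km') (kernD ka ka')).
apply: (strip_combination km km1 km' km1' ka ka' kphi1 kphi2 kS kV kV' e0) => x t.
rewrite /phi1 /phi2 /m0 /m1 /ohara /ccos.
move: (sqchord f x t)^-1 (sqchord g x t)^-1 (d x t ^+ 2)^-1 (p x t) (q x t) (p' x t) (q' x t)
  (tcos T x t) (tcos U x t) (logdist L f x t) (logdist L g x t) => i i' j P Q P' Q' c c' X X'.
by field.
Qed.

Let strip_Y_le e : 0 < e -> e < l ->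
  `|strip L e (fun x t => Y x t * (m0 f T x t + m0 g U x t - (a x t + a' x t)))| <= K * (E + E' + 4).
Proof.
move=> e0 el; have kH := kernM kY (kernB (kernD km km') (kernD ka ka')).
apply: (le_trans (strip_le_norm kH e0)); apply: le_trans (strip_YG e0 el).
apply: strip_le => //; first exact: kern_norm.
  exact: kernM (kern_norm kY) kG.
move=> t h _; rewrite normrM ler_wpM2l//.
by apply: norm_sub_le_add; apply: addr_ge0;
  [exact: (m0_ge0 fT)|exact: (m0_ge0 gU)|exact: (ohara_ge0 fT)|exact: (ohara_ge0 gU)].
Qed.

(** By contradiction: the boundary term is known to be small only at some cut-offs near 0, and one
    such e below the thresholds of all the other approximations is enough. *)
Lemma energy_gap_le : `|(E - F) - (E' - F')| <= 2 * (K * (E + E' + 4)) + `|2 * (J - J')| .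
Proof.
have l0' := l0.
have ohara_bd e : 0 < e -> e < l -> strip L e (fun x t => a x t + a' x t) <= E / 2 + E' / 2 + 4.
  move=> e0 el; rewrite (stripD ka ka')//.
  rewrite (_ : E / 2 + E' / 2 + 4 = E / 2 + 2 + (E' / 2 + 2)); last by ring.
  by apply: lerD; [exact: (strip_ohara_le L0 fT fE e0 el)|exact: (strip_ohara_le L0 gU gE e0 el)].
rewrite leNgt; apply/negP => gap.
pose eta := (`|(E - F) - (E' - F')| - (2 * (K * (E + E' + 4)) + `|2 * (J - J')|)) / 100.
have eta0 : 0 < eta by rewrite divr_gt0// subr_gt0.
have [r1 r10 H1] := torus_approx L0 km (m0_ge0 fT) (m0C f T) fE eta0.
have [r2 r20 H2] := torus_approx L0 km' (m0_ge0 gU) (m0C g U) gE eta0.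
have [r3 r30 H3] := torus_approx L0 km1 (m1_ge0 fT) (m1C f T) fF eta0.
have [r4 r40 H4] := torus_approx L0 km1' (m1_ge0 gU) (m1C g U) gF eta0.
have V0 (c W : R -> 'rV[R]_n) : tangent_curve L c W -> forall x t, 0 <= logdist L c x t / d x t ^+ 2.
  by move=> hW x t; rewrite divr_ge0 ?sqr_ge0// (logdist_ge0 hW).
have VC (c : R -> 'rV[R]_n) x t : logdist L c x t / d x t ^+ 2 = logdist L c t x / d t x ^+ 2.
  by rewrite logdistC circle_distC.
have [r5 r50 H5] := torus_approx L0 kV (V0 _ _ fT) (VC f) fJ eta0.
have [r6 r60 H6] := torus_approx L0 kV' (V0 _ _ gU) (VC g) gJ eta0.
have [r7 r70 H7] := strip_ohara_lim L0 fT fE eta0.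
have [r8 r80 H8] := strip_ohara_lim L0 gU gE eta0.
pose rmin := Num.min l (Num.min (Num.min (Num.min r1 r2) (Num.min r3 r4)) (Num.min (Num.min r5 r6) (Num.min r7 r8))).
have rmin0 : 0 < rmin by rewrite !lt_min l0' r10 r20 r30 r40 r50 r60 r70 r80.
pose k h := h * avg L (fun x t => a x t + a' x t) h.
have kE h : 0 < h -> k h / h = avg L (fun x t => a x t + a' x t) h.
  by move=> h0; rewrite /k mulrC mulKf// gt_eqF.
have ikh e : 0 < e -> mu.-integrable `[e, l] (EFin \o (fun h => k h / h)).
  move=> e0; have := avg_integrable (kernD ka ka') e0; apply: eq_integrable => // h.
  rewrite inE/= in_itv/= => /andP[eh hl]; rewrite /= kE//; exact: lt_le_trans eh.
have kC e : 0 < e -> e < l -> \int[mu]_(h in `[e, l]) (k h / h) <= E / 2 + E' / 2 + 4.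
  move=> e0 el; apply: le_trans (ohara_bd e e0 el); rewrite le_eqVlt; apply/orP; left; apply/eqP.
  apply: eq_Rintegral => h; rewrite inE/= in_itv/= => /andP[eh hl].
  by rewrite kE// (lt_le_trans e0).
have [e /andP[e0]] := exists_small_of_integral_div l0' ikh kC eta0 rmin0.
rewrite !lt_min => /andP[el /andP[/andP[/andP[er1 er2] /andP[er3 er4]]
  /andP[/andP[er5 er6] /andP[er7 er8]]]] ke.
have el' := ltW el.
have F1 := H1 e e0 er1; have F2 := H2 e e0 er2; have F3 := H3 e e0 er3; have F4 := H4 e e0 er4.
have F5 := H5 e e0 er5; have F6 := H6 e e0 er6; have F7 := H7 e e0 er7; have F8 := H8 e e0 er8.
have G1 := strip_le_half L0 km (m0_ge0 fT) (m0C f T) fE e0.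
have G2 := strip_le_half L0 km' (m0_ge0 gU) (m0C g U) gE e0.
have G3 := strip_le_half L0 km1 (m1_ge0 fT) (m1C f T) fF e0.
have G4 := strip_le_half L0 km1' (m1_ge0 gU) (m1C g U) gF e0.
have G5 := strip_le_half L0 kV (V0 _ _ fT) (VC f) fJ e0.
have G6 := strip_le_half L0 kV' (V0 _ _ gU) (VC g) gJ e0.
have G7 := strip_ohara_le L0 fT fE e0 el.
have G8 := strip_ohara_le L0 gU gE e0 el.
have S := strip_identity e0 el.
have SY := strip_Y_le e0 el.
have bd := boundary e0 el.
have bk : `|avg L Phi1 e + avg L Phi2 e| < 8 * eta by rewrite (le_lt_trans bd)// ltr_pM2l.
have := gap_arithmetic F1 G1 F2 G2 F3 G3 F4 G4 F5 G5 F6 G6 F7 G7 F8 G8 S SY bk.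
have -> : `|E - F - (E' - F')| = 2 * (K * (E + E' + 4)) + `|2 * (J - J')| + 100 * eta.
  by rewrite /eta; field.
by rewrite lerD2l ler_pM2r// ler_nat.
Qed.

End two_curves.

(** * Borel tangents and the energies *)

Section borel_tangent.
Context {R : realType} {n : nat}.
Local Notation mu := (@lebesgue_measure R).
Implicit Types (f : R -> 'rV[R]_n) (L s : R).

Definition forward_quotient f i (k : nat) s : R :=
  k.+1%:R * (f (s + k.+1%:R^-1) 0 i - f s 0 i).

Lemma derivable_coord f s i : derivable f s 1 ->
  is_derive s (1 : R) (fun x => f x 0 i) (tangent f s 0 i).
Proof.
move=> df; apply: DeriveDef; first by move: df => /derivable_mxP; exact.
by rewrite /tangent derive1E derive_mx// mxE.
Qed.

Lemma cvg_forward_quotient f i s :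
  derivable f s 1 -> forward_quotient f i k s @[k --> \oo] --> tangent f s 0 i.
Proof.
move=> df.
have [di <-] := derivable_coord i df.
have h_cvg : (k.+1%:R : R)^-1 @[k --> \oo] --> (0 : R)^'.
  move=> A A0.
  have H : \forall k \near \oo, (k.+1%:R : R)^-1 != 0 -> A (k.+1%:R)^-1 :=
    (@cvg_harmonic R) _ A0.
  apply: (@filterS _ \oo _ (fun k => (k.+1%:R : R)^-1 != 0 -> A (k.+1%:R)^-1)) H => k.
  by apply; rewrite invr_eq0 pnatr_eq0.
have dq : (t^-1 *: (((fun x => f x 0 i) \o shift s) (t *: 1) - f s 0 i) @[t --> (0 : R)^']
    --> 'D_1 (fun x => f x 0 i) s) by exact: di.
have := cvg_comp _ _ h_cvg dq.
apply: cvg_trans; apply: near_eq_cvg; apply: nearW => k /=.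
by rewrite /forward_quotient /GRing.scale/= mulr1 invrK (addrC s).
Qed.

(* The pointwise derivative [tangent f] has junk values on a null set and need
   not be measurable; the upper limit of the forward quotients is Borel. *)
Lemma exists_tangent_curve L f : arclength_embedded_closed_curve L f ->
  exists T, tangent_curve L f T /\ {ae mu, forall s, T s = tangent f s}.
Proof.
move=> [fL finj flip fae].
have clip i s t : `|f s 0 i - f t 0 i| <= `|s - t|.
  apply: norm_le_of_sqr => //; rewrite real_normK ?num_real//.
  have := coord_le_dotp (f s - f t) i; rewrite !mxE => /le_trans; apply.
  rewrite -enorm_sqr -[leRHS]real_normK ?num_real//.
  by rewrite ler_pXn2r// ?nnegrE// sqrtr_ge0.
have mf i : measurable_fun setT (fun s => f s 0 i).
  by apply: (@lipschitz_measurable _ _ 1) => s t; rewrite mul1r clip.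
pose T0 s i := limn_sup (forward_quotient f i ^~ s).
have fq1 i k s : `|forward_quotient f i k s| <= 1.
  rewrite /forward_quotient normrM ger0_norm// mulrC -ler_pdivlMr// div1r.
  by rewrite (le_trans (clip _ _ _))// addrAC subrr add0r ger0_norm.
have mT0 i : measurable_fun setT (T0 ^~ i).
  apply: measurable_fun_limn_sup.
  - by move=> s _; exists 1 => _ [k _ <-]; have := fq1 i k s; rewrite ler_norml => /andP[].
  - by move=> s _; exists (- 1) => _ [k _ <-]; have := fq1 i k s; rewrite ler_norml => /andP[].
  - move=> k; apply: measurable_funM => //; apply: measurable_funB => //.
    by apply: (measurableT_comp (mf i)); exact: measurable_funD.
have T0E s i : derivable f s 1 -> T0 s i = tangent f s 0 i.
  by move=> df; have := cvg_limn_inf_sup (cvg_forward_quotient (i := i) df) => -[].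
(* Supplies a unit vector as the value of [T] wherever the upper limits do not form one; it exists
   because the line is not a null set. *)
have [s0 s0P] : exists s0, derivable f s0 1 /\ enorm (tangent f s0) = 1.
  apply: contrapT => no.
  have : ~ {ae mu, forall s : R, False}.
    move=> [N [mN N0 sub]].
    have : (mu `[0%R, 1%R] <= mu N)%E.
      by apply: le_measure; rewrite ?inE//= => s _; apply: sub => /=.
    by rewrite N0 lebesgue_measure_itv/= lte_fin ltr01 oppr0 adde0 lee_fin ler10.
  apply; by apply: ae_imply fae => s sP; apply: no; exists s.
have e1 : dotp (tangent f s0) (tangent f s0) = 1.
  by rewrite -enorm_sqr s0P.2 expr1n.
pose T1 s : 'rV[R]_n := \row_i T0 s i.
pose T s := if dotp (T1 s) (T1 s) == 1 then T1 s else tangent f s0.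
have TE : {ae mu, forall s, T s = tangent f s}.
  apply: ae_imply fae => s [df fs1].
  have T1E : T1 s = tangent f s by apply/rowP => i; rewrite mxE T0E.
  by rewrite /T T1E -enorm_sqr fs1 expr1n eqxx.
exists T; split => //; split => //.
- move=> s; have TL : T1 (s + L) = T1 s.
    apply/rowP => i; rewrite !mxE; congr limn_sup; apply/funext => k.
    by rewrite /forward_quotient addrAC !fL.
  by rewrite /T TL.
- by move=> s; rewrite /T; case: ifP => [/eqP|].
- move=> i; rewrite (_ : (fun s => T s 0 i) = fun s =>
      if dotp (T1 s) (T1 s) == 1 then T0 s i else tangent f s0 0 i); last first.
    by apply/funext => s; rewrite /T; case: ifP; rewrite ?mxE.
  apply: measurable_fun_ifT => //.
  apply: measurable_fun_eqr => //.
  rewrite (_ : (fun s => _) = fun s => \sum_(j < n) T0 s j * T0 s j); last first.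
    by apply/funext => s; apply: eq_bigr => j _; rewrite !mxE.
  by apply: measurable_sum => j; apply: measurable_funM; exact: mT0.
- by apply: ae_imply2 fae TE => s [df _] -> i; exact: derivable_coord.
Qed.

Lemma tangent_curve_shift L f T a : tangent_curve L f T ->
  tangent_curve L (fun s => f (s + a)) (fun s => T (s + a)).
Proof.
move=> [[fL finj flip] TL T1 mT fae]; split => //.
- split.
  + by move=> s; rewrite addrAC fL.
  + by move=> s t /finj[k kE]; exists k; rewrite -kE; ring.
  + by move=> s t; rewrite (le_trans (flip _ _))// opprD addrACA subrr addr0.
- by move=> s; rewrite addrAC TL.
- by move=> i; apply: (measurableT_comp (mT i)); exact: measurable_funD.
- have := ae_measure_preserving (measurable_shift a) (lebesgue_measure_shift a) fae.
  apply: ae_imply => s H i.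
  have id1 : is_derive s (1 : R) (fun s : R => s + a) (1 : R).
    by apply: is_derive_eq; rewrite addr0.
  have := @is_derive1_comp _ (fun s => f s 0 i) (fun s => s + a) s _ _ (H i) id1.
  by rewrite mulr1.
Qed.

End borel_tangent.

Section torus_integral_facts.
Context {R : realType}.
Local Notation mu := (@lebesgue_measure R).
Variable L : R.
Implicit Types (K : R -> R -> R) (a : R).

Lemma lebesgue_measure_setT : mu setT = +oo%E.
Proof. by rewrite -set_itvNyy lebesgue_measure_itv. Qed.

Lemma lebesgue2X (A B : set (measurableTypeR R)) : measurable A -> measurable B ->
  lebesgue2 R (A `*` B) = (mu A * mu B)%E.
Proof. by move=> mA mB; exact: product_measure1E. Qed.

Lemma lebesgue2_setT : lebesgue2 R setT = +oo%E.
Proof. by rewrite -setXTT lebesgue2X// lebesgue_measure_setT mulyy. Qed.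

Lemma ae_lebesgue2 (P : R -> Prop) : {ae mu, forall s, P s} ->
  {ae lebesgue2 R, forall z, P z.1 /\ P z.2}.
Proof.
move=> [N [mN N0 PN]].
exists (N `*` setT `|` setT `*` N); split.
- by apply: measurableU; exact: measurableX.
- apply: (@null_set_setU _ _ _ (lebesgue2 R)); try exact: measurableX.
  + by rewrite lebesgue2X//= N0 mul0e.
  + by rewrite lebesgue2X//= N0 mule0.
- move=> z /= /not_andP[nP|nP]; [left|right]; split => //; exact: PN.
Qed.

Lemma torus_integral_ge0 K : (forall x t, 0 <= K x t) -> (0 <= torus_integral L K)%E.
Proof. by move=> K0; apply: integral_ge0 => z _; rewrite lee_fin. Qed.

Lemma torus_integral_fin K : (forall x t, 0 <= K x t) -> (torus_integral L K < +oo)%E ->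
  torus_integral L K = (fine (torus_integral L K))%:E.
Proof. by move=> K0 Koo; rewrite fineK// ge0_fin_numE// torus_integral_ge0. Qed.

Lemma measurable_torus : measurable (torus L : set (measurableTypeR R * measurableTypeR R)).
Proof. by apply: measurableX; exact: measurable_itv. Qed.

Lemma torus_integrable K A : kern L K -> (forall x t, 0 <= K x t) ->
  torus_integral L K = A%:E ->
  (lebesgue2 R).-integrable (torus L) (EFin \o (fun z : R * R => K z.1 z.2)).
Proof.
move=> [mK _ _ _] K0 KA; apply/integrableP; split.
  by apply/measurable_EFinP; exact: measurable_funTS.
rewrite (_ : (\int[_]_(x in _) _)%E = torus_integral L K); first by rewrite KA ltry.
by apply: eq_integral => z _; rewrite /= ger0_norm.
Qed.

Lemma torus_integralB K1 K2 A B : kern L K1 -> kern L K2 ->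
  (forall x t, 0 <= K1 x t) -> (forall x t, 0 <= K2 x t) ->
  torus_integral L K1 = A%:E -> torus_integral L K2 = B%:E ->
  torus_integral L (fun x t => K1 x t - K2 x t) = (A - B)%:E.
Proof.
move=> k1 k2 K10 K20 K1A K2B; rewrite EFinB -K1A -K2B /torus_integral.
under eq_integral do rewrite EFinB.
apply: integralB_EFin; [exact: measurable_torus|..].
- exact: torus_integrable K1A.
- exact: torus_integrable K2B.
Qed.

(** In the coordinates (t, h) a shift along the diagonal moves t alone, and the integrand is
    periodic in t at fixed h. *)
Lemma torus_integral_shift K a : 0 < L -> kern L K -> kern L (fun x t => K (x + a) (t + a)) ->
  (forall x t, 0 <= K x t) -> (forall x t, K x t = K t x) ->
  torus_integral L (fun x t => K (x + a) (t + a)) = torus_integral L K.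
Proof.
move=> L0 kK kKa K0 Ksym; rewrite (torus_fold L0 kKa (fun _ _ => K0 _ _) (fun _ _ => Ksym _ _)).
rewrite (torus_fold L0 kK K0 Ksym); congr (_ * _)%E.
apply: eq_integral => h _.
rewrite -(@integral_periodic_shift _ a L (fun t => (K (t + h) t)%:E))//.
- by apply: eq_integral => t _; rewrite addrAC.
- by apply/measurable_EFinP; exact: kern_measurable_slice kK.
- by move=> t; case: kK => _ pl pr _; rewrite addrAC pl pr.
Qed.

End torus_integral_facts.

(** * The energies as torus integrals of the kernels *)

Section curve_energies.
Context {R : realType} {n : nat}.
Local Notation mu := (@lebesgue_measure R).
Variables (L : R) (f T : R -> 'rV[R]_n).
Hypothesis fT : tangent_curve L f T.

Let T1 s : dotp (T s) (T s) = 1. Proof. by case: fT. Qed.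

Lemma log_distortionE x t : log_distortion L f x t = logdist L f x t.
Proof.
rewrite /log_distortion /logdist /chord enorm_sqr -/(sqchord f x t).
(* At coinciding points both sides are 0, since 1 / 0 and ln 0 are 0. *)
have [D0|D0] := eqVneq (sqchord f x t) 0.
  by rewrite D0 (circle_dist_eq0 fT D0) invr0 mulr0 !ln0// mulr0 subrr.
have Dp : 0 < sqchord f x t by rewrite lt_neqAle eq_sym D0 sqchord_ge0.
have dp : 0 < circle_dist L x t.
  rewrite lt_neqAle circle_dist_ge0 andbT eq_sym; apply/eqP => d0.
  have := sqchord_le_circle_dist fT x t.
  by rewrite d0 expr0n/= leNgt Dp.
by rewrite ln_div ?posrE ?exprn_gt0// lnXn// mulr_natl.
Qed.

Hypothesis TE : {ae mu, forall s, T s = tangent f s}.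

Lemma M0_M1_M2E x t : T x = tangent f x /\ T t = tangent f t ->
  [/\ M0 f x t = m0 f T x t, M1 f x t = m1 f T x t &
      M2 f x t = m0 f T x t - m1 f T x t].
Proof.
move=> [Tx Tt].
have key : dotp (T x - T t) (T x - T t) = 2 - 2 * dotp (T x) (T t).
  by rewrite !dotp_expand !T1 (dotpC (T t)); ring.
rewrite /M0 /M1 /M2 /cos_conformal_angle /dotp_wedge /chord_dir -Tx -Tt /chord.
rewrite /m0 /m1 /ccos /dlog1 /dlog2 /tcos /sqchord.
rewrite !(enorm_sqr (T x - T t)) key -(enorm_sqr (f x - f t)).
move: (f x - f t) => w; rewrite !dotpZr !dotpZl (dotpC w (T t)) -(enorm_sqr w).
move: (enorm w) (dotp (T x) w) (dotp (T t) w) (dotp (T x) (T t)) => e p q c.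
(* For a chord of length 0 all the densities vanish, being divided by 0. *)
have [->|e0] := eqVneq e 0; first by rewrite expr0n/= mulr0 invr0; split; ring.
by split; field.
Qed.

Lemma energies_tangent_curve :
  [/\ E0 L f = torus_integral L (m0 f T), E1 L f = torus_integral L (m1 f T) &
      E2 L f = torus_integral L (fun x t => m0 f T x t - m1 f T x t)].
Proof.
have ae2 := ae_lebesgue2 TE.
split; apply: ae_eq_integral_any; apply: ae_imply ae2 => -[x t] /= /M0_M1_M2E[H0 H1 H2] _.
- by rewrite H0.
- by rewrite H1.
- by rewrite H2.
Qed.

End curve_energies.

Section energy_bounds.
Context {R : realType} {n : nat}.
Variable L : R.
Hypothesis L0 : 0 < L.
Implicit Types (f g T U : R -> 'rV[R]_n).

Lemma torus_Linfty_ae (h : R -> R -> R) K : torus_Linfty L h = K%:E ->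
  0 <= K /\ {ae lebesgue2 R, forall z, torus L z -> `|h z.1 z.2| <= K}.
Proof.
move=> hK; have K0 : 0 <= K.
  rewrite -lee_fin -hK; exact: Lnorm_ge0.
(* At exponent +oo the norm is an essential supremum provided that the whole space has positive
   measure, hence [lebesgue2_setT]. *)
split => //; move: hK; rewrite /torus_Linfty unlock lebesgue2_setT ltry => hK.
have := ess_sup_inf.ess_sup_ge (lebesgue2 R) (abse \o ((fun s => (h s.1 s.2)%:E) \_ (torus L))).
rewrite hK; apply: ae_imply => z /= + Lz.
by rewrite patchE mem_set//= lee_fin.
Qed.

Lemma torus_m1_fin f T E : tangent_curve L f T -> torus_integral L (m0 f T) = E%:E ->
  exists F, torus_integral L (m1 f T) = F%:E.
Proof.
move=> fT fE; have [C stripC] := strip_m1_bounded L0 fT fE.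
exists (fine (torus_integral L (m1 f T))); apply: torus_integral_fin; first exact: m1_ge0 fT.
apply: (@le_lt_trans _ _ (2 * C)%:E); last exact: ltry.
apply: torus_le stripC => //; [exact: kern_m1 fT|exact: m1_ge0 fT|exact: m1C].
Qed.

Lemma torus_logdist_fin f T E : tangent_curve L f T -> torus_integral L (m0 f T) = E%:E ->
  exists J, torus_integral L (fun x t => logdist L f x t / circle_dist L x t ^+ 2) = J%:E.
Proof.
move=> fT fE; pose V x t := logdist L f x t / circle_dist L x t ^+ 2; rewrite -/V.
have V0 x t : 0 <= V x t by rewrite divr_ge0 ?sqr_ge0// (logdist_ge0 fT).
exists (fine (torus_integral L V)); apply: torus_integral_fin => //.
apply: (@le_lt_trans _ _ (2 * (E / 2 + 2))%:E); last exact: ltry.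
apply: torus_le => //; last exact: (strip_logdist_le L0 fT fE).
- exact: kernM (kern_logdist L0 fT) (kern_inv_dist2 L0).
- by move=> x t; rewrite /V logdistC circle_distC.
Qed.

Lemma finite_energy_curve f : arclength_embedded_closed_curve L f -> (E0 L f < +oo)%E ->
  exists T E F, [/\ tangent_curve L f T,
    torus_integral L (m0 f T) = E%:E /\ torus_integral L (m1 f T) = F%:E &
    [/\ E0 L f = E%:E, E1 L f = F%:E & E2 L f = (E - F)%:E]].
Proof.
move=> fc; have [T [fT TE]] := exists_tangent_curve fc.
have [-> -> ->] := energies_tangent_curve fT TE => Eoo.
have fE := torus_integral_fin (m0_ge0 fT) Eoo.
have [F fF] := torus_m1_fin fT fE.
exists T, (fine (torus_integral L (m0 f T))), F; split => //; split => //.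
by apply: torus_integralB fF => //; [exact: kern_m0 fT|exact: kern_m1 fT|exact: m0_ge0 fT|exact: m1_ge0 fT].
Qed.

(** A shift changes neither energy of g, so [energy_gap_le] applies to f and the shifted curve, with
    the norm of the difference of the two X as [K]. *)
Lemma energy_gap_shift f T g U E F E' F' a : tangent_curve L f T -> tangent_curve L g U ->
  torus_integral L (m0 f T) = E%:E -> torus_integral L (m1 f T) = F%:E ->
  torus_integral L (m0 g U) = E'%:E -> torus_integral L (m1 g U) = F'%:E ->
  (`|(E - F) - (E' - F')|%:E <= 2%:E *
    (torus_Linfty L (log_distortion_diff L f g a) * (E%:E + E'%:E + 4%:E) +
     `|torus_integral L (fun s1 s2 =>
        (log_distortion_diff L f g a s1 s2 / circle_dist L s1 s2 ^+ 2)%R)|))%E.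
Proof.
move=> fT gU fE fF gE gF.
have gUa := tangent_curve_shift a gU.
set ga := fun s => g (s + a) in gUa *; set Ua := fun s => U (s + a) in gUa *.
have gEa : torus_integral L (m0 ga Ua) = E'%:E.
  rewrite -gE; exact: (@torus_integral_shift _ L (m0 g U) a L0 (kern_m0 L0 gU)
    (kern_m0 L0 gUa) (m0_ge0 gU) (m0C g U)).
have gFa : torus_integral L (m1 ga Ua) = F'%:E.
  rewrite -gF; exact: (@torus_integral_shift _ L (m1 g U) a L0 (kern_m1 L0 gU)
    (kern_m1 L0 gUa) (m1_ge0 gU) (m1C g U)).
have [J fJ] := torus_logdist_fin fT fE.
have [J' gJ] := torus_logdist_fin gUa gEa.
have E_ge0 : 0 <= E by rewrite -lee_fin -fE; apply: torus_integral_ge0; exact: m0_ge0 fT.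
have E'_ge0 : 0 <= E' by rewrite -lee_fin -gE; apply: torus_integral_ge0; exact: m0_ge0 gU.
have XE x t : log_distortion_diff L f g a x t = logdist L f x t - logdist L ga x t.
  by rewrite /log_distortion_diff (log_distortionE fT) (log_distortionE gUa).
have -> : torus_integral L (fun s1 s2 =>
    log_distortion_diff L f g a s1 s2 / circle_dist L s1 s2 ^+ 2) = (J - J')%:E.
  rewrite -(torus_integralB _ _ _ _ fJ gJ).
  - by apply: eq_integral => z _; rewrite XE mulrBl.
  - exact: kernM (kern_logdist L0 fT) (kern_inv_dist2 L0).
  - exact: kernM (kern_logdist L0 gUa) (kern_inv_dist2 L0).
  - by move=> x t; rewrite divr_ge0 ?sqr_ge0// (logdist_ge0 fT).
  - by move=> x t; rewrite divr_ge0 ?sqr_ge0// (logdist_ge0 gUa).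
case NE : torus_Linfty => [K| |].
- have [K0 XK] := torus_Linfty_ae NE.
  have YK : {ae lebesgue2 R, forall z, torus L z ->
      `|logdist L f z.1 z.2 - logdist L ga z.1 z.2| <= K}.
    by apply: ae_imply XK => z + Lz => /(_ Lz); rewrite XE.
  have := energy_gap_le L0 fT gUa fE gEa fF gFa fJ gJ K0 YK.
  rewrite -!EFinD -!EFinM/= lee_fin => /le_trans; apply.
  by rewrite normrM ger0_norm// -mulrDr.
(* Infinite norm: since E + E' + 4 > 0, the right-hand side is +oo. *)
- rewrite -!EFinD mulyr gtr0_sg ?mul1e; last by rewrite ltr_wpDl// addr_ge0.
  by rewrite addye// gt0_muley ?lte_fin// leey.
- have : (0 <= torus_Linfty L (log_distortion_diff L f g a))%E by exact: Lnorm_ge0.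
  by rewrite NE.
Qed.

End energy_bounds.
Theorem theorem3p1 (R : realType) (n : nat) (L : R) (f ft : R -> 'rV[R]_n)
    (L_gt0 : 0 < L)
    (f_curve : arclength_embedded_closed_curve L f)
    (ft_curve : arclength_embedded_closed_curve L ft)
    (E0f_fin : (E0 L f < +oo)%E)
    (E0ft_fin : (E0 L ft < +oo)%E) :
  (`|E1 L f - E1 L ft| <= `|E0 L f - E0 L ft| +
     2%:E * ereal_inf
       [set torus_Linfty L (log_distortion_diff L f ft a) *
              (E0 L f + E0 L ft + 4%:E) +
            `|torus_integral L (fun s1 s2 =>
                (log_distortion_diff L f ft a s1 s2 /
                 circle_dist L s1 s2 ^+ 2)%R)| | a in [set: R]])%E
  /\
  (`|E2 L f - E2 L ft| <=
     2%:E * ereal_inf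
       [set torus_Linfty L (log_distortion_diff L f ft a) *
              (E0 L f + E0 L ft + 4%:E) +
            `|torus_integral L (fun s1 s2 =>
                (log_distortion_diff L f ft a s1 s2 /
                 circle_dist L s1 s2 ^+ 2)%R)| | a in [set: R]])%E.
Proof.
have [T [E [F [fT [fE fF] [E0f E1f E2f]]]]] := finite_energy_curve L_gt0 f_curve E0f_fin.
have [U [E' [F' [gU [gE gF] [E0g E1g E2g]]]]] := finite_energy_curve L_gt0 ft_curve E0ft_fin.
rewrite E1f E1g E2f E2g E0f E0g.
set I := ereal_inf _.
have gap : (`|(E - F) - (E' - F')|%:E <= 2%:E * I)%E.
  rewrite -lee_pdivrMl//; apply/ereal_infP => _ [a _ <-].
  by rewrite lee_pdivrMl//; exact: (energy_gap_shift L_gt0 a fT gU fE fF gE gF).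
split; last by rewrite -EFinB.
apply: (@le_trans _ _ (`|E - E'|%:E + `|(E - F) - (E' - F')|%:E)%E); last first.
  by rewrite -EFinB/= leeD2l.
(* E1 is E0 minus E2, so the gap in E1 is the gap in E0 minus the gap in E2. *)
rewrite -EFinB/= -EFinD lee_fin (_ : F - F' = (E - E') - (E - F - (E' - F'))); last by ring.
exact: ler_normB.
Qed.
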